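(* Every nonsingular Bernoulli shift on a finite set of symbols that is equipped with a product measure which satisfies the Doeblin condition has an i.i.d. factor. That is: let $A\subset\mathbb{R}$ be a finite set and let $\rho=\bigotimes_{i\in\mathbb{Z}}\rho_i$ be a product probability measure on $A^{\mathbb{Z}}$ which is nonsingular for the left-shift $T$ and satisfies the Doeblin condition. Then the Bernoulli shift $(A^{\mathbb{Z}},\mathcal{B},\rho,T)$ has an i.i.d. system as a factor.
   Context: Let $A\subset\mathbb{R}$ and let $(\rho_i)_{i\in\mathbb{Z}}$ be a sequence of probability measures on $A$, with product measure $\rho=\bigotimes_{i\in\mathbb{Z}}\rho_i$ on $A^{\mathbb{Z}}$. The left-shift $T:A^{\mathbb{Z}}\to A^{\mathbb{Z}}$ is given by $(Tx)_i=x_{i+1}$, and $\mathcal{B}$ is the usual Borel product sigma-algebra. The system $(A^{\mathbb{Z}},\mathcal{B},\rho,T)$ is called a Bernoulli shift. The measure $\rho$ and the system are nonsingular if $\rho\circ T^{-1}$ is equivalent to $\rho$ (mutually absolutely continuous). The product measure $\rho$ satisfies the Doeblin condition if there exists $\delta>0$ such that $\rho_i(a)>\delta$ for all $a\in A$ and all $i\in\mathbb{Z}$. A Bernoulli shift is independent and identically distributed (i.i.d.) if the measures $\rho_i$ are all identical. For nonsingular product measures $\rho$ and $\nu$ on $A^{\mathbb{Z}}$, a factor from $\rho$ to $\nu$ is a measurable map $\phi:A^{\mathbb{Z}}\to A^{\mathbb{Z}}$ that is equivariant, $\phi\circ T=T\circ\phi$, and such that the push-forward $\rho\circ\phi^{-1}$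 is equivalent to $\nu$ (equality is not required). *)

(* Defs.v *)
From HB Require Import structures.
From mathcomp Require Import all_boot all_order all_algebra finmap.
From mathcomp Require Import all_classical all_reals all_analysis.

Set Implicit Arguments.
Unset Strict Implicit.
Unset Printing Implicit Defensive.

Import Order.TTheory GRing.Theory Num.Theory.

Local Open Scope classical_set_scope.
Local Open Scope ring_scope.

(* A [measurableType] must be pointed: the letter [a0] only records that the
   finite set [A] is nonempty, as any set carrying a probability measure is. *)
Definition letters (R : realType) (A : {fset R}) (a0 : A) : Type := A.

HB.instance Definition _ (R : realType) (A : {fset R}) (a0 : A) :=
  Choice.copy (letters a0) A.
HB.instance Definition _ (R : realType) (A : {fset R}) (a0 : A) :=
  isPointed.Build (letters a0) a0.

(* [A] with the trace of the Borel sigma-algebra of [R]. *)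
Definition alphabet (R : realType) (A : {fset R}) (a0 : A) :=
  g_sigma_algebra_preimageType
    (fun a : letters a0 => \val (a : A) : measurableTypeR R).

Section Shift.
Context {d : measure_display} {S : measurableType d} {R : realType}.

Definition coordinate_events : set (set (int -> S)) :=
  \bigcup_i preimage_set_system setT (fun x : int -> S => x i) measurable.

(* S^Z with the product sigma-algebra. *)
Definition seqZ := g_sigma_algebraType coordinate_events.

Definition left_shift (x : seqZ) : seqZ := fun i => x (i + 1).

(* [rho] is the product of the [rho_ i]; the values on finite-dimensional
   rectangles determine [rho] by the pi-lambda theorem. *)
Definition is_product_measure (rho_ : int -> probability S R)
    (rho : probability seqZ R) : Prop :=
  forall (I : {fset int}) (B : int -> set S),
    (forall i, measurable (B i)) ->
    rho [set x | forall i, i \in I -> B i (x i)] =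
      (\prod_(i <- I) rho_ i (B i))%E.

Definition measure_equiv (mu nu : set seqZ -> \bar R) : Prop :=
  mu `<< nu /\ nu `<< mu.

Definition nonsingular (rho : probability seqZ R) : Prop :=
  measure_equiv (pushforward rho left_shift) rho.

Definition doeblin (rho_ : int -> probability S R) : Prop :=
  exists2 delta : R, 0 < delta &
    forall i (a : S), (delta%:E < rho_ i [set a])%E.

(* The image measure need only be equivalent to [nu], not equal to it. *)
Definition is_factor (rho nu : probability seqZ R) (phi : seqZ -> seqZ)
    : Prop :=
  [/\ measurable_fun setT phi,
      phi \o left_shift = left_shift \o phi &
      measure_equiv (pushforward rho phi) nu].

Definition non_dirac (mu : probability S R) : Prop :=
  forall a : S, mu [set a] != 1%E.

End Shift.
Arguments seqZ {d} S.

(* Main.v *)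
Require Import Defs.
From HB Require Import structures.
From mathcomp Require Import all_boot all_order all_algebra finmap.
From mathcomp Require Import all_classical all_reals all_analysis.
From mathcomp Require Import zify ring lra.

Set Implicit Arguments.
Unset Strict Implicit.
Unset Printing Implicit Defensive.

Import Order.TTheory GRing.Theory Num.Theory.

Local Open Scope classical_set_scope.
Local Open Scope ring_scope.

(* Fix two letters a <> b and call an occurrence of one of the words aab(ab)b,
   aab(ba)b a mark. Given the sequence outside the bracketed pairs, these pairs
   are independent, and the pair of the mark i is ab with a probability t_i
   depending on rho_(i+3) and rho_(i+4) only. By Kakutani's dichotomy,
   nonsingularity makes the sum of (rho_i(c) - rho_(i+1)(c))^2 finite for every
   letter c, hence also that of (t_i - 1/2)^2; so, up to an equivalent change of
   measure, the marks carry independent fair coins.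

   The coins are turned into an i.i.d. sequence by a machine which scans the
   line from right to left. Each mark pushes its coin on a stack. The first marks
   of long runs of marks ("anchors") cut the line into intervals, themselves
   cut into blocks of N = 2^e sites, and the first site of a block ("request")
   pops coins to sample N independent bits of a small parameter c, which takes
   fewer than four coins on average. For N large, marks outnumber four times the
   requests, so that the stack never runs out and each sample is determined by
   finitely many sites. For almost every x the bits sampled from fair coins are
   then i.i.d., so the equivalence of the two coin measures yields an image
   measure equivalent to an i.i.d. one. *)

(** Since [rho] need not be invariant, no ergodic theorem compares the frequencies of marks and
    requests. Anchors make the comparison sequence by sequence: an anchor comes with eight marks of
    its own, so that requests at anchors use at most half of the marks, and the other half pays for
    the remaining requests, at most one per [N] sites. Only a lower bound on the number of anchors
    is left to prove, and the Doeblin condition gives it.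

    Equivalence of measures preserves null sets but not laws. It is therefore used once, on the
    coins alone: with fair coins the output is exactly i.i.d. for every sequence with enough marks,
    and fair coins are exchanged for the true ones at the very end.

    Last in, first out is what makes samples local: entries pushed nearby hide everything below
    them, so that a sample which stays within them ignores the far right. As a sampler decides where
    to stop from the bits it has read, the unread bits remain fair.

    Producing [N] bits from fewer than four coins on average forces their entropy below [4 / N],
    whence a small parameter instead of fair output bits. *)

Definition scons (c : bool) (w : nat -> bool) : nat -> bool :=
  fun k => if k is k'.+1 then w k' else c.

Definition sshift (T : Type) (n : nat) (w : nat -> T) : nat -> T :=
  fun k => w (n + k)%N.

Definition finite_dep (T : Type) (n : nat) (g : (nat -> bool) -> T) :=
  forall w w', (forall k, (k < n)%N -> w k = w' k) -> g w = g w'.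

Lemma scons_sshift w : scons (w 0%N) (sshift 1 w) = w.
Proof. by apply/funext => -[]. Qed.

Lemma sshift_scons c w : sshift 1 (scons c w) = w.
Proof. by apply/funext => k; rewrite /sshift add1n. Qed.

Lemma sshift0 (T : Type) (w : nat -> T) : sshift 0 w = w.
Proof. by apply/funext. Qed.

Lemma sshift_sshift (T : Type) m n (w : nat -> T) :
  sshift m (sshift n w) = sshift (n + m) w.
Proof. by apply/funext => k; rewrite /sshift addnA. Qed.

Lemma finite_dep_scons (T : Type) n (g : (nat -> bool) -> T) c :
  finite_dep n.+1 g -> finite_dep n (fun w => g (scons c w)).
Proof. by move=> gn w w' ww'; apply: gn => -[|k]//= kn; apply: ww'. Qed.

Lemma finite_dep_le (T : Type) m n (g : (nat -> bool) -> T) :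
  (m <= n)%N -> finite_dep m g -> finite_dep n g.
Proof.
by move=> mn gm w w' ww'; apply: gm => k /leq_trans /(_ mn); exact: ww'.
Qed.

Lemma finite_dep_comp (T U : Type) n (g : (nat -> bool) -> T) (f : T -> U) :
  finite_dep n g -> finite_dep n (fun w => f (g w)).
Proof. by move=> gn w w' /gn ->. Qed.

Lemma finite_dep2 (T U V : Type) n (g : (nat -> bool) -> T)
    (g' : (nat -> bool) -> U) (f : T -> U -> V) :
  finite_dep n g -> finite_dep n g' -> finite_dep n (fun w => f (g w) (g' w)).
Proof. by move=> gn gn' w w' ww'; rewrite (gn _ _ ww') (gn' _ _ ww'). Qed.

Lemma finite_dep_sshift (T : Type) (l n : nat) (g : (nat -> bool) -> T) :
  finite_dep n g -> finite_dep (l + n)%N (fun w => g (sshift l w)).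
Proof. by move=> gn w w' ww'; apply: gn => k kn; apply: ww'; rewrite ltn_add2l. Qed.

(** * Finitely many independent bits *)

Section Expectation.
Variable R : realFieldType.
Implicit Types (p : nat -> R) (g h : (nat -> bool) -> R).

(* Expectation of [g] when the first [n] bits are independent, bit [k] being
   true with probability [p k], and the other bits are false. *)
Fixpoint bitsE p n g : R :=
  if n is n'.+1 then
    p 0%N * bitsE (sshift 1 p) n' (fun w => g (scons true w)) +
    (1 - p 0%N) * bitsE (sshift 1 p) n' (fun w => g (scons false w))
  else g (fun=> false).

Lemma bitsED p n g h : bitsE p n (fun w => g w + h w) = bitsE p n g + bitsE p n h.
Proof. by elim: n p g h => //= n IH p g h; rewrite !IH; ring. Qed.

Lemma bitsEZ p n c g : bitsE p n (fun w => c * g w) = c * bitsE p n g.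
Proof. by elim: n p g => //= n IH p g; rewrite !IH; ring. Qed.

Lemma bitsE_cst p n c : bitsE p n (fun=> c) = c.
Proof. by elim: n p => //= n IH p; rewrite !IH; ring. Qed.

Lemma bitsE_sum p n (I : Type) (r : seq I) (P : pred I) (g : I -> (nat -> bool) -> R) :
  bitsE p n (fun w => \sum_(i <- r | P i) g i w) =
  \sum_(i <- r | P i) bitsE p n (g i).
Proof.
elim: r => [|i r IH].
  rewrite big_nil -[RHS](bitsE_cst p n 0); congr bitsE.
  by apply/funext => w; rewrite big_nil.
rewrite big_cons -IH; case: ifP => Pi.
  rewrite -bitsED; congr bitsE; apply/funext => w; by rewrite big_cons Pi.
by congr bitsE; apply/funext => w; rewrite big_cons Pi.
Qed.

Lemma ler_bitsE p n g h : (forall k, 0 <= p k <= 1) -> (forall w, g w <= h w) ->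
  bitsE p n g <= bitsE p n h.
Proof.
elim: n p g h => [|n IH] p g h p01 gh /=; first exact: gh.
have /andP[p0 p1] := p01 0%N.
have p01' k : 0 <= sshift 1 p k <= 1 by exact: p01.
by apply: lerD; apply: ler_wpM2l; rewrite ?subr_ge0//; apply: IH => // w; exact: gh.
Qed.

Lemma bitsE_ge0 p n g : (forall k, 0 <= p k <= 1) -> (forall w, 0 <= g w) ->
  0 <= bitsE p n g.
Proof. by move=> p01 g0; rewrite -(bitsE_cst p n 0); apply: ler_bitsE. Qed.

Lemma bitsE_dep p n m g : finite_dep n g -> (n <= m)%N -> bitsE p m g = bitsE p n g.
Proof.
elim: n m p g => [|n IH] [|m] p g gn //=.
  move=> _; rewrite -[RHS](bitsE_cst (sshift 1 p) m).
  have gE c : (fun w => g (scons c w)) = (fun=> g (fun=> false)).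
    by apply/funext => w; apply: gn.
  by rewrite !gE; ring.
rewrite ltnS => nm; rewrite !(IH m)//; exact: finite_dep_scons.
Qed.

Lemma bitsE_sshift (c : R) k n g :
  bitsE (fun=> c) (k + n) (fun w => g (sshift k w)) = bitsE (fun=> c) n g.
Proof.
elim: k g => [|k IH] g; first by rewrite add0n.
have E e : (fun w => g (sshift k.+1 (scons e w))) = (fun w => g (sshift k w)).
  by apply/funext.
by rewrite addSn /= !E IH; ring.
Qed.

End Expectation.

(** * Comparison of two product laws on finitely many bits *)

Section FiniteKakutani.
Variable R : rcfType.
Implicit Types (p : nat -> R) (g : (nat -> bool) -> R).

(** Cauchy-Schwarz for [g] times the likelihood ratio of [p'] to [p]; the product is the second
    moment of this ratio, which factorizes over the bits. The induction applies the two-point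
    inequality to the first bit. *)
Lemma bitsE_sqr_le p p' n g : (forall k, 0 < p k < 1) -> (forall k, 0 <= p' k <= 1) ->
  (bitsE p' n g) ^+ 2 <=
  (\prod_(k < n) (p' k ^+ 2 / p k + (1 - p' k) ^+ 2 / (1 - p k))) *
  bitsE p n (fun w => g w ^+ 2).
Proof.
elim: n p p' g => [|n IH] p p' g p01 p'01 /=; first by rewrite big_ord0 mul1r.
rewrite big_ord_recl.
set C := \prod_(i < n) _.
have IHp c := IH (sshift 1 p) (sshift 1 p') (fun w => g (scons c w))
  (fun k => p01 _) (fun k => p'01 _).
have C0 : 0 <= C.
  apply: prodr_ge0 => i _; have /andP[? ?] := p01 (bump 0 i).
  by apply: addr_ge0; rewrite divr_ge0 ?sqr_ge0// ?subr_ge0 ltW.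
have /= := IHp true; have /= := IHp false.
rewrite -/C.
have /andP[p0 p1] := p01 0%N; have /andP[p'0 p'1] := p'01 0%N.
set a := bitsE (sshift 1 p') n _; set A := bitsE (sshift 1 p) n _.
set b := bitsE (sshift 1 p') n _; set B := bitsE (sshift 1 p) n _.
set x := p 0%N in p0 p1 *; set y := p' 0%N in p'0 p'1 *.
move=> aA bB.
have x1 : 0 < 1 - x by rewrite subr_gt0.
have : (y * b + (1 - y) * a) ^+ 2 <=
    (y ^+ 2 / x + (1 - y) ^+ 2 / (1 - x)) * (x * b ^+ 2 + (1 - x) * a ^+ 2).
  rewrite -subr_ge0.
  (* Lagrange's identity: the defect in Cauchy-Schwarz is a square. *)
  have -> : (y ^+ 2 / x + (1 - y) ^+ 2 / (1 - x)) * (x * b ^+ 2 + (1 - x) * a ^+ 2) -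
    (y * b + (1 - y) * a) ^+ 2 =
    (y * (1 - x) * a - (1 - y) * x * b) ^+ 2 / (x * (1 - x)).
    by field; rewrite ?gt_eqF//.
  by rewrite divr_ge0 ?sqr_ge0// mulr_ge0// ltW.
move=> /le_trans; apply.
rewrite -mulrA; apply: ler_wpM2l.
  by apply: addr_ge0; rewrite divr_ge0 ?sqr_ge0// ltW.
by rewrite mulrDr !(mulrCA C); apply: lerD; apply: ler_wpM2l => //; exact: ltW.
Qed.

(** [g] is the likelihood ratio test between the two laws. The weights [al] and [be] carry the
    likelihoods of the bits already read; once all bits are read, the smaller weight is the error,
    and it is at most the geometric mean. *)
Lemma bitsE_hellinger p p' n (al be : R) :
  (forall k, 0 <= p k <= 1) -> (forall k, 0 <= p' k <= 1) ->
  0 <= al -> 0 <= be ->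
  exists g : (nat -> bool) -> bool, finite_dep n g /\
    al * bitsE p n (fun w => (g w)%:R) + be * bitsE p' n (fun w => (~~ g w)%:R) <=
    Num.sqrt (al * be) *
    \prod_(k < n) (Num.sqrt (p k * p' k) + Num.sqrt ((1 - p k) * (1 - p' k))).
Proof.
elim: n p p' al be => [|n IH] p p' al be p01 p'01 al0 be0 /=.
  exists (fun=> al <= be); split=> //.
  rewrite big_ord0 mulr1; case: (leP al be) => ab /=; rewrite ?mulr1 ?mulr0 ?addr0 ?add0r.
    by rewrite -[leLHS]ger0_norm// -sqrtr_sqr ler_wsqrtr// expr2 ler_wpM2l.
  rewrite -[leLHS]ger0_norm// -sqrtr_sqr ler_wsqrtr// expr2 ler_wpM2r//.
  exact: ltW.
have /andP[p0 p1] := p01 0%N; have /andP[p'0 p'1] := p'01 0%N.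
have q0 : 0 <= 1 - p 0%N by rewrite subr_ge0.
have q'0 : 0 <= 1 - p' 0%N by rewrite subr_ge0.
have [g1 [dg1 h1]] := IH (sshift 1 p) (sshift 1 p') (al * p 0%N) (be * p' 0%N)
  (fun k => p01 _) (fun k => p'01 _) (mulr_ge0 al0 p0) (mulr_ge0 be0 p'0).
have [g0 [dg0 h0]] := IH (sshift 1 p) (sshift 1 p') (al * (1 - p 0%N)) (be * (1 - p' 0%N))
  (fun k => p01 _) (fun k => p'01 _) (mulr_ge0 al0 q0) (mulr_ge0 be0 q'0).
exists (fun w => if w 0%N then g1 (sshift 1 w) else g0 (sshift 1 w)); split.
  move=> w w' ww'; rewrite (ww' 0%N)//; case: (w' 0%N).
    by apply: dg1 => k kn; apply: ww'; rewrite add1n.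
  by apply: dg0 => k kn; apply: ww'; rewrite add1n.
move: h1 h0; rewrite big_ord_recl.
set C := \prod_(i < n) _.
rewrite /= => h1 h0.
have E1 : Num.sqrt (al * p 0%N * (be * p' 0%N)) = Num.sqrt (al * be) * Num.sqrt (p 0%N * p' 0%N).
  by rewrite -sqrtrM ?mulr_ge0//; congr Num.sqrt; ring.
have E0 : Num.sqrt (al * (1 - p 0%N) * (be * (1 - p' 0%N))) =
    Num.sqrt (al * be) * Num.sqrt ((1 - p 0%N) * (1 - p' 0%N)).
  by rewrite -sqrtrM ?mulr_ge0//; congr Num.sqrt; ring.
rewrite E1 in h1; rewrite E0 in h0.
have := lerD h1 h0.
have S (G : bool -> (nat -> bool) -> bool) c :
    (fun w => (G c (sshift 1 (scons c w)))%:R : R) = (fun w => (G c w)%:R).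
  by apply/funext => w; rewrite sshift_scons.
rewrite (S (fun=> g1) true) (S (fun=> g0) false).
rewrite (S (fun _ w => ~~ g1 w) true) (S (fun _ w => ~~ g0 w) false).
move=> H; apply: (le_trans _ (le_trans H _)); rewrite -subr_ge0; last first.
  by rewrite le_eqVlt; apply/orP; left; apply/eqP; ring.
by rewrite le_eqVlt; apply/orP; left; apply/eqP; ring.
Qed.

Lemma hellinger_affinity_le (x y : R) : 0 <= x <= 1 -> 0 <= y <= 1 ->
  Num.sqrt (x * y) + Num.sqrt ((1 - x) * (1 - y)) <= 1 - (x - y) ^+ 2 / 2.
Proof.
move=> /andP[x0 x1] /andP[y0 y1].
have x'0 : 0 <= 1 - x by rewrite subr_ge0.
have y'0 : 0 <= 1 - y by rewrite subr_ge0.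
have d1 : (x - y) ^+ 2 <= 1 by nra.
have r0 : 0 <= 1 - (x - y) ^+ 2 / 2 by lra.
set s := Num.sqrt (x * y); set t := Num.sqrt _.
have s2 : s ^+ 2 = x * y by rewrite sqr_sqrtr ?mulr_ge0.
have t2 : t ^+ 2 = (1 - x) * (1 - y) by rewrite sqr_sqrtr ?mulr_ge0.
have s0 : 0 <= s by exact: sqrtr_ge0.
have t0 : 0 <= t by exact: sqrtr_ge0.
(* AM-GM for [2 s t] gives [(s + t)^2 <= 1 - (x - y)^2]. *)
have st : 2 * (s * t) <= x * (1 - x) + y * (1 - y).
  rewrite -(@ler_pXn2r _ 2)// ?nnegrE ?addr_ge0 ?mulr_ge0//.
  have -> : (2 * (s * t)) ^+ 2 = 4 * (s ^+ 2 * t ^+ 2) by ring.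
  rewrite s2 t2 -subr_ge0.
  have -> : (x * (1 - x) + y * (1 - y)) ^+ 2 - 4 * (x * y * ((1 - x) * (1 - y))) =
    (x * (1 - x) - y * (1 - y)) ^+ 2 by ring.
  exact: sqr_ge0.
rewrite -(@ler_pXn2r _ 2)// ?nnegrE ?addr_ge0//.
have -> : (s + t) ^+ 2 = s ^+ 2 + t ^+ 2 + 2 * (s * t) by ring.
rewrite s2 t2; have := sqr_ge0 ((x - y) ^+ 2 / 2); nra.
Qed.

End FiniteKakutani.

(** * Sampling from fair bits by a decision tree *)

Inductive tree (T : Type) := Leaf of T | Node of tree T & tree T.

Section Tree.
Variable T : Type.
Implicit Types (t : tree T) (w : nat -> bool).

Fixpoint tree_val t w : T :=
  match t with
  | Leaf v => v
  | Node a b => if w 0%N then tree_val a (sshift 1 w) else tree_val b (sshift 1 w)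
  end.

Fixpoint tree_depth t w : nat :=
  match t with
  | Leaf _ => 0
  | Node a b => (if w 0%N then tree_depth a (sshift 1 w) else tree_depth b (sshift 1 w)).+1
  end.

Definition tree_rest t w := sshift (tree_depth t w) w.

Fixpoint tree_height t : nat :=
  if t is Node a b then (maxn (tree_height a) (tree_height b)).+1 else 0.

(** Expectation over fair bits of a function of the output and of the number of bits read. The
    weight [1 - 2^-1] is left unsimplified to match the unfolding of [bitsE]. *)
Fixpoint treeE (R : realFieldType) t (h : T -> nat -> R) : R :=
  match t with
  | Leaf v => h v 0%N
  | Node a b => 2^-1 * treeE a (fun v d => h v d.+1) +
                (1 - 2^-1) * treeE b (fun v d => h v d.+1)
  end.

Lemma tree_rest_node a b w : tree_rest (Node a b) w =
  if w 0%N then tree_rest a (sshift 1 w) else tree_rest b (sshift 1 w).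
Proof. by rewrite /tree_rest /=; case: (w 0%N); rewrite sshift_sshift add1n. Qed.

Lemma tree_agree t w w' a : (tree_depth t w <= a)%N ->
    (forall k, (k < a)%N -> w k = w' k) ->
  [/\ tree_val t w' = tree_val t w, tree_depth t w' = tree_depth t w &
      forall k, (k < a - tree_depth t w)%N -> tree_rest t w k = tree_rest t w' k].
Proof.
elim: t w w' a => [v|t1 IH1 t2 IH2] w w' a /=.
  by move=> _ ww'; split => // k; rewrite subn0; exact: ww'.
case: a => [|a]; first by rewrite ltn0.
rewrite ltnS subSS !tree_rest_node => da ww'; rewrite -(ww' 0%N)//.
have ww1 k : (k < a)%N -> sshift 1 w k = sshift 1 w' k.
  by move=> ka; apply: ww'; rewrite add1n.
case: (w 0%N) da => da.
  by have [-> -> ?] := IH1 _ _ _ da ww1.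
by have [-> -> ?] := IH2 _ _ _ da ww1.
Qed.

Lemma tree_depth_le t w : (tree_depth t w <= tree_height t)%N.
Proof.
elim: t w => //= a IHa b IHb w; rewrite ltnS leq_max; case: (w 0%N).
  by rewrite IHa.
by rewrite IHb orbT.
Qed.

Lemma tree_dep U r (F : T -> nat -> (nat -> bool) -> U) t :
  (forall v d, finite_dep r (F v d)) ->
  finite_dep (tree_height t + r)
    (fun w => F (tree_val t w) (tree_depth t w) (tree_rest t w)).
Proof.
move=> Fr w w' ww'.
have le := leq_trans (tree_depth_le t w) (leq_addr r _).
have [-> -> h] := tree_agree le ww'.
apply: Fr => k kr; apply: h; have := tree_depth_le t w; lia.
Qed.

Lemma tree_law (R : realFieldType) t (h : T -> nat -> R) r g B :
  finite_dep r g -> (tree_height t + r <= B)%N ->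
  bitsE (fun=> 2^-1) B (fun w => h (tree_val t w) (tree_depth t w) *
                                 g (tree_rest t w)) =
  treeE t h * bitsE (fun=> 2^-1) r g.
Proof.
move=> gr; elim: t h B => [v|a IHa b IHb] h B /=.
  rewrite add0n => rB.
  have E w : tree_rest (Leaf v) w = w by exact: sshift0.
  under [X in bitsE _ _ X]funext do rewrite E.
  by rewrite bitsEZ (bitsE_dep _ gr).
case: B => [|B]; rewrite ?addSn ?ltn0// ltnS => leB.
have [leaB lebB] : (tree_height a + r <= B /\ tree_height b + r <= B)%N by lia.
rewrite /= [RHS]mulrDl -!mulrA -(IHa _ _ leaB) -(IHb _ _ lebB).
have E c w : tree_rest (Node a b) (scons c w) = if c then tree_rest a w else tree_rest b w.
  by rewrite tree_rest_node sshift_scons.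
under [X in _ * bitsE _ _ X + _]funext do rewrite E sshift_scons.
by under [X in _ + _ * bitsE _ _ X]funext do rewrite E sshift_scons.
Qed.

End Tree.

(** * A cheap sampler of many bits of small parameter *)

Section Sampler.
Variable R : realFieldType.

Lemma eq_treeE (T : Type) (t : tree T) (h h' : T -> nat -> R) :
  (forall v d, h v d = h' v d) -> treeE t h = treeE t h'.
Proof.
elim: t h h' => //= a IHa b IHb h h' hh'.
by rewrite (IHa _ (fun v d => h' v d.+1))// (IHb _ (fun v d => h' v d.+1)).
Qed.

Lemma treeEZ (T : Type) (t : tree T) (h : T -> nat -> R) c :
  treeE t (fun v d => c * h v d) = c * treeE t h.
Proof. by elim: t h => //= a IHa b IHb h; rewrite IHa IHb; ring. Qed.

(** Uniform choice in [l] by binary search, meant for lists of size [2 ^ d]. *)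
Fixpoint full_tree (T : Type) (x0 : T) d (l : seq T) : tree T :=
  if d is d'.+1 then
    Node (full_tree x0 d' (take (2 ^ d') l)) (full_tree x0 d' (drop (2 ^ d') l))
  else Leaf (head x0 l).

(** Exits with [x0] at the first [true], so that the possibly deep tree [t] is reached with
    probability [2^-k] only. *)
Fixpoint comb (T : Type) k (x0 : T) (t : tree T) : tree T :=
  if k is k'.+1 then Node (Leaf x0) (comb k' x0 t) else t.

Lemma treeE_full (T : Type) (x0 : T) d l (h : T -> nat -> R) :
  size l = (2 ^ d)%N ->
  treeE (full_tree x0 d l) h = 2^-1 ^+ d * \sum_(v <- l) h v d.
Proof.
elim: d l h => [|d IH] l h /=.
  by case: l => [|v []]//= _; rewrite big_seq1 mul1r.
rewrite expnS => sl.
have s1 : size (take (2 ^ d) l) = (2 ^ d)%N by rewrite size_takel// sl; lia.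
have s2 : size (drop (2 ^ d) l) = (2 ^ d)%N by rewrite size_drop sl; lia.
rewrite !IH//.
rewrite -[in RHS](cat_take_drop (2 ^ d) l) big_cat /= exprS.
have -> : 1 - 2^-1 = 2^-1 :> R by field.
by rewrite mulrDr !mulrA.
Qed.

Lemma treeE_comb (T : Type) k (x0 : T) t (h : T -> R) :
  treeE (comb k x0 t) (fun v _ => h v) =
  (1 - 2^-1 ^+ k) * h x0 + 2^-1 ^+ k * treeE t (fun v _ => h v).
Proof.
elim: k => [|k IH] /=; first by rewrite expr0 subrr mul0r add0r mul1r.
by rewrite IH exprS; field.
Qed.

Lemma treeE_comb_exp (T : Type) k (x0 : T) t (theta : R) :
  let e j := treeE (comb j x0 t) (fun _ d => theta ^+ d) in
  e k.+1 = theta * (1 + e k) / 2.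
Proof.
move=> e; rewrite /e /= expr1.
under eq_treeE do rewrite exprS.
by rewrite treeEZ; field.
Qed.

(** Multiplicities in [C] act as weights: a uniform choice in [words C n] is a sequence of [n]
    independent uniform choices in [C]. *)
Fixpoint words (C : seq bool) n : seq (seq bool) :=
  if n is n'.+1 then [seq c :: v | c <- C, v <- words C n'] else [:: [::]].

Lemma size_words C n : size (words C n) = (size C ^ n)%N.
Proof. by elim: n => //= n IH; rewrite size_allpairs IH expnS. Qed.

Lemma sum_words C n (f : nat -> bool -> R) :
  \sum_(v <- words C n) \prod_(j < n) f j (nth false v j) =
  \prod_(j < n) \sum_(c <- C) f j c.
Proof.
elim: n f => [|n IH] f /=; first by rewrite big_seq1 !big_ord0.
rewrite big_allpairs_dep big_ord_recl mulr_suml; apply: eq_bigr => c _.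
under eq_bigr do rewrite big_ord_recl /=.
rewrite -mulr_sumr; congr (_ * _).
exact: (IH (fun j => f j.+1)).
Qed.

Lemma count_words C n :
  count_mem (nseq n false) (words C n) = (count_mem false C ^ n)%N.
Proof.
elim: n => //= n IH; rewrite expnS -IH; move: (words C n) => W.
elim: C {IH} => //= c C IHC; rewrite count_cat IHC mulnDl; congr addn.
rewrite count_map; case: c => /=.
  by rewrite mul0n; apply/eqP; rewrite eqn0Ngt -has_count; apply/hasPn.
rewrite mul1n; apply: eq_count => v /=.
by rewrite eqseq_cons eqxx.
Qed.

(** Union bound: among the words of length [n.+1] over [a] letters, those that contain a given
    letter number at most [n.+1 * a ^ n]. *)
Lemma expn_pred_ge a n : (a ^ n.+1 <= a.-1 ^ n.+1 + n.+1 * a ^ n)%N.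
Proof.
elim: n => [|n IH]; first by rewrite !expn1 expn0 muln1; lia.
have h : (a.-1 ^ n.+1 <= a ^ n.+1)%N by rewrite leq_exp2r// leq_pred.
rewrite expnS (leq_trans (leq_mul (leqnn a) IH))// mulnDr.
have -> : (a * (n.+1 * a ^ n) = n.+1 * a ^ n.+1)%N by rewrite expnS; lia.
rewrite [in leqRHS](expnS a.-1); move: (a.-1 ^ n.+1)%N (a ^ n.+1)%N h => X Y XY.
by case: a {IH} => [|a] /=; nia.
Qed.

Lemma perm_nseq_cat (T : eqType) (x : T) c (l : seq T) :
  (c <= count_mem x l)%N ->
  exists l', perm_eq l (nseq c x ++ l').
Proof.
move=> cl; exists (nseq (count_mem x l - c) x ++ seq.filter (predC1 x) l).
rewrite catA -nseqD subnKC//.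
have -> : nseq (count_mem x l) x = seq.filter (pred1 x) l.
  rewrite -size_filter; apply/esym/all_pred1P/allP => y.
  by rewrite mem_filter => /andP[].
by rewrite perm_sym; apply/permPl; exact: (perm_filterC (pred1 x)).
Qed.

(** Keeps the exponential moment with base [1 + e] close to its linear part, so that it can be
    compared with a mean; the smallness of [e] absorbs the quadratic terms of the induction. *)
Lemma exp_1D_le (e : R) n : 0 <= e -> 2 ^+ n * e <= 1 ->
  (1 + e) ^+ n <= 1 + n%:R * e + 2 ^+ n * e ^+ 2.
Proof.
move=> e0; elim: n => [|n IH] h; first by rewrite !expr0 mul0r addr0 mul1r lerDl sqr_ge0.
have h2 : 2 ^+ n * e <= 1.
  by apply: le_trans h; rewrite ler_wpM2r// ler_weXn2l// ler1n.
have := IH h2; have nle : n%:R + 1 <= 2 ^+ n :> R.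
  by rewrite natr1 -natrX ler_nat; exact: ltn_expl.
move=> {}IH; rewrite [leLHS]exprS.
apply: (le_trans (ler_wpM2l _ IH)); first lra.
rewrite [2 ^+ n.+1]exprS -natr1; set P := 2 ^+ n in h h2 nle IH *.
have eP : 0 <= e * (1 - P * e) by rewrite mulr_ge0// subr_ge0.
have ne : 0 <= e ^+ 2 * (P - n%:R - P * e).
  by rewrite mulr_ge0 ?sqr_ge0//; lra.
rewrite -subr_ge0; apply: le_trans ne _; rewrite le_eqVlt; apply/orP; left; apply/eqP.
by ring.
Qed.

(* A sampler of [2 ^ a] independent bits of small parameter out of fair bits.
   It outputs zeros as soon as it reads a zero among its first [2 a + 2] bits
   and otherwise reads on, so that it reads less than four bits on average. *)
Lemma sampler_exists a : exists (t : tree (seq bool)) (theta q : R),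
  [/\ 1 < theta, 0 < q < 1,
      forall f : nat -> bool -> R,
        treeE t (fun v _ => \prod_(j < 2 ^ a) f j (nth false v j)) =
        \prod_(j < 2 ^ a) (q * f j true + (1 - q) * f j false) &
      treeE t (fun _ d => theta ^+ d) <= theta ^+ 4].
Proof.
(* The output bits have parameter [2^-m]. With [m = k + a], the nonzero words are at most
   [N * 2 ^ (m * (N - 1)) = 2 ^ D] of the [2 ^ d] equally likely ones, a proportion [2^-k]. The
   value of [k] ensures [D < 2 ^ k], so that reading [D] further bits in this rare case costs less
   than one bit on average. *)
pose N := (2 ^ a)%N; pose k := (2 * a + 2)%N; pose m := (k + a)%N.
pose d := (m * N)%N; pose D := (d - k)%N.
pose C := true :: nseq (2 ^ m - 1) false.
have sC : size C = (2 ^ m)%N by rewrite /= size_nseq; have := expn_gt0 2 m; lia.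
have cC : count_mem false C = (2 ^ m - 1)%N by rewrite /= count_nseq mul1n.
have N0 : (0 < N)%N by rewrite expn_gt0.
have kd : (k <= d)%N by rewrite /d /m; nia.
pose v0 := nseq N false.
have cnt : (2 ^ d - 2 ^ D <= count_mem v0 (words C N))%N.
  rewrite count_words cC subn1 leq_subLR.
  have := expn_pred_ge (2 ^ m) N.-1; rewrite prednK// -expnM -/d addnC.
  suff -> : (N * (2 ^ m) ^ N.-1 = 2 ^ D)%N by [].
  rewrite -expnM /N -expnD -/N; congr expn.
  by rewrite /D /d /m -subn1 mulnBr muln1; nia.
(* [2 ^ d - 2 ^ D] copies of [v0] are set aside for the comb; the [2 ^ D] words left in [l] are
   drawn by the full tree. *)
have [l lP] := perm_nseq_cat cnt.
have sl : size l = (2 ^ D)%N.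
  have := perm_size lP; rewrite size_cat size_nseq size_words sC -expnM -/d.
  by have : (2 ^ D <= 2 ^ d)%N by [rewrite leq_exp2l// leq_subr]; lia.
(* Small enough for both [2 ^+ D * e <= 1] and [(D + 4) * e <= 1]. *)
pose e : R := 2^-1 ^+ (D + 4).
have e0 : 0 < e by rewrite exprn_gt0// invr_gt0.
have eE n : 2 ^+ n * 2^-1 ^+ n = 1 :> R.
  by rewrite -exprMn mulfV ?expr1n// pnatr_eq0.
have half n : 2^-1 ^+ n <= 1 :> R by rewrite exprn_ile1 ?invr_ge0// invf_le1 ?ler1n.
exists (comb k v0 (full_tree v0 D l)), (1 + e), (2^-1 ^+ m); split.
- by rewrite ltrDl.
- rewrite exprn_gt0 ?invr_gt0//= exprn_ilt1 ?invr_ge0 ?invf_lt1 ?ltr1n//.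
  by rewrite /m /k; lia.
- move=> f; rewrite treeE_comb treeE_full// -/N.
  pose F v : R := \prod_(j < N) f j (nth false v j).
  rewrite -/(F v0) -[\sum_(v <- l) _]/(\sum_(v <- l) F v).
  have S : \sum_(v <- words C N) F v = (2 ^ d - 2 ^ D)%:R * F v0 + \sum_(v <- l) F v.
    rewrite (perm_big _ lP) big_cat big_nseq /=; congr (_ + _).
    by rewrite iter_addr_0 mulr_natl.
  have mE : 2 ^+ d = 2 ^+ D * 2 ^+ k :> R by rewrite -exprD subnK.
  (* The exit probability [1 - 2^-k] of the comb is exactly the proportion of the copies set aside,
     so the whole tree draws uniformly from all [2 ^ d] words. *)
  transitivity (2^-1 ^+ d * \sum_(v <- words C N) F v).
    rewrite S natrB ?leq_exp2l ?leq_subr// !natrX mE.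
    have -> : 2^-1 ^+ d = 2^-1 ^+ k * 2^-1 ^+ D :> R by rewrite -exprD subnKC.
    have := eE k; have := eE D; move: (2^-1 ^+ k) (2^-1 ^+ D) (2 ^+ k) (2 ^+ D).
    move=> x y x' y' yy' xx'; rewrite [RHS]mulrDr; congr (_ + _); last by ring.
    have -> : x * y * ((y' * x' - y') * F v0) = (y' * y) * (x' * x - x) * F v0 by ring.
    by rewrite yy' xx' mul1r.
  rewrite sum_words /d exprM -[in X in X * _ = _](card_ord N) -prodr_const -big_split.
  apply: eq_bigr => j _; rewrite big_cons big_nseq iter_addr_0 /=.
  rewrite -[f j false *+ _]mulr_natl.
  rewrite natrB ?expn_gt0// natrX.
  by have := eE m; move: (2^-1 ^+ m) (2 ^+ m) => x y yx;
    rewrite mulrDr mulrA mulrBr mulr1 [x * y]mulrC yx.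
- have DkE : (D.+1 <= 2 ^ k)%N.
    have : (3 * a + 2 <= 2 ^ (a + 2))%N.
      elim: (a) => // n IHn; rewrite addSn expnS; have := expn_gt0 2 n.
      by move: IHn; rewrite !(addn2 n) !expnS; lia.
    move=> h; have -> : (2 ^ k = 2 ^ (a + 2) * N)%N by rewrite -expnD; congr expn; lia.
    apply: leq_trans (leq_mul h (leqnn N)).
    have -> : (3 * a + 2 = m)%N by rewrite /m /k; lia.
    by rewrite /D -/d; have : (0 < k)%N by [rewrite /k; lia]; lia.
  have De : (D%:R + 4) * e <= 1.
    rewrite /e -natrD -[leRHS](eE (D + 4)) ler_wpM2r ?exprn_ge0 ?invr_ge0//.
    by rewrite -natrX ler_nat ltnW// ltn_expl.
  (* To first order in [e], one more tooth of the comb sends [c] to [1 + c / 2]; [c j] obeys the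
     recursion [c (j + 1) = 3 / 2 + c j / 2], whose extra [1 / 2] absorbs the quadratic term. The
     limit 3 leaves room below 4. *)
  pose c j : R := 3 + (D%:R + 1) * 2^-1 ^+ j.
  have cj j : treeE (comb j v0 (full_tree v0 D l)) (fun _ d => (1 + e) ^+ d) <= 1 + c j * e.
    elim: j => [|j IHj].
      rewrite /c expr0 mulr1 /= treeE_full// big_const_seq count_predT sl iter_addr_0.
      rewrite -[(1 + e) ^+ D *+ _]mulr_natl natrX mulrA [_ * 2 ^+ D]mulrC eE mul1r.
      have D1 : 2 ^+ D * e <= 1.
        by rewrite /e exprD mulrA eE mul1r.
      have := exp_1D_le (ltW e0) D1; move: (2 ^+ D) D1 => P D1; nra.
    rewrite treeE_comb_exp /c exprS; move: IHj; rewrite /c.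
    have := half j; have : 0 <= 2^-1 ^+ j :> R by rewrite exprn_ge0// invr_ge0.
    move: (2^-1 ^+ j) (treeE _ _) => x y x0 x1 IHj.
    have xe : (D%:R + 1) * x <= D%:R + 1 by rewrite ler_piMr// addr_ge0.
    nra.
  apply: (le_trans (cj k)).
  have ck : c k <= 4.
    have : (D%:R + 1) * 2^-1 ^+ k <= 1 :> R.
      rewrite natr1 -[leRHS](eE k) ler_wpM2r ?exprn_ge0 ?invr_ge0//.
      by rewrite -natrX ler_nat.
    by rewrite /c; lra.
  have := ler_wpM2r (ltW e0) ck; have := e0.
  have -> : (1 + e) ^+ 4 = 1 + 4 * e + e ^+ 2 * (6 + 4 * e + e ^+ 2) by ring.
  have := sqr_ge0 e; nra.
Qed.

End Sampler.

(** * The stack of unused bits *)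

Section Stack.
Variables (T : Type) (t : tree T).
Implicit Types (s q u z : nat -> bool).

(* Reading the sites from right to left: a request site ([q]) feeds the top of
   the stack to the sampler [t], then a source site ([s]) pushes its bit. *)
Definition stack_step (s q c : bool) (w : nat -> bool) : nat -> bool :=
  let w' := if q then tree_rest t w else w in if s then scons c w' else w'.

(* The stack left of the sites [0, ..., n - 1], when it is [z] on their right. *)
Fixpoint stack s q u n z : nat -> bool :=
  if n is n'.+1 then
    stack_step (s 0%N) (q 0%N) (u 0%N)
      (stack (sshift 1 s) (sshift 1 q) (sshift 1 u) n' z)
  else z.

(* The stack left of site [k], all the bits from [n] on being the initial stack. *)
Definition state s q u n k :=
  stack (sshift k s) (sshift k q) (sshift k u) (n - k) (sshift n u).

(* Lower bound for the number of entries of the stack that do not depend on [z]. *)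
Fixpoint stack_acc s q u n z : int :=
  if n is n'.+1 then
    stack_acc (sshift 1 s) (sshift 1 q) (sshift 1 u) n' z + (s 0%N : nat)%:Z -
    (if q 0%N then
       tree_depth t (stack (sshift 1 s) (sshift 1 q) (sshift 1 u) n' z) else 0%N)%:Z
  else 0.

Lemma stack_cat s q u m n z : stack s q u (m + n) z =
  stack s q u m (stack (sshift m s) (sshift m q) (sshift m u) n z).
Proof.
elim: m s q u => [|m IH] s q u /=; first by rewrite !sshift0.
by rewrite IH !sshift_sshift add1n.
Qed.

(** Bits enter the stack only at sources, so [mark_bits] may take any value off the marks. *)
Lemma eq_stack s q u u' n z : (forall k, s k -> u k = u' k) ->
  stack s q u n z = stack s q u' n z.
Proof.
elim: n s q u u' => //= n IH s q u u' uu'.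
rewrite (IH _ _ _ (sshift 1 u')); last by move=> k; exact: uu'.
by rewrite /stack_step; case: ifP => // s0; rewrite uu'.
Qed.

Lemma stack_eq_below (s q u s' q' u' : nat -> bool) n z :
  (forall k, (k < n)%N -> [/\ s k = s' k, q k = q' k & u k = u' k]) ->
  stack s q u n z = stack s' q' u' n z.
Proof.
elim: n s q u s' q' u' => //= n IH s q u s' q' u' h.
have [-> -> ->] := h 0%N (ltn0Sn _); congr (stack_step _ _ _ _).
by apply: IH => k kn; exact: (h k.+1 kn).
Qed.

Lemma stateS s q u n k : state s q u n.+1 k.+1 =
  state (sshift 1 s) (sshift 1 q) (sshift 1 u) n k.
Proof. by rewrite /state subSS !sshift_sshift !add1n. Qed.

Lemma state0S s q u n : state s q u n.+1 0 =
  stack_step (s 0%N) (q 0%N) (u 0%N) (state (sshift 1 s) (sshift 1 q) (sshift 1 u) n 0).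
Proof. by rewrite /state !subn0 !sshift0 /= !sshift_sshift add1n. Qed.

(** Each site consumes at most [tree_height t] entries. This crude bound serves to show that
    functions of the stack are [finite_dep]. *)
Lemma stack_agree s q u u' n z z' r : (forall k, (k < n)%N -> u k = u' k) ->
  (forall k, (k < r + n * tree_height t)%N -> z k = z' k) ->
  forall k, (k < r)%N -> stack s q u n z k = stack s q u' n z' k.
Proof.
elim: n s q u u' r => [|n IH] s q u u' r uu' zz' k kr /=.
  by apply: zz'; rewrite mul0n addn0.
have IHs := IH (sshift 1 s) (sshift 1 q) (sshift 1 u) (sshift 1 u').
have {IHs} : forall j, (j < r + tree_height t)%N ->
    stack (sshift 1 s) (sshift 1 q) (sshift 1 u) n z j =
    stack (sshift 1 s) (sshift 1 q) (sshift 1 u') n z' j.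
  apply: IHs => j jn; first by apply: uu'; rewrite add1n.
  by apply: zz'; move: jn; rewrite mulSn addnA.
rewrite /stack_step -(uu' 0%N)//; set w := stack _ _ _ _ _; set w' := stack _ _ _ _ _.
move=> ww'.
have {ww'} : forall j, (j < r)%N ->
    (if q 0%N then tree_rest t w else w) j = (if q 0%N then tree_rest t w' else w') j.
  have hw := tree_depth_le t w.
  case: (q 0%N) => j jr.
    have le : (tree_depth t w <= r + tree_height t)%N by lia.
    have [_ _] := tree_agree le ww'.
    by apply; lia.
  by apply: ww'; lia.
case: (s 0%N) => ww'; last exact: ww'.
by case: k kr => //= k kr; apply: ww'; lia.
Qed.

Lemma state_dep (U : Type) s q n k r (F : (nat -> bool) -> U) : finite_dep r F ->
  finite_dep (n + (r + n * tree_height t)) (fun u => F (state s q u n k)).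
Proof.
move=> Fr u u' uu'; apply: Fr => j jr.
apply: (@stack_agree _ _ _ _ _ _ _ r) => // i ir; apply: uu'; nia.
Qed.

(** Two runs agree on the entries counted by [stack_acc], so a sampler that stays within these reads
    the same bits in both and leaves them in agreement. Where the count is negative nothing is
    claimed. *)
Lemma coalesce s q u n z z' (k : nat) : k%:Z < stack_acc s q u n z ->
  stack s q u n z k = stack s q u n z' k.
Proof.
elim: n s q u k => [|n IH] s q u k /=; first lia.
have {}IH := IH (sshift 1 s) (sshift 1 q) (sshift 1 u).
move: IH; set A := stack_acc _ _ _ _ _; set w := stack _ _ _ _ z; set w' := stack _ _ _ _ z'.
move=> ww'; set d := (if q 0%N then _ else _) => kA.
have {ww'} : forall j : nat, j%:Z < A - d%:Z ->
    (if q 0%N then tree_rest t w else w) j = (if q 0%N then tree_rest t w' else w') j.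
  move=> j; rewrite /d; case: (q 0%N) => jA; last by apply: ww'; lia.
  have le : (tree_depth t w <= `|A|)%N by lia.
  have [|_ _] := tree_agree le (w' := w').
    by move=> i iA; apply: ww'; lia.
  by apply; lia.
rewrite /stack_step; case: (s 0%N) kA => kA ww'; last by apply: ww'; lia.
by case: k kA => //= k kA; apply: ww'; lia.
Qed.

(** The source of the site itself adds at most one to the count, so a count of at least one after
    the site means that its sample stayed within the entries determined before it. *)
Lemma coalesce_val s q u n z z' : q 0%N -> 1 <= stack_acc s q u n.+1 z ->
  tree_val t (stack (sshift 1 s) (sshift 1 q) (sshift 1 u) n z') =
  tree_val t (stack (sshift 1 s) (sshift 1 q) (sshift 1 u) n z).
Proof.
move=> /= -> hA.
set w := stack _ _ _ _ z' ; set w1 := stack _ _ _ _ z in hA *.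
have [|-> _ _//] := tree_agree (leqnn (tree_depth t w1)) (w' := w).
by move=> i iA; apply: coalesce; case: (s 0%N) hA; lia.
Qed.

Lemma stack_accE s q u n : stack_acc s q u n (sshift n u) =
  (\sum_(k < n) (s k : nat))%N%:Z -
  (\sum_(k < n) (if q k then tree_depth t (state s q u n k.+1) else 0))%N%:Z.
Proof.
elim: n s q u => [|n IH] s q u /=; first by rewrite !big_ord0.
have -> : sshift n.+1 u = sshift n (sshift 1 u) by rewrite sshift_sshift.
rewrite IH !big_ord_recl stateS.
rewrite [state _ _ _ _ ord0]/state subn0 !sshift0.
have E' : (\sum_(i < n) (if q (lift ord0 i) then tree_depth t (state s q u n.+1 (lift ord0 i).+1) else 0) =
    \sum_(i < n) (if sshift 1 q i then
      tree_depth t (state (sshift 1 s) (sshift 1 q) (sshift 1 u) n i.+1) else 0))%N.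
  by apply: eq_bigr => i _; rewrite lift0 stateS.
have E : (\sum_(i < n) (s (lift ord0 i) : nat) = \sum_(i < n) (sshift 1 s i : nat))%N.
  by apply: eq_bigr => i _; rewrite lift0.
rewrite E E'; case: (q 0%N) => /=; lia.
Qed.

End Stack.

Section StackLaw.
Variables (R : realFieldType) (T : Type) (t : tree T).
Implicit Types (s q u z : nat -> bool).

(** By [tree_law] every sample leaves fair bits independent of the past, hence the product. Site 0
    comes last in the scan: its sample and its push are absorbed into the test function [g3], to
    which the induction hypothesis applies. [B0] only says how many bits have to be revealed. *)
Lemma stack_law n s q (h : nat -> T -> nat -> R) r g : finite_dep r g ->
  exists B0, forall B, (B0 <= B)%N ->
  bitsE (fun=> 2^-1) B (fun u =>
    (\prod_(k < n) (if q k then h k (tree_val t (state t s q u n k.+1))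
                                    (tree_depth t (state t s q u n k.+1)) else 1)) *
    g (state t s q u n 0)) =
  (\prod_(k < n) (if q k then treeE t (h k) else 1)) * bitsE (fun=> 2^-1) r g.
Proof.
elim: n s q h r g => [|n IH] s q h r g gr.
  exists r => B rB; rewrite big_ord0 mul1r -(bitsE_dep _ gr rB).
  congr bitsE; apply/funext => u; rewrite big_ord0 mul1r.
  by rewrite /state /= !sshift0.
(* Average of [g] over the bit of site 0, as a function of the stack on its right. *)
pose g2 w := if s 0%N then 2^-1 * g (scons true w) + (1 - 2^-1) * g (scons false w) else g w.
have g2r : finite_dep r g2.
  move=> w w' ww'; rewrite /g2; case: (s 0%N); last exact: gr.
  by congr (_ * _ + _ * _); apply: gr => -[|k]//= kr; apply: ww'; exact: ltnW.
have g2E : bitsE (fun=> 2^-1) r g2 = bitsE (fun=> 2^-1) r g.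
  rewrite /g2; case: (s 0%N) => //.
  rewrite -[RHS](bitsE_dep _ gr (leqnSn r)) /=.
  by rewrite bitsED !bitsEZ.
pose g3 w := if q 0%N then h 0%N (tree_val t w) (tree_depth t w) * g2 (tree_rest t w)
             else g2 w.
have g3r : finite_dep (tree_height t + r) g3.
  rewrite /g3; case: (q 0%N); last by apply: finite_dep_le g2r; exact: leq_addl.
  by apply: (@tree_dep _ _ r (fun v d w => h 0%N v d * g2 w)) => v d; exact: finite_dep_comp.
have g3E : bitsE (fun=> 2^-1) (tree_height t + r) g3 =
    (if q 0%N then treeE t (h 0%N) else 1) * bitsE (fun=> 2^-1) r g.
  rewrite /g3 -g2E; case: (q 0%N); first by rewrite (tree_law _ g2r).
  by rewrite mul1r (bitsE_dep _ g2r)// leq_addl.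
have [B0 hB0] := IH (sshift 1 s) (sshift 1 q) (fun k => h k.+1) _ _ g3r.
exists B0.+1 => -[|B]// B0B.
rewrite /= -(bitsEZ _ _ 2^-1) -(bitsEZ _ _ (1 - 2^-1)) -bitsED.
rewrite big_ord_recl /= -mulrA mulrCA -g3E.
have -> : \prod_(i < n) (if q (lift ord0 i) then treeE t (h (lift ord0 i)) else 1) =
    \prod_(i < n) (if sshift 1 q i then treeE t (h i.+1) else 1).
  by apply: eq_bigr => i _; rewrite lift0.
rewrite -(hB0 B)//; congr bitsE; apply/funext => u.
have stE c k : state t s q (scons c u) n.+1 k.+1 = state t (sshift 1 s) (sshift 1 q) u n k.
  by rewrite stateS sshift_scons.
pose w := state t (sshift 1 s) (sshift 1 q) u n 0.
have pE c : \prod_(k < n.+1) (if q k then h k (tree_val t (state t s q (scons c u) n.+1 k.+1))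
      (tree_depth t (state t s q (scons c u) n.+1 k.+1)) else 1) =
    (if q 0%N then h 0%N (tree_val t w) (tree_depth t w) else 1) *
    \prod_(k < n) (if sshift 1 q k then
       h k.+1 (tree_val t (state t (sshift 1 s) (sshift 1 q) u n k.+1))
      (tree_depth t (state t (sshift 1 s) (sshift 1 q) u n k.+1)) else 1).
  rewrite big_ord_recl stE; congr (_ * _); apply: eq_bigr => i _.
rewrite !pE !state0S !sshift_scons -/w /stack_step /g3 /g2 /=.
case: (q 0%N); case: (s 0%N); try ring.
Qed.

End StackLaw.

Section StackBounds.
Variables (R : realFieldType).
Implicit Types (s q u z : nat -> bool).

Lemma treeE_ge0 (T : Type) (t : tree T) (h : T -> nat -> R) :
  (forall v d, 0 <= h v d) -> 0 <= treeE t h.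
Proof.
elim: t h => //= a IHa b IHb h h0; have := IHa (fun v d => h v d.+1) (fun v d => h0 _ _).
by have := IHb (fun v d => h v d.+1) (fun v d => h0 _ _); lra.
Qed.

(** Chernoff bound: a nonpositive count means that at least as many bits were consumed as pushed,
    and the exponential moment of the consumption is a product over requests with factors at most
    [theta ^+ 4]. *)
Lemma stack_acc_tail (T : Type) (t : tree T) (theta : R) n s q :
  1 < theta -> treeE t (fun _ d => theta ^+ d) <= theta ^+ 4 ->
  exists B0, forall B, (B0 <= B)%N ->
  bitsE (fun=> 2^-1) B (fun u => ((stack_acc t s q u n (sshift n u) <= 0)%R : nat)%:R) *
    theta ^+ (\sum_(k < n) (s k : nat)) <=
  theta ^+ (4 * \sum_(k < n) (q k : nat)).
Proof.
move=> th1 tE; have th0 : 0 < theta by apply: lt_trans th1.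
have [B0 hB0] := stack_law t n s q (fun _ _ d => theta ^+ d) (r := 0)
  (g := fun=> 1) (fun _ _ _ => erefl).
exists B0 => B /hB0; rewrite /= mulr1 => law.
set D := fun u => (\sum_(k < n) (if q k then tree_depth t (state t s q u n k.+1) else 0))%N.
have {}law : bitsE (fun=> 2^-1) B (fun u => theta ^+ D u) =
    \prod_(k < n) (if q k then treeE t (fun _ d => theta ^+ d) else 1).
  rewrite -law; congr bitsE; apply/funext => u; rewrite mulr1 /D.
  rewrite (big_morph (fun d => theta ^+ d) (exprD theta) (expr0 theta)).
  by apply: eq_bigr => k _; case: (q k).
have -> : theta ^+ (4 * \sum_(k < n) q k) = \prod_(k < n) (if q k then theta ^+ 4 else 1).
  rewrite exprM (big_morph (fun d => (theta ^+ 4) ^+ d) (exprD _) (expr0 _)).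
  by apply: eq_bigr => k _; case: (q k); rewrite ?expr1 ?expr0.
have le : bitsE (fun=> 2^-1) B (fun u => theta ^+ D u) <=
    \prod_(k < n) (if q k then theta ^+ 4 else 1).
  rewrite law; apply: ler_prod => k _; case: (q k); last by rewrite ler01 lexx.
  by rewrite tE andbT treeE_ge0// => _ d; rewrite exprn_ge0// ltW.
apply: le_trans le; rewrite mulrC -bitsEZ; apply: ler_bitsE.
  by move=> _; lra.
move=> u; case: (boolP (stack_acc _ _ _ _ _ _ <= 0)%R) => h;
  rewrite /= ?mulr0 ?(exprn_ge0 _ (ltW th0))// mulr1.
rewrite ler_eXn2l//.
by move: h; rewrite stack_accE /D /=; lia.
Qed.

(** Change of index [i = k + j], where [k] is the request that serves the site [i] and [j] is its
    offset. Factors 1 complete the blocks cut by the ends of the window. *)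
Lemma prod_offsets (q : nat -> bool) (o : nat -> nat) N a m n (G : nat -> nat -> R) :
  (forall i, (a <= i < a + m)%N -> [&& (o i < N)%N, (o i <= i)%N & q (i - o i)%N]) ->
  (a + m <= n)%N ->
  \prod_(k < n) (if q k then
     \prod_(j < N) (if (a <= k + j < a + m)%N && (o (k + j)%N == j) then G k j else 1)
   else 1) = \prod_(a <= i < a + m) G (i - o i)%N (o i).
Proof.
move=> oP amn.
have E i : (a <= i < a + m)%N -> G (i - o i)%N (o i) =
    \prod_(k < n) \prod_(j < N) (if (i - o i == k)%N && (o i == j) then G k j else 1).
  move=> /[dup] /oP /and3P[oN oi qi] /andP[ai iam].
  have ik : (i - o i < n)%N by lia.
  rewrite (bigD1 (Ordinal ik))//= (bigD1 (Ordinal oN))//= !eqxx/= big1 ?mulr1.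
    rewrite big1 ?mulr1// => k; rewrite -val_eqE /= => /negPf kP.
    by rewrite big1// => j _; rewrite eq_sym kP.
  by move=> j; rewrite -val_eqE /= eq_sym => /negPf ->.
rewrite big_nat (eq_bigr _ E) -big_nat exchange_big; apply: eq_bigr => k _ /=.
rewrite exchange_big /=; case: ifPn => [qk|qk].
  apply: eq_bigr => j _; case: ifPn => [/andP[/andP[h1 h2] /eqP h3]|h].
    rewrite (bigD1_seq (k + j)%N) ?mem_index_iota ?h1 ?h2 ?iota_uniq//= h3 addnK !eqxx /=.
    rewrite big1_seq ?mulr1// => i /andP[ij]; rewrite mem_index_iota => /oP /and3P[_ oi _].
    by case: ifP => // /andP[/eqP h4 /eqP h5]; move: ij; rewrite -h4 -h5 subnK ?eqxx.
  rewrite big1_seq// => i /=; rewrite mem_index_iota => /[dup] iam /oP /and3P[_ oi _].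
  case: ifP => // /andP[/eqP h4 /eqP h5]; move: h.
  by rewrite -{1 2}h5 -{1 2}h4 subnK// iam /= -h4 -h5 subnK// eqxx.
rewrite big1// => j _; rewrite big1_seq// => i /=; rewrite mem_index_iota.
move=> /oP /and3P[_ _ qi]; case: ifP => // /andP[/eqP h4 _].
by rewrite -h4 qi in qk.
Qed.

(** Bits of one block come from one sample, bits of different blocks from independent samples.
    Completing the test by ones turns it into a product over whole blocks, to which the law of the
    sampler applies. *)
Lemma stack_outputs_law (t : tree (seq bool)) N (c : R) s q (o : nat -> nat) a m n
    (f : nat -> bool -> R) :
  (forall g : nat -> bool -> R,
     treeE t (fun v _ => \prod_(j < N) g j (nth false v j)) =
     \prod_(j < N) (c * g j true + (1 - c) * g j false)) ->
  (forall i, (a <= i < a + m)%N -> [&& (o i < N)%N, (o i <= i)%N & q (i - o i)%N]) ->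
  (a + m <= n)%N ->
  exists B0, forall B, (B0 <= B)%N ->
  bitsE (fun=> 2^-1) B (fun u => \prod_(a <= i < a + m)
    f i (nth false (tree_val t (state t s q u n (i - o i).+1)) (o i))) =
  \prod_(a <= i < a + m) (c * f i true + (1 - c) * f i false).
Proof.
move=> tE oP amn.
pose g k j (b : bool) : R :=
  if (a <= k + j < a + m)%N && (o (k + j)%N == j) then f (k + j)%N b else 1.
have [B0 hB0] := stack_law t n s q
  (fun k val _ => \prod_(j < N) g k j (nth false val j)) (r := 0)
  (g := fun=> 1) (fun _ _ _ => erefl).
exists B0 => B /hB0; rewrite /= mulr1 => law.
transitivity (\prod_(k < n) (if q k then
   treeE t (fun val _ => \prod_(j < N) g k j (nth false val j)) else 1)).
  rewrite -law; congr bitsE; apply/funext => u; rewrite mulr1.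
  transitivity (\prod_(a <= i < a + m)
    f (i - o i + o i)%N (nth false (tree_val t (state t s q u n (i - o i).+1)) (o i))).
    by apply: eq_big_nat => i /oP /and3P[_ oi _]; rewrite subnK.
  by rewrite -(prod_offsets (fun k j =>
     f (k + j)%N (nth false (tree_val t (state t s q u n k.+1)) j)) oP amn).
transitivity (\prod_(a <= i < a + m)
  (c * f (i - o i + o i)%N true + (1 - c) * f (i - o i + o i)%N false)); last first.
  by apply: eq_big_nat => i /oP /and3P[_ oi _]; rewrite subnK.
rewrite -(prod_offsets (fun k j => c * f (k + j)%N true + (1 - c) * f (k + j)%N false) oP amn).
apply: eq_bigr => k _; case: (q k) => //; rewrite tE; apply: eq_bigr => j _.
by rewrite /g; case: ifP => _ //; ring.
Qed.

End StackBounds.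

(** * Product measures on two-sided sequences *)

Section SeqZ.
Context {d : measure_display} {S : measurableType d} {R : realType}.

Lemma measurable_coord i : measurable_fun [set: seqZ S] (fun x : seqZ S => x i).
Proof.
move=> _ B mB; rewrite setTI; apply: sub_sigma_algebra; exists i => //.
by exists B => //; rewrite setTI.
Qed.

Lemma measurable_seqZ d' (T : measurableType d') (f : T -> seqZ S) :
  (forall i, measurable_fun setT (fun x => f x i)) -> measurable_fun setT f.
Proof.
move=> mf; apply: (@measurability _ _ T (seqZ S) setT f (@coordinate_events _ S)) => //.
move=> _ [_ [i _ [B mB <-]] <-].
by have := mf i measurableT B mB; rewrite !setTI.
Qed.

Definition rect (I : {fset int}) (B : int -> set S) : set (seqZ S) :=
  [set x | forall i, i \in I -> B i (x i)].

Lemma measurable_rect I B : (forall i, measurable (B i)) -> measurable (rect I B).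
Proof.
move=> mB; have -> : rect I B = \bigcap_(i in [set` I]) (fun x : seqZ S => x i) @^-1` B i.
  by apply/seteqP; split => x /=.
apply: fin_bigcap_measurable => // i _.
by rewrite -[X in measurable X]setTI; apply: measurable_coord.
Qed.

Lemma rectI I B J C : rect I B `&` rect J C =
  rect (I `|` J)%fset (fun i => (if i \in I then B i else setT) `&`
                                (if i \in J then C i else setT)).
Proof.
apply/seteqP; split => x /=.
  by move=> [xB xC] i _; split; case: ifP => //; [exact: xB|exact: xC].
by move=> h; split => i iI; have := h i; rewrite in_fsetU iI ?orbT => /(_ isT) [].
Qed.

Lemma eq_seqZ_measure (mu nu : probability (seqZ S) R) :
  (forall I B, (forall i, measurable (B i)) -> mu (rect I B) = nu (rect I B)) ->
  forall E, measurable E -> mu E = nu E.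
Proof.
move=> munu E mE.
pose G := [set A | exists I B, (forall i, measurable (B i)) /\ A = rect I B].
apply: (g_sigma_algebra_measure_unique G _ (fun=> setT)) => //.
- by move=> _ [I [B [mB ->]]]; exact: measurable_rect.
- by move=> _; exists fset0, (fun=> setT); split => //; apply/seteqP; split => x //=.
- by rewrite bigcup_const//; exists 0%N.
- move=> _ _ [I [B [mB ->]]] [J [C [mC ->]]].
  rewrite rectI; eexists _, _; split; last by [].
  by move=> i; apply: measurableI; case: ifP.
- by move=> _ [I [B [mB ->]]]; exact: munu.
- by move=> _; rewrite (le_lt_trans (probability_le1 _ _))// ltry.
- apply: (smallest_sub _ _ mE); first exact: smallest_sigma_algebra.
  move=> _ [i _ [B mB <-]]; apply: sub_sigma_algebra.
  exists [fset i]%fset, (fun=> B); split => //; rewrite setTI.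
  by apply/seteqP; split => x /= => [xB j|]; [rewrite inE => /eqP ->|apply; rewrite inE].
Qed.

Section Product.
Variables (b : int -> probability S R) (mu : probability (seqZ S) R).
Hypothesis mub : is_product_measure b mu.

Lemma product_rect_coord (I : {fset int}) B (i : int) C : i \notin I ->
  (forall i, measurable (B i)) -> measurable C ->
  mu (rect I B `&` [set x | C (x i)]) = (mu (rect I B) * b i C)%E.
Proof.
move=> iI mB mC.
pose B' j := if j == i then C else B j.
have -> : rect I B `&` [set x | C (x i)] = rect (i |` I)%fset B'.
  apply/seteqP; split => x /=.
    move=> [xB xC] j; rewrite in_fset1U /B' => /orP[/eqP ->|]; first by rewrite eqxx.
    by move=> jI; case: eqP => [->//|_]; exact: xB.
  move=> h; split => [j jI|]; last first.
    by have := h i; rewrite /B' eqxx; apply; rewrite in_fset1U eqxx.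
  have := h j; rewrite /B' in_fset1U jI orbT => /(_ isT).
  by case: eqP jI => // ->; rewrite (negPf iI).
rewrite !mub//; last by move=> j; rewrite /B'; case: ifP.
rewrite big_fsetU1//= {1}/B' eqxx muleC; congr (_ * _)%E.
by apply: eq_big_seq => j jI; rewrite /B'; case: eqP jI => // ->; rewrite (negPf iI).
Qed.

Definition window (f : S -> bool) (l : int) (x : seqZ S) : nat -> bool :=
  fun k => f (x (l + k%:Z)).

Lemma windowS f l x : window f l x = scons (f (x l)) (window f (l + 1) x).
Proof.
apply/funext => -[|k]; rewrite /window /= ?addr0//.
by rewrite -addrA; congr (f (x (_ + _))); lia.
Qed.

Lemma window_split f l (P : (nat -> bool) -> bool) :
  [set x | P (window f l x)] =
  ([set x | f (x l)] `&` [set x | P (scons true (window f (l + 1) x))]) `|`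
  ([set x | ~~ f (x l)] `&` [set x | P (scons false (window f (l + 1) x))]).
Proof.
apply/seteqP; split => x /=; rewrite (windowS f l); first by case: (f (x l)); [left|right].
by case: (f (x l)) => /= -[[]|[]].
Qed.

Variable f : S -> bool.
Hypothesis mf : forall c, measurable [set a | f a = c].

Lemma measurable_window (l : int) n (P : (nat -> bool) -> bool) : finite_dep n P ->
  measurable [set x : seqZ S | P (window f l x)].
Proof.
elim: n l P => [|n IH] l P Pn.
  have -> : [set x : seqZ S | P (window f l x)] = [set x | P (fun=> false)].
    by apply/seteqP; split => x /=; rewrite (Pn _ (fun=> false)).
  case: (P _).
    rewrite (_ : [set _ : seqZ S | _] = setT); first exact: measurableT.
    by apply/seteqP; split.
  rewrite (_ : [set _ : seqZ S | _] = set0); first exact: measurable0.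
  by apply/seteqP; split.
have mc c : measurable [set x : seqZ S | f (x l) = c].
  by rewrite -[X in measurable X]setTI; exact: (measurable_coord l measurableT (mf c)).
rewrite (window_split f l); apply: measurableU; apply: measurableI.
- exact: (mc true).
- exact: (IH (l + 1) (fun w => P (scons true w)) (@finite_dep_scons _ _ _ true Pn)).
- rewrite (_ : [set x | _] = [set x : seqZ S | f (x l) = false])//.
  by apply/seteqP; split => x /=; [move/negbTE|move=> ->].
- exact: (IH (l + 1) (fun w => P (scons false w)) (@finite_dep_scons _ _ _ false Pn)).
Qed.

(** The rectangle on coordinates off the window is there for the induction, which moves the first
    coordinate of the window into it. *)
Lemma product_window n (l : int) (P : (nat -> bool) -> bool) (I : {fset int}) B :
  finite_dep n P -> (forall i, measurable (B i)) ->
  (forall k, (k < n)%N -> l + k%:Z \notin I) ->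
  mu (rect I B `&` [set x | P (window f l x)]) =
  (mu (rect I B) *
   (bitsE (fun k => fine (b (l + k%:Z) [set a | f a])) n (fun w => (P w)%:R))%:E)%E.
Proof.
elim: n l P I B => [|n IH] l P I B Pn mB lI.
  have -> : [set x : seqZ S | P (window f l x)] = [set x | P (fun=> false)].
    by apply/seteqP; split => x /=; rewrite (Pn _ (fun=> false)).
  rewrite /=; case: (P _) => /=.
    by rewrite mule1; congr (mu _); apply/seteqP; split => x //= [].
  rewrite mule0 (_ : _ `&` _ = set0) ?measure0//.
  by apply/seteqP; split => x //= [].
rewrite (window_split f l) setIUr !setIA.
have mfc c : measurable ((rect I B `&` [set x | f (x l) = c]) `&`
    [set x : seqZ S | P (scons c (window f (l + 1) x))]).
  apply: measurableI; first apply: measurableI; first exact: measurable_rect.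
    by rewrite -[X in measurable X]setTI; exact: (measurable_coord l measurableT (mf c)).
  exact: (@measurable_window (l + 1) n (fun w => P (scons c w)) (@finite_dep_scons _ _ _ c Pn)).
have lI0 : l \notin I by have := lI 0%N; rewrite addr0; apply.
pose Bc c i := if i == l then [set a | f a = c] else B i.
have mBc c i : measurable (Bc c i) by rewrite /Bc; case: ifP.
have rE c : rect I B `&` [set x | f (x l) = c] = rect (l |` I)%fset (Bc c).
  apply/seteqP; split => x /=.
    move=> [xB xC] j; rewrite in_fset1U /Bc => /orP[/eqP ->|]; first by rewrite eqxx.
    by move=> jI; case: eqP => [->//|_]; exact: xB.
  move=> h; split => [j jI|]; last first.
    by have := h l; rewrite /Bc eqxx; apply; rewrite in_fset1U eqxx.
  have := h j; rewrite /Bc in_fset1U jI orbT => /(_ isT).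
  by case: eqP jI => // ->; rewrite (negPf lI0).
have muc c : mu ((rect I B `&` [set x | f (x l) = c]) `&`
      [set x : seqZ S | P (scons c (window f (l + 1) x))]) =
    (mu (rect I B) * b l [set a | f a = c] *
     (bitsE (fun k => fine (b (l + 1 + k%:Z) [set a | f a])) n
        (fun w => (P (scons c w))%:R))%:E)%E.
  rewrite rE (IH _ (fun w => P (scons c w)))//; last 2 first.
  - exact: finite_dep_scons.
  - move=> k kn; rewrite in_fset1U negb_or; apply/andP; split; first lia.
    by have := lI k.+1; rewrite ltnS => /(_ kn); rewrite -addn1 PoszD [k%:Z + _]addrC addrA.
  by rewrite -rE (@product_rect_coord I B l [set a | f a = c]).
have fF : [set x : seqZ S | ~~ f (x l)] = [set x | f (x l) = false].
  by apply/seteqP; split => x /=; [move/negbTE|move=> ->].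
rewrite measureU ?fF; [|exact: (mfc true)|exact: (mfc false)|]; last first.
  by apply/seteqP; split => x //= -[[[_ ft] _] [[_ +] _]]; rewrite /= ft.
rewrite [X in (X + _ = _)%E](muc true) [X in (_ + X = _)%E](muc false).
have -> : b l [set a | f a = false] = (1 - b l [set a | f a])%E.
  rewrite -probability_setC; last exact: (mf true).
  by congr (b l _); apply/seteqP; split => a /=; [move=> ->|move/negP/negbTE].
have -> : [set a | f a = true] = [set a | f a] by [].
have fin : b l [set a | f a] \is a fin_num by apply: fin_num_measure; exact: (mf true).
have finr : mu (rect I B) \is a fin_num.
  by apply: fin_num_measure; exact: measurable_rect.
rewrite -(fineK fin) -(fineK finr).
set pl := fine (b l _); set r := fine (mu _).
have -> : (1 - pl%:E)%E = (1 - pl)%:E by rewrite EFinB.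
rewrite -!EFinM -EFinD.
congr EFin; rewrite /= addr0 -/pl.
have -> : sshift 1 (fun k : nat => fine (b (l + k%:Z) [set a | f a])) =
    (fun k : nat => fine (b (l + 1 + k%:Z) [set a | f a])).
  by apply/funext => k; rewrite /sshift; congr (fine (b _ _)); lia.
ring.
Qed.

Lemma product_windowT n (l : int) (P : (nat -> bool) -> bool) : finite_dep n P ->
  mu [set x | P (window f l x)] =
  (bitsE (fun k => fine (b (l + k%:Z) [set a | f a])) n (fun w => (P w)%:R))%:E.
Proof.
move=> Pn; have := @product_window n l P fset0 (fun=> setT) Pn (fun=> measurableT).
have -> : rect fset0 (fun=> setT) = setT by apply/seteqP; split => x //=.
by rewrite setTI probability_setT mul1e; apply.
Qed.

End Product.
End SeqZ.

(** * Bernoulli sequences built from a uniform point of the unit interval *)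

Lemma pushforward_probability d d' (T : measurableType d) (T' : measurableType d')
    (R : realType) (P : probability T R) (f : T -> T') : measurable_fun setT f ->
  exists Q : probability T' R, forall A, Q A = P (f @^-1` A).
Proof.
move=> mf.
pose F : {mfun T >-> T'} := HB.pack f (isMeasurableFun.Build _ _ _ _ f mf).
by exists (distribution P F).
Qed.

Lemma lebesgue_itv01_probability (R : realType) :
  exists P : probability (measurableTypeR R) R, forall A,
    P A = lebesgue_measure (A `&` `[0, 1[%classic).
Proof.
have mD : @measurable _ (measurableTypeR R) `[0, 1[%classic by [].
pose m := mrestr (@lebesgue_measure R) mD.
have m1 : m setT = 1%E.
  by rewrite /m /mrestr setTI lebesgue_measure_itv /= lte_fin ltr01 oppr0 adde0.
pose P : probability (measurableTypeR R) R := 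
  HB.pack m (Measure_isProbability.Build _ _ R m m1).
by exists P.
Qed.

Section Digits.
Variable R : realType.
Implicit Types (p : nat -> R).

(* Digit [n] of [t]: the interval [x, x + l[ is cut in the proportion
   [p 0 : 1 - p 0], and so on in the half that contains [t]. *)
Fixpoint digit p (x l : R) n (t : R) : bool :=
  if n is n'.+1 then
    if t < x + p 0%N * l then digit (sshift 1 p) x (p 0%N * l) n' t
    else digit (sshift 1 p) (x + p 0%N * l) ((1 - p 0%N) * l) n' t
  else t < x + p 0%N * l.

Definition digits p x l t : nat -> bool := fun n => digit p x l n t.

Lemma digitsE p x l t : digits p x l t =
  if t < x + p 0%N * l then scons true (digits (sshift 1 p) x (p 0%N * l) t)
  else scons false (digits (sshift 1 p) (x + p 0%N * l) ((1 - p 0%N) * l) t).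
Proof. by apply/funext => -[|n]; rewrite /digits /=; case: ifP. Qed.

Lemma measurable_digits p (x l : R) n (P : (nat -> bool) -> bool) : finite_dep n P ->
  @measurable _ (measurableTypeR R) [set t | P (digits p x l t)].
Proof.
elim: n p x l P => [|n IH] p x l P Pn.
  have -> : [set t | P (digits p x l t)] = [set _ | P (fun=> false)].
    by apply/seteqP; split => t /=; rewrite (Pn _ (fun=> false)).
  case: (P _).
    rewrite (_ : [set _ : R | _] = setT); first exact: measurableT.
    by apply/seteqP; split.
  rewrite (_ : [set _ : R | _] = set0); first exact: measurable0.
  by apply/seteqP; split.
pose y := x + p 0%N * l.
have -> : [set t | P (digits p x l t)] =
  (`]-oo, y[ `&` [set t | P (scons true (digits (sshift 1 p) x (p 0%N * l) t))]) `|`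
  (`[y, +oo[ `&` [set t | P (scons false (digits (sshift 1 p) y ((1 - p 0%N) * l) t))]).
  apply/seteqP; split => t; rewrite /= !in_itv /= ?andbT (digitsE p x l) -/y.
    by case: ltP => h Ph; [left|right].
  by case: ltP => h [[]|[]].
apply: measurableU; apply: measurableI => //.
  exact: (IH _ _ _ (fun w => P (scons true w)) (@finite_dep_scons _ _ _ true Pn)).
exact: (IH _ _ _ (fun w => P (scons false w)) (@finite_dep_scons _ _ _ false Pn)).
Qed.

Lemma lebesgue_digits p (x l : R) n (P : (nat -> bool) -> bool) :
  (forall k, 0 <= p k <= 1) -> 0 <= l -> finite_dep n P ->
  lebesgue_measure (`[x, x + l[%classic `&` [set t | P (digits p x l t)]) =
  (l * bitsE p n (fun w => (P w)%:R))%:E.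
Proof.
move=> p01; elim: n p p01 x l P => [|n IH] p p01 x l P l0 Pn.
  have -> : [set t | P (digits p x l t)] = [set _ | P (fun=> false)].
    by apply/seteqP; split => t /=; rewrite (Pn _ (fun=> false)).
  rewrite /=; case: (P _) => /=.
    rewrite mulr1 (_ : _ `&` _ = `[x, x + l[%classic); last first.
      by apply/seteqP; split => t //= [].
    rewrite lebesgue_measure_itv /= lte_fin ltrDl; case: ltP => l0'.
      by rewrite -EFinD; congr EFin; ring.
    by congr EFin; apply/eqP; rewrite eq_le l0 l0'.
  rewrite mulr0 (_ : _ `&` _ = set0) ?measure0//.
  by apply/seteqP; split => t //= [].
have /andP[p0 p1] := p01 0%N.
have p01' k : 0 <= sshift 1 p k <= 1 by exact: p01.
pose y := x + p 0%N * l.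
have pl0 : 0 <= p 0%N * l by rewrite mulr_ge0.
have ql0 : 0 <= (1 - p 0%N) * l by rewrite mulr_ge0// subr_ge0.
have yE : y + (1 - p 0%N) * l = x + l by rewrite /y; ring.
have -> : `[x, x + l[%classic `&` [set t | P (digits p x l t)] =
  (`[x, y[ `&` [set t | P (scons true (digits (sshift 1 p) x (p 0%N * l) t))]) `|`
  (`[y, y + (1 - p 0%N) * l[ `&`
     [set t | P (scons false (digits (sshift 1 p) y ((1 - p 0%N) * l) t))]).
  apply/seteqP; split => t; rewrite /= !in_itv /= yE (digitsE p x l) -/y.
    by case: (ltP t y) => h [/andP[h1 h2] Ph]; [left|right]; split; rewrite ?h1 ?h2.
  have xy : x <= y by rewrite lerDl.
  have yl : y <= x + l by rewrite -yE lerDl.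
  case: (ltP t y) => h [[/andP[h1 h2] Ph]|[/andP[h1 h2] Ph]]; split=> //.
  - by rewrite h1 (lt_le_trans h yl).
  - by rewrite h2 (le_trans xy h).
have P1 := @finite_dep_scons _ _ _ true Pn; have P0 := @finite_dep_scons _ _ _ false Pn.
rewrite measureU; last first.
- apply/seteqP; split => t //=; rewrite !in_itv /= => -[[/andP[_ h] _] [/andP[+ _] _]].
  by rewrite leNgt h.
- apply: measurableI => //; exact: (measurable_digits _ _ _ P0).
- apply: measurableI => //; exact: (measurable_digits _ _ _ P1).
have E1 := IH _ p01' x (p 0%N * l) _ pl0 P1; have E0 := IH _ p01' y _ _ ql0 P0.
rewrite [X in (X + _)%E]E1 [X in (_ + X)%E]E0.
by rewrite -EFinD; congr EFin => /=; ring.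
Qed.

End Digits.

Section BernoulliSequences.
Variable R : realType.

Lemma bitsE_prod (p : nat -> R) n (g : nat -> bool -> R) :
  bitsE p n (fun w => \prod_(k < n) g k (w k)) =
  \prod_(k < n) (p k * g k true + (1 - p k) * g k false).
Proof.
elim: n p g => [|n IH] p g /=; first by rewrite !big_ord0.
have E c : (fun w => \prod_(k < n.+1) g k (scons c w k)) =
    (fun w => g 0%N c * \prod_(k < n) g k.+1 (w k)).
  by apply/funext => w; rewrite big_ord_recl.
rewrite !E !bitsEZ (IH (sshift 1 p) (fun k => g k.+1)) [RHS]big_ord_recl /= [RHS]mulrDl.
by rewrite !mulrA.
Qed.

(** Coordinate [i] is the digit of rank [pickle i] of a single uniform point, each digit cutting its
    interval in the prescribed proportion. Ranks that code no integer get the dummy parameter 0 and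
    contribute a factor 1. *)
Lemma bernoulli_sequence_exists (p : int -> R) : (forall i, 0 <= p i <= 1) ->
  exists mu : probability (seqZ bool) R,
    is_product_measure (fun i => bernoulli_prob (p i)) mu.
Proof.
move=> p01; have [P PE] := lebesgue_itv01_probability R.
pose nat_of (i : int) : nat := choice.pickle i.
pose q (k : nat) : R := if @choice.pickle_inv int k is Some i then p i else 0.
have q01 k : 0 <= q k <= 1 by rewrite /q; case: (choice.pickle_inv k) => [i|]//; rewrite lexx ler01.
pose f (t : measurableTypeR R) : seqZ bool := fun i => digits q 0 1 t (nat_of i).
have mf : measurable_fun setT f.
  apply: measurable_seqZ => i _ B _; rewrite setTI.
  have dep : finite_dep (nat_of i).+1 (fun w : nat -> bool => w (nat_of i) \in B).
    by move=> w w' ww'; rewrite ww'.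
  have := measurable_digits q 0 1 dep; congr measurable.
  by apply/seteqP; split => t /=; rewrite in_setE.
have [mu muE] := pushforward_probability P mf.
exists mu => I B _; rewrite muE PE.
pose n := (\max_(i <- I) nat_of i).+1.
have In i : i \in I -> (nat_of i < n)%N.
  by move=> iI; rewrite ltnS; exact: (leq_bigmax_seq (F := nat_of)).
pose g (k : nat) (c : bool) : bool :=
  if @choice.pickle_inv int k is Some i then (i \in I) ==> (c \in B i) else true.
pose Q (w : nat -> bool) := \big[andb/true]_(k < n) g k (w k).
have dep : finite_dep n Q.
  by move=> w w' ww'; rewrite /Q; apply: eq_bigr => k _; rewrite ww'.
have -> : f @^-1` [set x | forall i, i \in I -> B i (x i)] `&` `[0, 1[%classic =
    `[0, 0 + 1[%classic `&` [set t | Q (digits q 0 1 t)].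
  rewrite setIC add0r; congr (_ `&` _); apply/seteqP; split => t /=; rewrite /Q big_andE.
    move=> h; apply/forallP => k; rewrite /g; case E : (choice.pickle_inv k) => [i|]//=.
    apply/implyP => iI; rewrite in_setE; have := h i iI; rewrite /f /nat_of.
    by have := @choice.pickle_invK int k; rewrite /ocancel E /= => ->.
  move=> /forallP h i iI; have := h (Ordinal (In i iI)).
  by rewrite /g /= choice.pickleK_inv iI /= in_setE.
rewrite (lebesgue_digits 0 q01 ler01 dep) mul1r.
have -> : (fun w => (Q w)%:R) = (fun w => \prod_(k < n) (g k (w k))%:R : R).
  apply/funext => w; rewrite /Q.
  by apply: (big_ind2 (fun (b : bool) (x : R) => b%:R = x)) => // -[] x [] y <- <-; rewrite ?mulr1 ?mulr0.
rewrite (bitsE_prod q n (fun k c => (g k c)%:R)).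
have bE i : bernoulli_prob (p i) (B i) =
    (p i * (true \in B i)%:R + (1 - p i) * (false \in B i)%:R)%:E.
  by rewrite bernoulli_probE// !diracE.
rewrite (eq_bigr _ (fun i _ => bE i)) prodEFin; congr EFin.
pose G (k : nat) : R := q k * (g k true)%:R + (1 - q k) * (g k false)%:R.
have -> : \prod_(i <- I) (p i * (true \in B i)%:R + (1 - p i) * (false \in B i)%:R) =
    \prod_(k <- [seq nat_of i | i <- I]) G k.
  rewrite big_map; apply: eq_big_seq => i iI.
  by rewrite /G /q /g choice.pickleK_inv iI.
rewrite -(big_mkord xpredT G) (bigID (mem [seq nat_of i | i <- I])) /=.
rewrite [X in _ * X]big1 ?mulr1; last first.
  move=> k kI; rewrite /G /q /g; case E : (choice.pickle_inv k) => [i|]; last by rewrite /=; ring.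
  case: (boolP (i \in I)) => iI /=; last by ring.
  by case/mapP: kI; exists i => //; rewrite /nat_of;
    have := @choice.pickle_invK int k; rewrite /ocancel E /= => ->.
rewrite -big_filter; apply: perm_big; apply: uniq_perm.
- by rewrite filter_uniq// iota_uniq.
- by rewrite map_inj_uniq ?fset_uniq//; exact: (pcan_inj (@choice.pickleK int)).
- move=> k; rewrite mem_filter mem_index_iota /=; apply/andP/idP => [[]//|kI].
  by split=> //; case/mapP: kI => i iI ->; exact: In.
Qed.

End BernoulliSequences.

(** * Absolute continuity of product measures *)

Section Approximation.
Context {d : measure_display} {T : measurableType d} {R : realType}.
Variables (la : {measure set T -> \bar R}) (G : set (set T)).
Hypotheses (lafin : (la setT < +oo)%E) (mG : G `<=` measurable)
  (G0 : G set0) (GC : forall A, G A -> G (~` A))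
  (GU : forall A B, G A -> G B -> G (A `|` B))
  (sG : measurable `<=` <<s G >>).

(** The sets that can be approximated form a sigma-algebra containing [G]: a countable union is
    replaced by a finite one, at a cost that tends to 0 by continuity from above. *)
Lemma algebra_approx E : measurable E -> forall e : R, 0 < e ->
  exists2 C, G C & (la (E `+` C) < e%:E)%E.
Proof.
pose H := [set E : set T | measurable E /\ forall e : R, 0 < e ->
  exists2 C, G C & (la (E `+` C) < e%:E)%E].
suff /smallest_sub : sigma_algebra setT H.
  move=> /(_ G) HG mE; suff : H E by case.
  apply: (HG _ _ (sG mE)) => C GC'; split; first exact: mG.
  by move=> e e0; exists C => //; rewrite setYK measure0 lte_fin.
have mY (A B : set T) : measurable A -> measurable B -> measurable (A `+` B).
  by move=> mA mB; rewrite /setY; apply: measurableU; exact: measurableD.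
have HU A B : H A -> H B -> H (A `|` B).
  move=> [mA hA] [mB hB]; split; first exact: measurableU.
  move=> e e0; have e20 : 0 < e / 2 by rewrite divr_gt0.
  have [C GCC lC] := hA _ e20; have [D GD lD] := hB _ e20.
  exists (C `|` D); first exact: GU.
  apply: (@le_lt_trans _ _ (la (A `+` C) + la (B `+` D))%E).
    apply: (@le_trans _ _ (la ((A `+` C) `|` (B `+` D)))); last first.
      by apply: measureU2; apply: mY => //; exact: mG.
    apply: le_measure; rewrite ?inE.
    - by apply: (mY (A `|` B) (C `|` D)); apply: measurableU => //; exact: mG.
    - by apply: measurableU; apply: mY => //; exact: mG.
    - by move=> x [[[]+ /not_orP[]]|[[]+ /not_orP[]]]; rewrite /setY /=; tauto.
  by rewrite [e]splitr EFinD; exact: lteD.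
split.
- split => // e e0; exists set0 => //.
  by rewrite setYK measure0 lte_fin.
- move=> A [mA hA]; rewrite setTD; split; first exact: measurableC.
  move=> e e0; have [C GCC lC] := hA _ e0; exists (~` C); first exact: GC.
  rewrite (_ : ~` A `+` ~` C = A `+` C)//; apply/seteqP.
  by split=> x; have := pselect (A x); have := pselect (C x); rewrite /setY /=; tauto.
move=> A HA; have mA n : measurable (A n) by case: (HA n).
have mUA : measurable (\bigcup_k A k) by exact: bigcupT_measurable.
split=> // e e0; have e20 : 0 < e / 2 by rewrite divr_gt0.
pose F n := \big[setU/set0]_(i < n) A i.
have HF n : H (F n).
  rewrite /F; elim/big_ind: _ => //.
  by split => // e' e'0; exists set0 => //; rewrite setYK measure0 lte_fin.
have mF n : measurable (F n) by case: (HF n).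
pose D n := \bigcup_k A k `\` F n.
have mD n : measurable (D n) by exact: measurableD.
have D0 : \bigcap_n D n = set0.
  apply/seteqP; split=> // x h; have [[k _ Akx] _] := h 0%N I.
  have [_] := h k.+1 I; apply; rewrite /F -bigcup_mkord; by exists k => //=.
have : la (D n) @[n --> \oo] --> la (\bigcap_n D n).
  apply: nonincreasing_cvg_mu => //.
  - by rewrite (le_lt_trans _ lafin)// le_measure ?inE.
  - by rewrite D0.
  - move=> m n mn; apply/subsetPset => x [Ux nF]; split=> // Fm; apply: nF.
    move: Fm; rewrite /F -!bigcup_mkord => -[k /= km Akx].
    by exists k => //=; exact: leq_trans mn.
rewrite D0 measure0 => /fine_cvgP[_ Dcvg].
have /cvgrPdist_lt/(_ _ e20)[N _ hN] := Dcvg.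
have {hN} : (la (D N) < (e / 2)%:E)%E.
  have := hN N (leqnn N); rewrite /= sub0r normrN.
  have fD : la (D N) \is a fin_num.
    by rewrite ge0_fin_numE// (le_lt_trans _ lafin)// le_measure ?inE.
  by rewrite ger0_norm ?fine_ge0// => h; rewrite -(fineK fD) lte_fin.
move=> lD; have [_ /(_ _ e20)[C GCC lC]] := HF N.
exists C => //; apply: (@le_lt_trans _ _ (la (D N) + la (F N `+` C))%E).
  apply: (@le_trans _ _ (la (D N `|` (F N `+` C)))); last first.
    by apply: measureU2 => //; apply: mY => //; exact: mG.
  apply: le_measure; rewrite ?inE.
  - by apply: mY => //; exact: mG.
  - by apply: measurableU => //; apply: mY => //; exact: mG.
  - have FA : F N `<=` \bigcup_k A k.
      by rewrite /F -bigcup_mkord => x [k _ Akx]; exists k.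
    move=> x [[Ux nC]|[Cx nU]].
      by have [Fx|nFx] := pselect (F N x); [right; left|left].
    by right; right; split=> // /FA.
by rewrite [e]splitr EFinD; exact: lteD.
Qed.

End Approximation.

Section AbsoluteContinuity.
Context {d : measure_display} {T : measurableType d} {R : realType}.

(** A [P]-null set is close to some [C] in [G] for [P + Q], hence for both measures; then [P C] is
    small, the hypothesis makes [Q C] small, and so is the [Q]-measure of the null set. *)
Lemma algebra_dominates (P Q : probability T R) (G : set (set T)) (K : R) :
  G `<=` measurable -> G set0 -> (forall A, G A -> G (~` A)) ->
  (forall A B, G A -> G B -> G (A `|` B)) -> measurable `<=` <<s G >> ->
  0 <= K -> (forall A, G A -> fine (Q A) ^+ 2 <= K * fine (P A)) ->
  Q `<< P.
Proof.
move=> mG G0 GC GU sG K0 QP; apply/null_content_dominatesP => E mE PE0.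
pose la := measure_add P Q.
have lafin : (la setT < +oo)%E.
  by rewrite /la measure_addE [X in (X + _)%E](probability_setT P)
    [X in (_ + X)%E](probability_setT Q) -EFinD ltry.
have Qfin (A : set T) : measurable A -> Q A = (fine (Q A))%:E.
  by move=> mA; rewrite fineK// fin_num_measure.
have Pfin (A : set T) : measurable A -> P A = (fine (P A))%:E.
  by move=> mA; rewrite fineK// fin_num_measure.
have mY (A B : set T) : measurable A -> measurable B -> measurable (A `+` B).
  by move=> mA mB; rewrite /setY; apply: measurableU; exact: measurableD.
have key (e : R) : 0 < e -> fine (Q E) <= e + Num.sqrt (K * e).
  move=> e0; have [C GCC laC] := algebra_approx lafin mG G0 GC GU sG mE e0.
  have mC := mG _ GCC; have mEC := mY _ _ mE mC.
  have : (P (E `+` C) + Q (E `+` C) < e%:E)%E.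
    by apply: le_lt_trans laC; rewrite -measure_addE.
  rewrite (Qfin (E `+` C))// (Pfin (E `+` C))// -EFinD lte_fin => lt_e.
  have PC : fine (P C) <= e.
    have : (P C <= P E + P (E `+` C))%E.
      apply: (@le_trans _ _ (P (E `|` (E `+` C)))); last exact: measureU2.
      apply: le_measure; rewrite ?inE//; first exact: measurableU.
      by move=> x Cx; have [Ex|nEx] := pselect (E x); [left|right; right].
    rewrite PE0 add0e (Pfin C)// (Pfin (E `+` C))// lee_fin => /le_trans; apply.
    by apply: ltW; apply: le_lt_trans lt_e; rewrite lerDl fine_ge0.
  have QC : fine (Q C) <= Num.sqrt (K * e).
    rewrite -[leLHS]ger0_norm ?fine_ge0// -sqrtr_sqr ler_wsqrtr//.
    by apply: (le_trans (QP _ GCC)); rewrite ler_wpM2l.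
  have : (Q E <= Q (E `+` C) + Q C)%E.
    apply: (@le_trans _ _ (Q ((E `+` C) `|` C))); last exact: measureU2.
    apply: le_measure; rewrite ?inE//; first exact: measurableU.
    by move=> x Ex; have [Cx|nCx] := pselect (C x); [right|left; left].
  rewrite (Qfin E)// (Qfin C)// (Qfin (E `+` C))// -EFinD lee_fin => /le_trans; apply.
  apply: lerD => //; apply: ltW; apply: le_lt_trans lt_e.
  by rewrite lerDr fine_ge0.
rewrite (Qfin E)//; congr EFin; apply/eqP; rewrite eq_le fine_ge0// andbT.
apply/ler_addgt0Pr => x x0; rewrite add0r.
(* Chosen so that [e] and [Num.sqrt (K * e)] are both at most [x / 2]. *)
pose e := x ^+ 2 / (1 + x + K) / 4.
have h0 : 0 < 1 + x + K by lra.
have e0 : 0 < e by rewrite /e !divr_gt0// exprn_gt0.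
apply: (le_trans (key e e0)).
have ex : e * (1 + x + K) * 4 = x ^+ 2 by rewrite /e; field; rewrite gt_eqF.
have s : Num.sqrt (K * e) <= x / 2.
  have x20 : 0 <= x / 2 by lra.
  rewrite -[leRHS]ger0_norm// -sqrtr_sqr ler_wsqrtr//.
  have : 0 <= e * (1 + x) by rewrite mulr_ge0; lra.
  nra.
have : e <= x / 2.
  rewrite -(ler_pM2r h0); have : 0 <= x * K by rewrite mulr_ge0// ltW.
  by nra.
lra.
Qed.

(** Borel-Cantelli: for separating sets with summable [P]-measures the limsup is [P]-null, while
    each of them, hence the limsup, has [Q]-measure at least one half. *)
Lemma not_dominates (P Q : probability T R) :
  (forall e : R, 0 < e -> exists E, [/\ measurable E, (P E <= e%:E)%E & (Q (~` E) <= e%:E)%E]) ->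
  ~ Q `<< P.
Proof.
move=> sep /null_content_dominatesP QP.
have /choice[F FP] : forall n : nat, exists E, [/\ measurable E,
    (P E <= (2^-1 / (2 ^ n.+1)%:R)%:E)%E & (Q (~` E) <= (2^-1)%:E)%E].
  move=> n; have [|E [mE PE QE]] := sep (2^-1 / (2 ^ n.+1)%:R).
    by rewrite divr_gt0// ltr0n expn_gt0.
  exists E; split=> //; apply: (le_trans QE).
  by rewrite lee_fin ler_piMr// invf_le1 ?ler1n ?ltr0n expn_gt0.
have mF n : measurable (F n) by case: (FP n).
have PF : P (lim_sup_set F) = 0%E.
  apply: lim_sup_set_cvg0 => //.
  apply: (@le_lt_trans _ _ (2^-1)%:E); last exact: ltry.
  apply: (@le_trans _ _ (\sum_(n <oo) (2^-1 / (2 ^ n.+1)%:R)%:E)%E).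
    by apply: lee_nneseries => n _ //; case: (FP n).
  by rewrite (epsilon_trick0 xpredT).
have mL : measurable (lim_sup_set F).
  by apply: bigcap_measurable => // k _; exact: bigcup_measurable.
have QF := QP _ mL PF.
have : Q (\bigcup_(k >= n) F k) @[n --> \oo] --> 0%E.
  rewrite -QF; apply: lim_sup_set_cvg => //.
  by rewrite (le_lt_trans (probability_le1 _ _)) ?ltry//; exact: bigcup_measurable.
move=> /fine_cvgP[_ /cvgrPdist_lt/(_ 2^-1)].
rewrite invr_gt0 ltr0n => /(_ isT)[N _ /(_ N (leqnn N))] /=.
rewrite sub0r normrN ger0_norm ?fine_ge0// ltNge => /negP; apply.
have mU : measurable (\bigcup_(k >= N) F k) by exact: bigcup_measurable.
rewrite -lee_fin fineK ?fin_num_measure//.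
apply: (@le_trans _ _ (Q (F N))); last first.
  by apply: le_measure; rewrite ?inE// => x Fx; exists N => //=.
have [_ _] := FP N; rewrite probability_setC//.
have Ffin : Q (F N) \is a fin_num by rewrite fin_num_measure.
rewrite -(fineK Ffin).
have -> : (1 - (fine (Q (F N)))%:E)%E = (1 - fine (Q (F N)))%:E by rewrite EFinB.
by rewrite !lee_fin; lra.
Qed.

End AbsoluteContinuity.

Section Kakutani.
Variable R : realType.

Definition cylinders : set (set (seqZ bool)) :=
  [set E | exists n (P : (nat -> bool) -> bool), finite_dep n.*2 P /\
     E = [set x | P (window id (- n%:Z) x)]].

Lemma window_sshift (x : seqZ bool) m n : (m <= n)%N ->
  window id (- m%:Z) x = sshift (n - m) (window id (- n%:Z) x).
Proof. by move=> mn; apply/funext => k; rewrite /window /sshift; congr (x _); lia. Qed.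

Lemma cylinders_measurable : cylinders `<=` measurable.
Proof.
by move=> _ [n [P [Pn ->]]]; apply: (measurable_window (f := id)) Pn => c.
Qed.

Lemma cylinders0 : cylinders set0.
Proof. by exists 0%N, (fun=> false); split => //; apply/seteqP; split. Qed.

Lemma cylindersC E : cylinders E -> cylinders (~` E).
Proof.
move=> [n [P [Pn ->]]]; exists n, (fun w => ~~ P w); split.
  exact: finite_dep_comp.
by apply/seteqP; split => x /= /negP.
Qed.

Lemma cylindersU E F : cylinders E -> cylinders F -> cylinders (E `|` F).
Proof.
move=> [m [P [Pm ->]]] [n [Q [Qn ->]]]; pose N := maxn m n.
exists N, (fun w => P (sshift (N - m) w) || Q (sshift (N - n) w)); split.
  apply: (finite_dep2 orb).
    by apply: finite_dep_le (finite_dep_sshift (l := N - m) Pm); rewrite /N; lia.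
  by apply: finite_dep_le (finite_dep_sshift (l := N - n) Qn); rewrite /N; lia.
apply/seteqP; split => x /=; rewrite -!window_sshift ?leq_maxl ?leq_maxr//.
  by case=> ->; rewrite ?orbT.
by move=> /orP[]; [left|right].
Qed.

Lemma cylinders_generate : measurable `<=` <<s cylinders >>.
Proof.
move=> E mE; apply: (smallest_sub _ _ mE); first exact: smallest_sigma_algebra.
move=> _ [i _ [B mB <-]]; apply: sub_sigma_algebra.
exists (absz i).+1, (fun w => w (absz (i + ((absz i).+1)%:Z)) \in B); split.
  by move=> w w' ww'; rewrite ww'//; lia.
rewrite setTI; apply/seteqP; split => x /=; rewrite in_setE /window;
  by have -> : - ((absz i).+1)%:Z + (absz (i + ((absz i).+1)%:Z))%:Z = i by lia.
Qed.

Lemma prod_1D_le (n : nat) (a : nat -> R) : (forall k, 0 <= a k) ->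
  \prod_(k < n) (1 + a k) <= expR (\sum_(k < n) a k).
Proof.
move=> a0; rewrite expR_sum; apply: ler_prod => k _.
by rewrite expR_ge1Dx andbT addr_ge0.
Qed.

(** On each window the density has second moment the product of the [1 + (p' - p)^2 / (p (1 - p))],
    at most [exp (C / eta^2)], a bound independent of the window. Summability over the integers is
    expressed by a common bound for all finite windows. *)
Lemma kakutani_dominates (p p' : int -> R) (mu mu' : probability (seqZ bool) R) (eta C : R) :
  is_product_measure (fun i => bernoulli_prob (p i)) mu ->
  is_product_measure (fun i => bernoulli_prob (p' i)) mu' ->
  0 < eta -> (forall i, eta <= p i <= 1 - eta) -> (forall i, 0 <= p' i <= 1) ->
  (forall (l : int) n, \sum_(k < n) (p' (l + k%:Z) - p (l + k%:Z)) ^+ 2 <= C) ->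
  mu' `<< mu.
Proof.
move=> muE mu'E eta0 pe p'01 sumC.
have p01 i : 0 < p i < 1 by have := pe i; lra.
have bE q i : 0 <= q i <= 1 -> fine (bernoulli_prob (q i) [set a | id a]) = q i :> R.
  move=> q01; rewrite bernoulli_probE// !diracE [true \in _]mem_set// [false \in _]memNset//.
  by rewrite -!EFinM -EFinD /= mulr1 mulr0 addr0.
apply: (@algebra_dominates _ _ _ mu mu' cylinders (expR (eta^-1 ^+ 2 * C))).
- exact: cylinders_measurable.
- exact: cylinders0.
- exact: cylindersC.
- exact: cylindersU.
- exact: cylinders_generate.
- exact: expR_ge0.
move=> _ [n [P [Pn ->]]].
have mid c : measurable [set a : bool | id a = c] by [].
rewrite (product_windowT mu'E mid _ Pn) (product_windowT muE mid _ Pn) /=.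
set q' := (fun k => _); set q := (fun k => fine (bernoulli_prob (p _) _)).
have q'E k : q' k = p' (- n%:Z + k%:Z) by exact: bE.
have qE k : q k = p (- n%:Z + k%:Z) by apply: bE; have := p01 (- n%:Z + k%:Z); lra.
have := @bitsE_sqr_le _ q q' n.*2 (fun w => (P w)%:R).
move=> /(_ _ _)/le_trans; apply.
- by move=> k; rewrite qE.
- by move=> k; rewrite q'E.
have -> : (fun w => (P w)%:R ^+ 2) = (fun w => (P w)%:R : R).
  by apply/funext => w; case: (P w); rewrite ?expr1n ?expr0n.
apply: ler_wpM2r.
  by apply: bitsE_ge0 => // k; rewrite qE; have := p01 (- n%:Z + k%:Z); lra.
pose a k : R := eta^-1 ^+ 2 * (p' (- n%:Z + k%:Z) - p (- n%:Z + k%:Z)) ^+ 2.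
apply: (@le_trans _ _ (\prod_(k < n.*2) (1 + a k))); last first.
  apply: (le_trans (prod_1D_le _ _)).
    by move=> k; rewrite mulr_ge0 ?sqr_ge0.
  by rewrite ler_expR -mulr_sumr ler_wpM2l ?sqr_ge0.
apply: ler_prod => k _; rewrite q'E qE.
move: (p01 (- n%:Z + k%:Z)) (p'01 (- n%:Z + k%:Z)) (pe (- n%:Z + k%:Z)); rewrite /a.
move: (p _) (p' _) => x y x01 y01 xe.
have x0 : 0 < x by lra. 
have x1 : 0 < 1 - x by lra.
apply/andP; split; first by rewrite addr_ge0// divr_ge0 ?sqr_ge0// ltW.
have -> : y ^+ 2 / x + (1 - y) ^+ 2 / (1 - x) = 1 + (x * (1 - x))^-1 * (y - x) ^+ 2.
  by field; rewrite !gt_eqF.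
rewrite lerD2l ler_wpM2r ?sqr_ge0// exprVn lef_pV2 ?posrE ?exprn_gt0 ?mulr_gt0//.
by nra.
Qed.

End Kakutani.

Section KakutaniConverse.
Context {d : measure_display} {S : measurableType d} {R : realType}.

(** If the sums were unbounded, the Hellinger affinity on suitable windows, at most the exponential
    of minus half the sum, would tend to 0; the tests of [bitsE_hellinger] would then separate the
    two measures. *)
Lemma dominates_sum_sqr (b b' : int -> probability S R) (mu mu' : probability (seqZ S) R)
    (f : S -> bool) :
  is_product_measure b mu -> is_product_measure b' mu' ->
  (forall c, measurable [set a | f a = c]) -> mu' `<< mu ->
  exists C : R, forall (l : int) n,
    \sum_(k < n) (fine (b (l + k%:Z) [set a | f a]) -
                  fine (b' (l + k%:Z) [set a | f a])) ^+ 2 <= C.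
Proof.
move=> muE mu'E mf mu'mu; apply: contrapT => /forallNP unb.
apply: (@not_dominates _ _ _ mu mu') mu'mu => e e0.
(* A sum above [- 2 * ln e] brings the affinity below [e]. *)
have /existsNP[l /existsNP[n /negP]] := unb (- 2 * ln e).
rewrite -ltNge.
set p := (fun k : nat => fine (b (l + k%:Z) [set a | f a])).
set p' := (fun k : nat => fine (b' (l + k%:Z) [set a | f a])).
rewrite -[\sum_(k < n) _]/(\sum_(k < n) (p k - p' k) ^+ 2) => big.
have b01 (c : int -> probability S R) i : 0 <= fine (c i [set a | f a]) <= 1.
  rewrite fine_ge0//= -lee_fin fineK ?probability_le1 ?fin_num_measure//; exact: (mf true).
have [g [gn]] := @bitsE_hellinger _ p p' n 1 1 (fun k => b01 _ _) (fun k => b01 _ _) ler01 ler01.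
rewrite !mul1r sqrtr1 mul1r => hg.
have prod_le : \prod_(k < n) (Num.sqrt (p k * p' k) + Num.sqrt ((1 - p k) * (1 - p' k))) <= e.
  apply: (@le_trans _ _ (\prod_(k < n) expR (- ((p k - p' k) ^+ 2 / 2)))).
    apply: ler_prod => k _; rewrite addr_ge0 ?sqrtr_ge0//=.
    apply: le_trans (hellinger_affinity_le (b01 _ _) (b01 _ _)) _.
    exact: expR_ge1Dx.
  rewrite -expR_sum -[leRHS](lnK e0) ler_expR sumrN -mulr_suml.
  by move: big; set s := \sum_(k < n) _; lra.
have E0 : 0 <= bitsE p n (fun w => (g w)%:R) by apply: bitsE_ge0 => // k; exact: b01.
have E1 : 0 <= bitsE p' n (fun w => (~~ g w)%:R) by apply: bitsE_ge0 => // k; exact: b01.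
exists [set x | g (window f l x)]; split.
- exact: (measurable_window mf _ gn).
- by rewrite (product_windowT muE mf _ gn) lee_fin; lra.
- have -> : ~` [set x | g (window f l x)] = [set x | (fun w => ~~ g w) (window f l x)].
    by apply/seteqP; split => x /= /negP.
  have ngn : finite_dep n (fun w => ~~ g w) by exact: finite_dep_comp.
  by rewrite (product_windowT mu'E mf _ ngn) lee_fin; lra.
Qed.

End KakutaniConverse.

(** * Marks and their fair coins *)

Section Marks.
Context {d : measure_display} {S : measurableType d}.
Variables (a b : S).
Implicit Types (x : seqZ S) (u : seqZ bool) (F : pred int).

(* The word [aab(ab)b] or [aab(ba)b]: occurrences are disjoint, and exchanging
   [ab] and [ba] inside some of them creates or destroys none. *)
Definition mark x (i : int) : bool :=
  [&& x i == a, x (i + 1) == a, x (i + 2) == b,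
      ((x (i + 3) == a) && (x (i + 4) == b)) ||
      ((x (i + 3) == b) && (x (i + 4) == a)) & x (i + 5) == b].

(** Written by position: site [i] holds the first letter of the pair of the mark [i - 3] or the
    second letter of the pair of the mark [i - 4]; for [a != b] both cannot be marks. *)
Definition resample F u x : seqZ S := fun i =>
  if F (i - 3) && mark x (i - 3) then (if u (i - 3) then a else b)
  else if F (i - 4) && mark x (i - 4) then (if u (i - 4) then b else a)
  else x i.

Lemma mark_shift x i j : mark (fun k => x (k + j)) i = mark x (i + j).
Proof.
by rewrite /mark; congr [&& x _ == a, x _ == a, x _ == b,
  ((x _ == a) && (x _ == b)) || ((x _ == b) && (x _ == a)) & x _ == b]; lia.
Qed.

Hypothesis ab : a != b.

(** The word does not overlap itself: a shift by 1, 2, 4 or 5 puts an initial [a] on a fixed [b],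
    and a shift by 3 requires the pair to be [aa]. *)
Lemma mark_disjoint x i j : mark x i -> mark x j -> i < j -> i + 6 <= j.
Proof.
move=> /and5P[/eqP i0 /eqP i1 /eqP i2 i34 /eqP i5] /and5P[/eqP j0 /eqP j1 _ _ _] ij.
rewrite leNgt; apply/negP => ji.
have : j = i + 1 \/ j = i + 2 \/ j = i + 3 \/ j = i + 4 \/ j = i + 5 by lia.
have neq y : x y = a -> x y = b -> False by move=> -> ?; move: ab => /eqP.
case=> [E|[E|[E|[E|E]]]]; rewrite E in j0 j1.
- by apply: (neq (i + 2)) => //; rewrite -j1; congr x; lia.
- exact: (neq _ j0 i2).
- have j1' : x (i + 4) = a by rewrite -j1; congr x; lia.
  by move: i34; rewrite j0 j1' !eqxx (negPf ab).
- by apply: (neq (i + 5)) => //; rewrite -j1; congr x; lia.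
- exact: (neq _ j0 i5).
Qed.

Lemma mark_near x i j : mark x i -> i != j -> i - 6 < j < i + 6 -> mark x j = false.
Proof.
move=> mi ij /andP[ji ji']; apply/negP => mj.
have [lt|lt|E] := ltgtP i j; last by rewrite E eqxx in ij.
  by have := mark_disjoint mi mj lt; lia.
by have := mark_disjoint mj mi lt; lia.
Qed.

Lemma resample_far F u x i :
  mark x (i - 3) = false -> mark x (i - 4) = false -> resample F u x i = x i.
Proof. by move=> h3 h4; rewrite /resample h3 h4 !andbF. Qed.

Lemma resample_3 F u x i : mark x i ->
  resample F u x (i + 3) = if F i then (if u i then a else b) else x (i + 3).
Proof.
move=> mi; rewrite /resample addrK mi andbT; case: (F i) => //.
by rewrite (mark_near mi) ?andbF//; lia.
Qed.

Lemma resample_4 F u x i : mark x i ->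
  resample F u x (i + 4) = if F i then (if u i then b else a) else x (i + 4).
Proof.
move=> mi; rewrite /resample addrK mi andbT (mark_near mi) ?andbF//; lia.
Qed.

Lemma mark_resample_imp F u x i : mark x i -> mark (resample F u x) i.
Proof.
move=> mi; have /and5P[i0 i1 i2 i34 i5] := mi.
have far j : j != i + 3 -> j != i + 4 -> i <= j <= i + 5 -> resample F u x j = x j.
  by move=> j3 j4 ij; apply: resample_far; apply: (mark_near mi); lia.
rewrite /mark resample_3// resample_4// !far; try lia.
rewrite i0 i1 i2 i5 /= andbT; case: (F i) => //.
by case: (u i); rewrite !eqxx ?orbT.
Qed.

(** An old mark survives, its pair remaining [ab] or [ba]. A new mark would be disjoint from the
    surviving ones, so no letter in it would have been changed and it would not be new. *)
Lemma mark_resample F u x i : mark (resample F u x) i = mark x i.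
Proof.
apply/idP/idP => [mi|]; last exact: mark_resample_imp.
apply: contraTT mi => nmi; apply/negP => mi.
have nm j : i - 6 < j < i + 6 -> mark x j = false.
  move=> ij; have [->|ji] := eqVneq j i; first exact: negbTE.
  apply/negP => mj; have := mark_near mi _ ij.
  by rewrite mark_resample_imp// eq_sym => /(_ ji).
have E j : i <= j <= i + 5 -> resample F u x j = x j.
  by move=> ij; apply: resample_far; apply: nm; lia.
by move: mi nmi; rewrite /mark !E; try lia; move=> ->.
Qed.

(** Marks can be resampled one after the other because resampling moves none of them. *)
Lemma resampleU1 F u x (s : int) : F s = false ->
  resample [pred i | (i == s) || F i] u x =
  resample (pred1 s) u (resample F u x).
Proof.
move=> Fs; apply/funext => i; rewrite {1 2}/resample /= !mark_resample.
have [E3|i3] := eqVneq (i - 3) s; rewrite /=.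
  case: ifP => // m3; rewrite E3 in m3.
  have -> : (i - 4 == s) = false by lia.
  by rewrite /= /resample E3 m3 andbF.
have [E4|i4] := eqVneq (i - 4) s; rewrite /=.
  case: (boolP (mark x (i - 4))) => m4.
    have -> : mark x (i - 3) = false by apply: (mark_near m4); lia.
    by rewrite andbF.
  by rewrite /resample E4 Fs.
by [].
Qed.

Lemma eq_resample F F' u x i : F (i - 3) = F' (i - 3) -> F (i - 4) = F' (i - 4) ->
  resample F u x i = resample F' u x i.
Proof. by rewrite /resample => -> ->. Qed.

Lemma resample1_cst s u x :
  resample (pred1 s) u x = resample (pred1 s) (fun=> u s) x.
Proof.
apply/funext => i; rewrite /resample /=.
by case: eqP => [->//|_]; case: eqP => [->//|_].
Qed.

Section Measurability.
Hypothesis mS : forall B : set S, measurable B.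
Context {d' : measure_display} {T : measurableType d'}.

Lemma measurable_coord_eq (X : T -> seqZ S) i c : measurable_fun setT X ->
  measurable_fun setT (fun t => X t i == c).
Proof.
move=> mX _ B _; rewrite setTI.
have := measurableT_comp (measurable_coord i) mX.
move=> /(_ measurableT [set s | B (s == c)] (mS _)); rewrite setTI; apply.
Qed.

Lemma measurable_mark (X : T -> seqZ S) i : measurable_fun setT X ->
  measurable_fun setT (fun t => mark (X t) i).
Proof.
move=> mX; have mE j c := measurable_coord_eq j c mX.
apply: measurable_and => //; apply: measurable_and => //; apply: measurable_and => //.
by apply: measurable_and => //; apply: measurable_or; exact: measurable_and.
Qed.

Lemma measurable_resample F (U : T -> seqZ bool) (X : T -> seqZ S) :
  measurable_fun setT U -> measurable_fun setT X ->
  measurable_fun setT (fun t => resample F (U t) (X t)).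
Proof.
move=> mU mX; apply: measurable_seqZ => i; rewrite /resample.
have mUi j : measurable_fun setT (fun t => U t j).
  exact: (measurableT_comp (measurable_coord j) mU).
apply: measurable_fun_ifT; [|exact: measurable_fun_ifT|apply: measurable_fun_ifT].
- by apply: measurable_and => //; exact: measurable_mark.
- by apply: measurable_and => //; exact: measurable_mark.
- exact: measurable_fun_ifT.
- exact: (measurableT_comp (measurable_coord i) mX).
Qed.

End Measurability.
End Marks.

(** * Resampling the pairs with their conditional law preserves the measure *)

Section ResampleLaw.
Context {d : measure_display} {S : measurableType d} {R : realType}.
Variables (a b : S) (rho_ : int -> probability S R) (rho : probability (seqZ S) R).
Hypotheses (ab : a != b) (mS : forall B : set S, measurable B)
  (rhoE : is_product_measure rho_ rho)
  (pos_a : forall i, 0 < fine (rho_ i [set a])) (pos_b : forall i, 0 < fine (rho_ i [set b])).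

Let w i c : R := fine (rho_ i [set c]).

(* Conditional probability that the pair of the mark [i] is [ab]. *)
Definition mark_bias (i : int) : R :=
  w (i + 3) a * w (i + 4) b / (w (i + 3) a * w (i + 4) b + w (i + 3) b * w (i + 4) a).

Lemma mark_bias01 i : 0 < mark_bias i < 1.
Proof.
have p1 : 0 < w (i + 3) a * w (i + 4) b by apply: mulr_gt0; [exact: pos_a|exact: pos_b].
have p2 : 0 < w (i + 3) b * w (i + 4) a by apply: mulr_gt0; [exact: pos_b|exact: pos_a].
by rewrite /mark_bias divr_gt0 ?addr_gt0//= ltr_pdivrMr ?addr_gt0// mul1r ltrDl.
Qed.

Lemma product_rect_coord2 (I : {fset int}) B (i j : int) C D :
  i \notin I -> j \notin I -> i != j ->
  rho ((rect I B `&` [set x | C (x i)]) `&` [set x | D (x j)]) =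
  (rho (rect I B) * rho_ i C * rho_ j D)%E.
Proof.
move=> iI jI ij.
have E : rect I B `&` [set x | C (x i)] =
    rect (i |` I)%fset (fun k => if k == i then C else B k).
  apply/seteqP; split => x /=.
    move=> [xB xC] k; rewrite in_fset1U => /orP[/eqP ->|]; first by rewrite eqxx.
    by move=> kI; case: eqP => [->//|_]; exact: xB.
  move=> h; split => [k kI|]; last by have := h i; rewrite eqxx; apply; rewrite in_fset1U eqxx.
  have := h k; rewrite in_fset1U kI orbT => /(_ isT).
  by case: eqP kI => // ->; rewrite (negPf iI).
have jI' : j \notin (i |` I)%fset by rewrite in_fset1U negb_or eq_sym ij.
rewrite E (product_rect_coord rhoE jI' (fun=> mS _) (mS _)) -E.
by rewrite (product_rect_coord rhoE iI (fun=> mS _) (mS _)).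
Qed.

Lemma measurable_resample_cst F (u : seqZ bool) : measurable_fun setT (@resample _ S a b F u).
Proof.
exact: (measurable_resample a b mS F (@measurable_cst _ _ _ _ setT u) (@measurable_id _ _ setT)).
Qed.

Section SingleSite.
Variables (s : int) (J : {fset int}) (B : int -> set S).

(** [W] imposes the rectangle off the pair and the four fixed letters of a mark at [s]; [A1] and
    [A0] add the pair [ab] or [ba]; [kap c] tells whether the pair written by the bit [c] meets the
    constraints of the rectangle. *)
Let J' := [fset j in J | ((j != s + 3) && (j != s + 4))%R]%fset.
Let K := [fset s; (s + 1)%R; (s + 2)%R; (s + 5)%R]%fset.
Let C (i : int) : set S := if (i == s) || (i == s + 1) then [set a] else [set b].
Let W := rect J' B `&` rect K C.
Let A1 := (W `&` [set x | [set a] (x (s + 3))]) `&` [set x | [set b] (x (s + 4))].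
Let A0 := (W `&` [set x | [set b] (x (s + 3))]) `&` [set x | [set a] (x (s + 4))].
Let M := [set x : seqZ S | mark a b x s].
Let kap (c : bool) : bool :=
  ((s + 3 \in J) ==> ((if c then a else b) \in B (s + 3))) &&
  ((s + 4 \in J) ==> ((if c then b else a) \in B (s + 4))).

Let rhoA c c' : rho ((W `&` [set x | [set c] (x (s + 3))]) `&` [set x | [set c'] (x (s + 4))]) =
  (fine (rho W) * w (s + 3) c * w (s + 4) c')%:E.
Proof.
rewrite /W rectI product_rect_coord2; last 3 first.
- by rewrite in_fsetU !inE /= eqxx andbF /=; lia.
- by rewrite in_fsetU !inE /= eqxx !andbF /=; lia.
- by lia.
rewrite -rectI -/W !EFinM !fineK ?fin_num_measure//.
by rewrite /W rectI; exact: measurable_rect.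
Qed.

Let WM x : W x -> [/\ x s = a, x (s + 1) = a, x (s + 2) = b & x (s + 5) = b].
Proof.
move=> [_ h]; split.
- by have := h s; rewrite /C eqxx; apply; rewrite !inE eqxx.
- by have := h (s + 1); rewrite /C eqxx orbT; apply; rewrite !inE eqxx ?orbT.
- have := h (s + 2); rewrite /C.
  have -> : (s + 2 == s) || (s + 2 == s + 1) = false by lia.
  by apply; rewrite !inE eqxx ?orbT.
- have := h (s + 5); rewrite /C.
  have -> : (s + 5 == s) || (s + 5 == s + 1) = false by lia.
  by apply; rewrite !inE eqxx ?orbT.
Qed.

Let AM : A1 `|` A0 `<=` M.
Proof.
by move=> x [] [[/WM[E0 E1 E2 E5] E3] E4]; rewrite /M /= /mark E0 E1 E2 E3 E4 E5 !eqxx ?orbT.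
Qed.

Let W_of_mark x : M x -> W x <-> forall i, i \in J -> i != s + 3 -> i != s + 4 -> B i (x i).
Proof.
move=> /and5P[/eqP E0 /eqP E1 /eqP E2 _ /eqP E5]; split.
  by move=> [xB _] i iJ i3 i4; apply: xB; rewrite !inE iJ i3 i4.
move=> h; split => [i|i]; rewrite !inE; first by move=> /and3P[iJ i3 i4]; exact: h.
rewrite /C => /orP[/orP[/orP[|]|]|] /eqP ->; rewrite ?eqxx ?orbT//.
  by have -> : (s + 2 == s) || (s + 2 == s + 1) = false by lia.
by have -> : (s + 5 == s) || (s + 5 == s + 1) = false by lia.
Qed.

Let A_of_mark x : M x -> (A1 `|` A0) x <-> W x.
Proof.
move=> mx; split; first by case=> -[[]].
have /and5P[_ _ _ /orP[] /andP[/eqP E3 /eqP E4] _] := mx => Wx.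
  by left.
by right.
Qed.

Let rect_of_mark (y x : seqZ S) : M x ->
  (forall i, i != s + 3 -> i != s + 4 -> y i = x i) ->
  rect J B y <-> [/\ W x, (s + 3 \in J) ==> (y (s + 3) \in B (s + 3)) &
                         (s + 4 \in J) ==> (y (s + 4) \in B (s + 4))].
Proof.
move=> mx yx; split.
  move=> h; split.
  - by apply/W_of_mark => // i iJ i3 i4; rewrite -yx//; exact: h.
  - by apply/implyP => h3; rewrite in_setE; exact: h.
  - by apply/implyP => h4; rewrite in_setE; exact: h.
move=> [/(W_of_mark mx) h /implyP h3 /implyP h4] i iJ.
have [E|i3] := eqVneq i (s + 3); first by move: h3; rewrite in_setE E -E; exact.
have [E|i4] := eqVneq i (s + 4); first by move: h4; rewrite in_setE E -E; exact.
by rewrite yx//; exact: h.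
Qed.

Let setE c : [set x | rect J B (resample a b (pred1 s) (fun=> c) x)] =
  (rect J B `\` M) `|` (if kap c then A1 `|` A0 else set0).
Proof.
have other (x : seqZ S) i : i != s + 3 -> i != s + 4 ->
    resample a b (pred1 s) (fun=> c) x i = x i.
  move=> i3 i4; rewrite /resample /=.
  have -> : (i - 3 == s) = false by lia.
  by have -> : (i - 4 == s) = false by lia.
have y3 (x : seqZ S) : M x -> resample a b (pred1 s) (fun=> c) x (s + 3) = if c then a else b.
  by move=> mx; rewrite (resample_3 ab _ _ mx) /= eqxx.
have y4 (x : seqZ S) : M x -> resample a b (pred1 s) (fun=> c) x (s + 4) = if c then b else a.
  by move=> mx; rewrite (resample_4 ab _ _ mx) /= eqxx.
have unmarked (x : seqZ S) : ~ M x -> resample a b (pred1 s) (fun=> c) x = x.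
  move=> /negP/negbTE nmx; apply/funext => i; rewrite /resample /=.
  have [E|_] := eqVneq (i - 3) s.
    by rewrite E nmx; have -> : (i - 4 == s) = false by lia.
  by have [->|] := eqVneq (i - 4) s; rewrite ?nmx.
apply/seteqP; split => x /=.
  have [mx|nmx] := pselect (M x); last by rewrite unmarked//; left.
  move=> /(rect_of_mark mx (other x)) []; rewrite y3// y4// => Wx h3 h4.
  by right; rewrite /kap h3 h4; apply/A_of_mark.
case=> [[h nmx]|]; first by rewrite unmarked.
case: ifP => // /andP[h3 h4] Ax; have mx := AM Ax.
apply/(rect_of_mark mx (other x)); split; first exact/A_of_mark.
  by rewrite y3.
by rewrite y4.
Qed.

Let rectE : rect J B = (rect J B `\` M) `|`
  ((if kap true then A1 else set0) `|` (if kap false then A0 else set0)).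
Proof.
apply/seteqP; split => x.
  have [mx|nmx] := pselect (M x); last by left.
  move=> /(rect_of_mark mx (fun _ _ _ => erefl)) [Wx]; rewrite /kap.
  have /and5P[_ _ _ /orP[] /andP[/eqP E3 /eqP E4] _] := mx; rewrite E3 E4 => -> ->; right.
    by left.
  by right.
case=> [[]//|[]]; case: ifP => // /andP[h3 h4] Ax.
  have mx : M x by apply: AM; left.
  have := Ax; move=> [[Wx E3] E4].
  by apply/(rect_of_mark mx (fun _ _ _ => erefl)); rewrite E3 E4.
have mx : M x by apply: AM; right.
have := Ax; move=> [[Wx E3] E4].
by apply/(rect_of_mark mx (fun _ _ _ => erefl)); rewrite E3 E4.
Qed.

(** Off the marks nothing changes. On [W] the two pairs have weights in the ratio
    [mark_bias s : 1 - mark_bias s], and resampling distributes their total weight again in this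
    ratio. *)
Lemma resample1_rect :
  (fine (rho [set x | rect J B (resample a b (pred1 s) (fun=> true) x)]) * mark_bias s +
   fine (rho [set x | rect J B (resample a b (pred1 s) (fun=> false) x)]) * (1 - mark_bias s)) =
  fine (rho (rect J B)).
Proof.
have mB : measurable (rect J B) by exact: measurable_rect.
have mM : measurable M.
  have := @measurable_mark _ S a b mS _ _ id s (@measurable_id _ _ setT).
  by move=> /(_ measurableT [set true]); rewrite setTI; apply.
have mW : measurable W by rewrite /W rectI; exact: measurable_rect.
have mAA c c' : measurable ((W `&` [set x | [set c] (x (s + 3))]) `&`
    [set x : seqZ S | [set c'] (x (s + 4))]).
  have mc j e : measurable [set x : seqZ S | [set e] (x j)].
    by have := measurable_coord j measurableT (mS [set e]); rewrite setTI.
  by apply: measurableI => //; exact: measurableI.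
have mA1 : measurable A1 by exact: mAA.
have mA0 : measurable A0 by exact: mAA.
have A10 : A1 `&` A0 = set0.
  apply/seteqP; split => x //= -[[[_ h1] _] [[_ h2] _]].
  by move: ab; rewrite -h1 -h2 eqxx.
have mD : measurable (rect J B `\` M) by exact: measurableD.
have disj X : X `<=` A1 `|` A0 -> (rect J B `\` M) `&` X = set0.
  by move=> XA; apply/seteqP; split => x //= -[[_ nM] /XA /AM].
have real (E : set (seqZ S)) : measurable E -> rho E = (fine (rho E))%:E.
  by move=> mE; rewrite fineK// fin_num_measure.
have addU E F : measurable E -> measurable F -> E `&` F = set0 ->
    fine (rho (E `|` F)) = fine (rho E) + fine (rho F).
  by move=> mE mF EF; rewrite measureU// fineD// fin_num_measure.
have fA1 : fine (rho A1) = fine (rho W) * w (s + 3) a * w (s + 4) b by rewrite /A1 rhoA.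
have fA0 : fine (rho A0) = fine (rho W) * w (s + 3) b * w (s + 4) a by rewrite /A0 rhoA.
have mif (c : bool) (E : set (seqZ S)) : measurable E -> measurable (if c then E else set0).
  by case: c.
have fif (c : bool) (E : set (seqZ S)) :
    fine (rho (if c then E else set0)) = c%:R * fine (rho E).
  by case: c; rewrite ?measure0 ?mul1r ?mul0r.
have sub (c c' : bool) : (if c then A1 else set0) `|` (if c' then A0 else set0) `<=` A1 `|` A0.
  by case: c; case: c' => x [] // ?; [left|right|left|right].
have f1 c : fine (rho ((rect J B `\` M) `|` (if kap c then A1 `|` A0 else set0))) =
    fine (rho (rect J B `\` M)) + (kap c)%:R * (fine (rho A1) + fine (rho A0)).
  have mX : measurable (if kap c then A1 `|` A0 else set0).
    by apply: mif; exact: measurableU.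
  by rewrite addU// ?fif ?addU//; apply: disj; case: ifP => _ x.
have f2 : fine (rho (rect J B)) = fine (rho (rect J B `\` M)) +
    ((kap true)%:R * fine (rho A1) + (kap false)%:R * fine (rho A0)).
  have m1 := mif (kap true) _ mA1; have m0 := mif (kap false) _ mA0.
  rewrite {1}rectE addU//; [|exact: measurableU|exact: disj].
  by rewrite addU// ?fif//; case: ifP => _; case: ifP => _; rewrite ?set0I ?setI0.
rewrite !setE !f1 f2 fA1 fA0 /mark_bias.
have p1 : 0 < w (s + 3) a * w (s + 4) b by apply: mulr_gt0; [exact: pos_a|exact: pos_b].
have p2 : 0 < w (s + 3) b * w (s + 4) a by apply: mulr_gt0; [exact: pos_b|exact: pos_a].
by field; rewrite gt_eqF// addr_gt0.
Qed.

End SingleSite.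

Lemma bernoulli_prob1 (p : R) c : 0 <= p <= 1 ->
  bernoulli_prob p [set c] = (if c then p else 1 - p)%:E.
Proof.
move=> p01; rewrite bernoulli_probE// !diracE.
case: c.
  rewrite [true \in _]mem_set// [false \in _]memNset//.
  by rewrite -!EFinM -EFinD /= mulr1 mulr0 addr0.
rewrite [true \in _]memNset// [false \in _]mem_set//.
by rewrite -!EFinM -EFinD /= mulr1 mulr0 add0r.
Qed.

(** The left side is the law of the resampled sequence under [rho] and an independent coin, a
    probability, so agreement on rectangles is enough. *)
Lemma resample1_law (s : int) E : measurable E ->
  (rho [set x | E (resample a b (pred1 s) (fun=> true) x)] * (mark_bias s)%:E +
   rho [set x | E (resample a b (pred1 s) (fun=> false) x)] * (1 - mark_bias s)%:E)%E =
  rho E.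
Proof.
have t01 : 0 <= mark_bias s <= 1 by have := mark_bias01 s; lra.
pose PB : probability (seqZ S * bool)%type R := (rho \x bernoulli_prob (mark_bias s))%E.
pose f (z : seqZ S * bool) : seqZ S := resample a b (pred1 s) (fun=> z.2) z.1.
have mf : measurable_fun setT f.
  apply: (measurable_resample a b mS); last exact: measurable_fst.
  by apply: measurable_seqZ => i; exact: measurable_snd.
have [Q QE] := pushforward_probability PB mf.
have mc c A : measurable A -> measurable [set x | A (resample a b (pred1 s) (fun=> c) x)].
  move=> mA; have := measurable_resample_cst (pred1 s) (fun=> c) measurableT mA.
  by rewrite setTI.
have QA A : measurable A -> Q A =
    (rho [set x | A (resample a b (pred1 s) (fun=> true) x)] * (mark_bias s)%:E +
     rho [set x | A (resample a b (pred1 s) (fun=> false) x)] * (1 - mark_bias s)%:E)%E.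
  move=> mA; rewrite QE.
  have -> : f @^-1` A = ([set x | A (resample a b (pred1 s) (fun=> true) x)] `*` [set true]) `|`
      ([set x | A (resample a b (pred1 s) (fun=> false) x)] `*` [set false]).
    apply/seteqP; split => -[x c] /=; rewrite /f /=; first by case: c; [left|right].
    by case=> -[+ ->].
  rewrite measureU; last first.
  - by apply/seteqP; split => -[x c] //= [[_ ->] []].
  - by apply: measurableX => //; exact: mc.
  - by apply: measurableX => //; exact: mc.
  rewrite [X in (X + _)%E = _](product_measure1E rho (bernoulli_prob (mark_bias s)) (mc true _ mA))//.
  rewrite [X in (_ + X)%E = _](product_measure1E rho (bernoulli_prob (mark_bias s)) (mc false _ mA))//.
  by congr (_ * _ + _ * _)%E; [exact: (bernoulli_prob1 true)|exact: (bernoulli_prob1 false)].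
move=> mE; rewrite -QA//; apply: eq_seqZ_measure mE => J B mB.
have mR : measurable (rect J B) by exact: measurable_rect.
have fr c : rho [set x | rect J B (resample a b (pred1 s) (fun=> c) x)] =
    (fine (rho [set x | rect J B (resample a b (pred1 s) (fun=> c) x)]))%:E.
  by rewrite fineK// fin_num_measure//; exact: mc.
rewrite QA// (fr true) (fr false) -!EFinM -EFinD resample1_rect fineK//.
exact: fin_num_measure.
Qed.

Section AllSites.
Variable beta : probability (seqZ bool) R.
Hypothesis betaE : is_product_measure (fun i => bernoulli_prob (mark_bias i)) beta.

Let pi : probability (seqZ S * seqZ bool)%type R := (rho \x beta)%E.

Let measurable_resample_pair F :
  measurable_fun setT (fun z : seqZ S * seqZ bool => resample a b F z.2 z.1).
Proof.
by apply: (measurable_resample a b mS); [exact: measurable_snd|exact: measurable_fst].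
Qed.

(** The event on the bits outside [I] is carried along so that, in the induction, the bit of [s] can
    be fixed and join it, while [E] is replaced by its preimage under the resampling at [s]. *)
Let resample_seq_law (I : seq int) E (J : {fset int}) (B : int -> set bool) :
  uniq I -> measurable E -> (forall i, i \in I -> i \notin J) ->
  pi [set z | E (resample a b (mem I) z.2 z.1) /\ rect J B z.2] =
  (rho E * beta (rect J B))%E.
Proof.
have mbool (X : set bool) : measurable X by [].
elim: I E J B => [|s I IH] E J B /=.
  move=> _ mE _; transitivity (pi (E `*` rect J B)); last first.
    by apply: product_measure1E => //; exact: measurable_rect.
  by congr (pi _).
move=> /andP[sI uI] mE IJ.
have sJ : s \notin J by apply: IJ; rewrite inE eqxx.
pose Ec (c : bool) := [set x | E (resample a b (pred1 s) (fun=> c) x)].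
pose Bc (c : bool) i : set bool := if i == s then [set c] else B i.
have mEc c : measurable (Ec c).
  have := measurable_resample_cst (pred1 s) (fun=> c) measurableT mE.
  by rewrite setTI.
have rBc c : rect (s |` J)%fset (Bc c) = rect J B `&` [set u | [set c] (u s)].
  apply/seteqP; split => x /=.
    move=> h; split => [k kJ|]; last by have := h s; rewrite /Bc eqxx; apply; rewrite in_fset1U eqxx.
    have := h k; rewrite /Bc in_fset1U kJ orbT => /(_ isT).
    by case: eqP kJ => // ->; rewrite (negPf sJ).
  move=> [xB xC] k; rewrite in_fset1U /Bc => /orP[/eqP ->|]; first by rewrite eqxx.
  by move=> kJ; case: eqP => [->//|_]; exact: xB.
have IHc c : pi [set z | Ec c (resample a b (mem I) z.2 z.1) /\ rect (s |` J)%fset (Bc c) z.2] =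
    (rho (Ec c) * (beta (rect J B) * (if c then mark_bias s else 1 - mark_bias s)%:E))%E.
  rewrite IH//; last first.
    move=> i iI; rewrite in_fset1U negb_or IJ ?inE ?iI ?orbT// andbT.
    by apply: contraNneq sI => <-.
  rewrite rBc (product_rect_coord betaE sJ (fun=> mbool _) (mbool _)).
  congr (_ * (_ * _))%E; apply: bernoulli_prob1.
  by have := mark_bias01 s; lra.
have mset c : measurable [set z : seqZ S * seqZ bool |
    Ec c (resample a b (mem I) z.2 z.1) /\ rect (s |` J)%fset (Bc c) z.2].
  apply: (@measurableI _ _ [set z | Ec c (resample a b (mem I) z.2 z.1)]
    [set z | rect (s |` J)%fset (Bc c) z.2]).
    by have := measurable_resample_pair (mem I) measurableT (mEc c); rewrite setTI.
  have := @measurable_snd _ _ (seqZ S) (seqZ bool) measurableT _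
    (@measurable_rect _ _ (s |` J)%fset (Bc c) (fun=> mbool _)).
  by rewrite setTI; apply.
have -> : [set z | E (resample a b (mem (s :: I)) z.2 z.1) /\ rect J B z.2] =
  [set z | Ec true (resample a b (mem I) z.2 z.1) /\ rect (s |` J)%fset (Bc true) z.2] `|`
  [set z | Ec false (resample a b (mem I) z.2 z.1) /\ rect (s |` J)%fset (Bc false) z.2].
  have rE u x : resample a b (mem (s :: I)) u x =
      resample a b (pred1 s) (fun=> u s) (resample a b (mem I) u x).
    by rewrite -resample1_cst -resampleU1//; exact: negbTE.
  apply/seteqP; split => -[x u] /=; rewrite !rBc /Ec /= rE.
    by move=> [+ ru]; case: (u s) => Ex; [left|right].
  by case=> -[+ [ru ->]].
rewrite measureU//; last first.
  by apply/seteqP; split => -[x u] //=; rewrite !rBc /= => -[[_ [_ ->]] [_ [_]]].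
rewrite [X in (X + _)%E = _]IHc [X in (_ + X)%E = _]IHc -(resample1_law s mE).
have fr (A : set (seqZ S)) : measurable A -> rho A = (fine (rho A))%:E.
  by move=> mA; rewrite fineK// fin_num_measure.
have fb : beta (rect J B) = (fine (beta (rect J B)))%:E.
  by rewrite fineK// fin_num_measure//; exact: measurable_rect.
rewrite -/(Ec true) -/(Ec false) fb (fr _ (mEc true)) (fr _ (mEc false)).
rewrite -!(EFinM, EFinD).
by congr EFin; ring.
Qed.

Lemma resample_law E : measurable E ->
  (rho \x beta)%E [set z | E (resample a b predT z.2 z.1)] = rho E.
Proof.
have [Q QE] := pushforward_probability pi (measurable_resample_pair predT).
move=> mE; rewrite -[LHS](QE E); apply: eq_seqZ_measure mE => J B mB.
(* A rectangle over [J] sees only the finitely many marks whose pair meets [J]. *)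
pose I := undup ([seq j - 3 | j <- J] ++ [seq j - 4 | j <- J]).
rewrite QE -[RHS]mule1.
have <- : beta (rect fset0 (fun=> setT)) = 1%E.
  rewrite -(probability_setT beta); congr (beta _).
  by apply/seteqP; split => x //=.
rewrite -(@resample_seq_law I); [|exact: undup_uniq|exact: measurable_rect|by []].
have rE x u j : j \in J -> resample a b predT u x j = resample a b (mem I) u x j.
  move=> jJ; apply: eq_resample; rewrite /= mem_undup mem_cat.
    by rewrite (map_f (fun j => j - 3)).
  by rewrite (map_f (fun j => j - 4)) ?orbT.
congr (pi _); apply/seteqP; split => -[x u] /=.
  by move=> h; split=> // j jJ; rewrite -rE//; exact: h.
by move=> [h _] j jJ; rewrite rE//; exact: h.
Qed.

End AllSites.
End ResampleLaw.

(** * Requests *)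

Section Requests.
Context {d : measure_display} {S : measurableType d}.
Variables (a b : S).
Implicit Types (x : seqZ S).

(* The first of at least eight consecutive marks, so that anchors are eight
   times rarer than marks. *)
Definition anchor x (i : int) : bool :=
  ~~ mark a b x (i - 6) && [forall k : 'I_8, mark a b x (i + (6 * k)%N%:Z)].

(** The marks [i + 6 k], for [i] an anchor and [k < 8], are distinct: if two runs met, the later
    anchor would have a mark six sites before it. The last mark of a run starts [42 = 6 * 7] sites
    after the anchor. *)
Lemma count_marks x l n :
  (8 * \sum_(k < n) (anchor x (l + k%:Z) : nat) <=
   \sum_(k < n + 42) (mark a b x (l + k%:Z) : nat))%N.
Proof.
pose X := [set p : 'I_n * 'I_8 | anchor x (l + (p.1 : nat)%:Z)]%SET.
pose Y := [set k : 'I_(n + 42) | mark a b x (l + (k : nat)%:Z)]%SET.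
have fP (p : 'I_n * 'I_8) : (p.1 + 6 * p.2 < n + 42)%N.
  by case: p => -[i /= in_] [k k8]; rewrite /=; lia.
pose f p := Ordinal (fP p).
have cX : (8 * \sum_(k < n) (anchor x (l + k%:Z) : nat) = #|X|)%N.
  have -> : X = finset.setX [set i : 'I_n | anchor x (l + (i : nat)%:Z)]%SET [set: 'I_8]%SET.
    by apply/setP => -[i k]; rewrite !inE andbT.
  rewrite cardsX cardsT card_ord mulnC; congr muln.
  rewrite -sum1_card [RHS]big_mkcond /=; apply: eq_bigr => i _.
  by rewrite inE; case: (anchor _ _).
have cY : (\sum_(k < n + 42) (mark a b x (l + k%:Z) : nat) = #|Y|)%N.
  rewrite -sum1_card [RHS]big_mkcond /=; apply: eq_bigr => i _.
  by rewrite inE; case: (mark _ _ _ _).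
rewrite cX cY -(card_in_imset (f := f)).
  apply/subset_leq_card/fintype.subsetP => _ /imsetP[[i k] iX ->]; rewrite inE /=.
  move: iX; rewrite inE /= => /andP[_ /forallP/(_ k)].
  by rewrite -addrA -PoszD.
have main (i j : 'I_n) (k m : 'I_8) : (k < m)%N -> anchor x (l + (i : nat)%:Z) ->
    anchor x (l + (j : nat)%:Z) -> (i + 6 * k = j + 6 * m)%N -> False.
  move=> km /andP[/negP ni _] /andP[_ /forallP aj] E; apply: ni.
  have m8 : (m - k.+1 < 8)%N by have := ltn_ord m; lia.
  have := aj (Ordinal m8); congr mark => /=; lia.
move=> [i k] [j m]; rewrite !inE /= => ai aj /(congr1 val) /= E.
have [km|mk|km] := ltngtP k m.
- by case: (main _ _ _ _ km ai aj E).
- by case: (main _ _ _ _ mk aj ai (esym E)).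
- by congr pair; apply: val_inj => //=; lia.
Qed.

(** Six letters [b] and eight copies of [aababb], in all [54 = 6 + 8 * 6] letters: eight adjacent
    marks, and a [b] where a preceding mark would have to start. *)
Lemma anchor_word x l :
  (forall j : nat, (j < 54)%N -> x (l + j%:Z) =
     if (j < 6)%N then b else nth b [:: a; a; b; a; b; b] ((j - 6) %% 6)) -> a != b ->
  anchor x (l + 6).
Proof.
move=> xE ab; apply/andP; split.
  by rewrite addrK /mark; have := xE 0%N isT; rewrite addr0 /= => ->; rewrite eq_sym (negPf ab).
apply/forallP => k; have k8 := ltn_ord k.
have E (m : nat) : (m < 6)%N ->
    x (l + 6 + (6 * k)%N%:Z + m%:Z) = nth b [:: a; a; b; a; b; b] m.
  move=> m6; have -> : l + 6 + (6 * k)%N%:Z + m%:Z = l + (6 + 6 * k + m)%N%:Z by lia.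
  rewrite xE; last lia.
  have -> : (6 + 6 * k + m < 6)%N = false by lia.
  have -> : (6 + 6 * k + m - 6 = k * 6 + m)%N by lia.
  by rewrite modnMDl modn_small.
have E0 := E 0%N isT; rewrite addr0 in E0.
by rewrite /mark E0 (E 1%N) ?(E 2) ?(E 3) ?(E 4) ?(E 5)// !eqxx.
Qed.

Variable N : nat.
Hypothesis N0 : (0 < N)%N.

(* Distance to the last anchor, modulo [N]; the value [0] when there is no anchor
   on the left is irrelevant since this has probability zero. *)
Definition offset x (i : int) : nat :=
  if pselect (exists k : nat, anchor x (i - k%:Z)) is left h then (ex_minn h %% N)%N
  else 0.

Definition request x (i : int) : bool := offset x i == 0%N.

Lemma offset_lt x i : (offset x i < N)%N.
Proof. by rewrite /offset; case: pselect => // h; rewrite ltn_mod. Qed.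

Lemma offset_last x i (k : nat) : anchor x (i - k%:Z) ->
  (forall j : nat, (j < k)%N -> ~~ anchor x (i - j%:Z)) -> offset x i = (k %% N)%N.
Proof.
move=> ak nk; rewrite /offset; case: pselect => [h|[]]; last by exists k.
case: ex_minnP => m am mmin; congr modn; apply/eqP; rewrite eqn_leq mmin//=.
by rewrite leqNgt; apply/negP => /nk; rewrite am.
Qed.

Lemma offset_noanchor x i : (forall k : nat, ~~ anchor x (i - k%:Z)) -> offset x i = 0%N.
Proof.
by move=> h; rewrite /offset; case: pselect => // h'; exfalso; case: h' => k; rewrite (negPf (h k)).
Qed.

Lemma last_anchor x i : (forall k : nat, ~~ anchor x (i - k%:Z)) \/
  exists k : nat, anchor x (i - k%:Z) /\ forall j : nat, (j < k)%N -> ~~ anchor x (i - j%:Z).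
Proof.
have [h|h] := pselect (exists k : nat, anchor x (i - k%:Z)); last first.
  by left=> k; apply/negP => ak; apply: h; exists k.
right; case: (ex_minnP h) => m am mmin; exists m; split=> // j jm.
by apply/negP => /mmin; rewrite leqNgt jm.
Qed.

Lemma request_offset x i : request x (i - (offset x i)%:Z).
Proof.
rewrite /request; have [h|[k [ak kmin]]] := last_anchor x i.
  by rewrite (offset_noanchor h) subr0 (offset_noanchor h).
rewrite (offset_last ak kmin).
have h j : i - (k %% N)%N%:Z - j%:Z = i - (k %% N + j)%N%:Z by lia.
have km := leq_mod k N.
rewrite (@offset_last _ _ (k - k %% N)%N).
- by rewrite {1}(divn_eq k N) addnK modnMl.
- by rewrite h subnKC.
- by move=> j jk; rewrite h kmin//; lia.
Qed.

Lemma offsetS x i (k : nat) : anchor x (i - k%:Z) -> 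
  offset x (i + 1) = if anchor x (i + 1) then 0%N else ((offset x i).+1 %% N)%N.
Proof.
move=> ak; case: ifPn => [ai|nai].
  by rewrite (@offset_last _ _ 0%N) ?subr0 ?mod0n// => j; rewrite ltn0.
have [h|[m [am mmin]]] := last_anchor x i; first by rewrite (negPf (h k)) in ak.
rewrite (offset_last am mmin) (@offset_last _ _ m.+1).
- by rewrite -[in LHS]addn1 -[in RHS]addn1 modnDml.
- by have -> : i + 1 - m.+1%:Z = i - m%:Z by lia.
- move=> [|j] jm; first by rewrite subr0.
  by have -> : i + 1 - j.+1%:Z = i - j%:Z by [lia]; exact: mmin.
Qed.

(** A request that is not an anchor comes after a full block of [N] sites; beginning the count at an
    anchor excludes a block started earlier. *)
Lemma count_extra x l n : anchor x l ->
  (N * \sum_(k < n) (request x (l + k%:Z) && ~~ anchor x (l + k%:Z) : nat) <= n)%N.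
Proof.
move=> al; case: n => [|n]; first by rewrite big_ord0 muln0.
(* The offset counts the sites already spent in the current block, which makes the bound
   inductive. *)
suff : (N * \sum_(k < n.+1) (request x (l + k%:Z) && ~~ anchor x (l + k%:Z) : nat) +
  offset x (l + n%:Z) <= n)%N by lia.
elim: n => [|n IH].
  rewrite big_ord_recl big_ord0 addr0 al andbF addn0 muln0 add0n.
  by rewrite (@offset_last _ _ 0%N) ?subr0 ?mod0n// => j; rewrite ltn0.
rewrite big_ord_recr /= mulnDr.
have lE : l + n.+1%:Z = l + n%:Z + 1 by lia.
have al' : anchor x (l + n%:Z - n%:Z) by rewrite addrK.
rewrite /request lE (offsetS al'); move: IH; set s := (\sum_(k < n.+1) _)%N.
case: (anchor x (l + n%:Z + 1)) => /=; first by rewrite !muln0; lia.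
have o := offset_lt x (l + n%:Z).
have [oN|oN] := ltnP (offset x (l + n%:Z)).+1 N.
  by rewrite modn_small//= muln0; lia.
have -> : (offset x (l + n%:Z)).+1 = N by lia.
by rewrite modnn eqxx muln1; lia.
Qed.

End Requests.

(** * Frequent occurrence of a fixed word in disjoint blocks *)

Section RareWords.
Context {d : measure_display} {S : measurableType d} {R : realType}.
Variables (rho_ : int -> probability S R) (rho : probability (seqZ S) R).
Hypotheses (mS : forall B : set S, measurable B) (rhoE : is_product_measure rho_ rho).
Variables (L : nat) (word : nat -> S) (l : int) (p : R).
Hypotheses (p0 : 0 < p) (p1 : p < 1)
  (word_ge : forall i j, p <= fine (rho_ i [set word j])).

Let block (m : nat) : {fset int} := [fset (l + (L * m + j)%N%:Z)%R | j in iota 0 L]%fset.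
Let pat (i : int) : set S := [set word (absz (i - l) %% L)%N].

Definition occurs (m : nat) (x : seqZ S) : bool :=
  [forall j : 'I_L, x (l + (L * m + j)%N%:Z) == word j].

Let occursE m : [set x | occurs m x] = rect (block m) pat.
Proof.
apply/seteqP; split => x /=.
  move=> /forallP h i /imfsetP[j /=]; rewrite mem_iota => /andP[_ jL] ->.
  rewrite /pat /=; have := h (Ordinal jL) => /eqP ->.
  have -> : absz (l + (L * m + j)%N%:Z - l)%R = (m * L + j)%N by lia.
  by rewrite modnMDl modn_small.
move=> h; apply/forallP => j; apply/eqP.
have := h (l + (L * m + j)%N%:Z); rewrite /pat /=.
have -> : absz (l + (L * m + j)%N%:Z - l)%R = (m * L + j)%N by lia.
rewrite modnMDl modn_small//; apply; apply/imfsetP; exists (val j) => //=.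
by rewrite mem_iota /= add0n.
Qed.

Let measurable_occurs m : measurable [set x | occurs m x].
Proof. by rewrite occursE; exact: measurable_rect. Qed.

Let product_rectU (I J : {fset int}) B C : (forall i, i \in J -> i \notin I) ->
  rho (rect I B `&` rect J C) = (rho (rect I B) * rho (rect J C))%E.
Proof.
move=> IJ; pose D i := if i \in I then B i else C i.
have -> : rect I B `&` rect J C = rect (I `|` J)%fset D.
  apply/seteqP; split => x /=.
    move=> [xB xC] i; rewrite in_fsetU /D; case: ifP => [iI _|_ /= iJ]; [exact: xB|exact: xC].
  move=> h; split => i iI; have := h i; rewrite in_fsetU iI ?orbT /D ?iI => /(_ isT)//.
  by rewrite (negPf (IJ i iI)).
rewrite !rhoE//.
have PE : perm_eq (I `|` J)%fset (enum_fset I ++ enum_fset J).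
  apply: uniq_perm; rewrite ?fset_uniq//.
    rewrite cat_uniq !fset_uniq andbT; apply/hasPn => i iJ; exact: IJ.
  by move=> i; rewrite mem_cat in_fsetU.
rewrite (perm_big _ PE) big_cat /=.
by congr (_ * _)%E; apply: eq_big_seq => i iI; rewrite /D ?iI// (negPf (IJ i iI)).
Qed.

Definition few (m j : nat) : set (seqZ S) :=
  [set x | (\sum_(k < m) (occurs k x : nat) < j)%N].

Let fewS m j : few m.+1 j =
  (few m j `\` [set x | occurs m x]) `|` (few m j.-1 `&` [set x | occurs m x]).
Proof.
apply/seteqP; split => x; rewrite /few /= big_ord_recr /=; case: (occurs m x) => /=.
- by move=> h; right; split => //; lia.
- by move=> h; left; split => //; lia.
- by case=> [[_ []]//|[]]; lia.
- by case=> [[]|[_ []]//]; lia.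
Qed.

Let measurable_few m j : measurable (few m j).
Proof.
elim: m j => [|m IH] j.
  rewrite /few; under eq_set do rewrite big_ord0.
  case: (ltnP 0 j) => _; first by rewrite (_ : [set _ | _] = setT)//; apply/seteqP; split.
  by rewrite (_ : [set _ | _] = set0)//; apply/seteqP; split.
by rewrite fewS; apply: measurableU; [exact: measurableD|exact: measurableI].
Qed.

(** [few m j] looks only at sites before [l + L * m]. The rectangle is arbitrary so that the
    induction can add the block [m] to it. *)
Let few_indep m j I B : (forall i, i \in I -> (l + (L * m)%N%:Z <= i)) ->
  rho (few m j `&` rect I B) = (rho (few m j) * rho (rect I B))%E.
Proof.
elim: m j I B => [|m IH] j I B Il.
  case: j => [|j].
    have -> : few 0 0 = set0 by apply/seteqP; split => x; rewrite /few /= big_ord0.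
    by rewrite set0I !measure0 mul0e.
  have -> : few 0 j.+1 = setT by apply/seteqP; split => x; rewrite /few /= big_ord0.
  by rewrite setTI probability_setT mul1e.
have mR := measurable_rect I (fun i => mS (B i)).
have blockI i : i \in I -> i \notin block m.
  move=> /Il iI; apply/imfsetP => -[k /=]; rewrite mem_iota => /andP[_ kL] E.
  by move: iI; rewrite E mulnS; lia.
have blockm i : i \in block m -> l + (L * m)%N%:Z <= i.
  by move=> /imfsetP[k /= _ ->]; lia.
have Im i : i \in I -> l + (L * m)%N%:Z <= i.
  by move=> /Il; rewrite mulnS; lia.
have bothm i : i \in (block m `|` I)%fset -> l + (L * m)%N%:Z <= i.
  by rewrite in_fsetU => /orP[/blockm|/Im].
have indep j' : rho (few m j' `&` [set x | occurs m x] `&` rect I B) =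
    (rho (few m j' `&` [set x | occurs m x]) * rho (rect I B))%E.
  rewrite -setIA occursE rectI IH//.
  by rewrite -rectI product_rectU// IH// muleA.
have fin (A : set (seqZ S)) : measurable A -> rho A \is a fin_num.
  by move=> mA; rewrite fin_num_measure.
have mO := measurable_occurs m.
have D (A : set (seqZ S)) : measurable A -> rho (A `\` [set x | occurs m x]) =
    (rho A - rho (A `&` [set x | occurs m x]))%E.
  by move=> mA; rewrite measureD// ltey_eq fin.
have disj (A C : set (seqZ S)) : (A `\` [set x | occurs m x]) `&` (C `&` [set x | occurs m x]) = set0.
  by apply/seteqP; split => x //= [[_ +] [_]].
have mA := measurableD (measurable_few m j) mO.
have mC := measurableI _ _ (measurable_few m j.-1) mO.
have U : rho (few m.+1 j) = (rho (few m j `\` [set x | occurs m x]) +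
    rho (few m j.-1 `&` [set x | occurs m x]))%E.
  by rewrite fewS; apply: measureU => //; exact: disj.
rewrite U fewS setIUl measureU; last first.
- by rewrite setIACA disj set0I.
- exact: measurableI.
- exact: measurableI.
have -> : (few m j `\` [set x | occurs m x]) `&` rect I B =
    (few m j `&` rect I B) `\` [set x | occurs m x].
  by apply/seteqP; split => x /=; tauto.
have mFR := measurableI _ _ (measurable_few m j) mR.
rewrite [X in (X + _)%E = _](D _ mFR) [X in (_ + X)%E = _]indep.
rewrite [X in _ = ((X + _) * _)%E](D _ (measurable_few m j)).
have -> : (few m j `&` rect I B) `&` [set x | occurs m x] =
    (few m j `&` [set x | occurs m x]) `&` rect I B by rewrite setIAC.
have f1 := fin _ (measurable_few m j); have f2 := fin _ mR.
have f3 := fin _ (measurableI _ _ (measurable_few m j) mO).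
have f4 := fin _ (measurableI _ _ (measurable_few m j.-1) mO).
rewrite indep IH// -(fineK f1) -(fineK f2) -(fineK f3) -(fineK f4) -!(EFinM, EFinB, EFinD).
by congr EFin; ring.
Qed.

Let occurs_ge m : p ^+ L <= fine (rho [set x | occurs m x]).
Proof.
rewrite occursE rhoE//.
have -> : (\prod_(i <- block m) rho_ i (pat i) =
    (\prod_(i <- block m) fine (rho_ i (pat i)))%:E)%E.
  by rewrite -prodEFin; apply: eq_bigr => i _; rewrite fineK// fin_num_measure.
rewrite /=.
have -> : p ^+ L = \prod_(i <- block m) p.
  rewrite big_const_seq iter_mulr_1 count_predT; congr (_ ^+ _).
  rewrite card_imfset /= ?undup_id ?iota_uniq ?size_iota//.
  by move=> j k /= /addrI []; lia.
by apply: ler_prod => i _; rewrite (ltW p0) word_ge.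
Qed.

(** Chernoff bound with base 2: each independent block multiplies the expectation of [2^-1] to the
    number of occurrences by at most [1 - p ^+ L / 2]. *)
Let few_le m j : fine (rho (few m j)) <= 2 ^+ j * (1 - p ^+ L / 2) ^+ m.
Proof.
have pL0 : 0 < p ^+ L by rewrite exprn_gt0.
have pL1 : p ^+ L <= 1 by rewrite exprn_ile1// ltW.
elim: m j => [|m IH] j.
  rewrite expr0 mulr1 (@le_trans _ _ 1)//; last by rewrite exprn_ege1// ler1n.
  by rewrite -lee_fin fineK ?fin_num_measure// probability_le1.
have fin (A : set (seqZ S)) : measurable A -> rho A \is a fin_num.
  by move=> mA; rewrite fin_num_measure.
have mO := measurable_occurs m.
have I (j' : nat) : fine (rho (few m j' `&` [set x | occurs m x])) =
    fine (rho (few m j')) * fine (rho [set x | occurs m x]).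
  have mr : measurable (rect (block m) pat) by exact: measurable_rect.
  rewrite occursE (@few_indep m j' (block m) pat); first by rewrite fineM// fin.
  by move=> i /imfsetP[k /= _ ->]; lia.
have -> : fine (rho (few m.+1 j)) =
    fine (rho (few m j)) * (1 - fine (rho [set x | occurs m x])) +
    fine (rho (few m j.-1)) * fine (rho [set x | occurs m x]).
  rewrite fewS measureU; last first.
  - by apply/seteqP; split => x //= [[_ +] [_]].
  - exact: measurableI.
  - exact: measurableD.
  rewrite fineD; [|by rewrite fin//; exact: measurableD|by rewrite fin//; exact: measurableI].
  rewrite [X in fine X + _]measureD//; last by rewrite ltey_eq fin.
  rewrite fineB ?fin//; last exact: measurableI.
  by rewrite !I; ring.
have := occurs_ge m; set r := fine (rho [set x | occurs m x]) => rp.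
have r1 : r <= 1 by rewrite -lee_fin fineK ?fin// probability_le1.
have c0 : 0 <= (1 - p ^+ L / 2) ^+ m by rewrite exprn_ge0//; lra.
case: j => [|j] /=.
  have -> : few m 0 = set0 by apply/seteqP; split => x; rewrite /few /= ltn0.
  by rewrite measure0 /= !mul0r addr0 expr0 mul1r exprn_ge0//; lra.
have h1 := IH j.+1; have h0 := IH j.
rewrite exprS in h1; rewrite exprS [_ ^+ m.+1]exprS.
have P0 : 0 <= 2 ^+ j * (1 - p ^+ L / 2) ^+ m by rewrite mulr_ge0// exprn_ge0.
move: P0 h1 h0; rewrite -!mulrA [(1 - p ^+ L / 2) * _]mulrC !mulrA -[2 * _ * _]mulrA.
set P := 2 ^+ j * _ => P0 h1 h0.
apply: (@le_trans _ _ (2 * P * (1 - r) + P * r)).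
  by apply: lerD; apply: ler_wpM2r => //; lra.
nra.
Qed.

(** For each single [t] the event has probability at most [2 ^ t * 4^-1 ^ t], which tends to 0. *)
Lemma few_null (c t0 : nat) : (1 - p ^+ L / 2) ^+ c <= 4^-1 ->
  rho.-negligible [set x | forall t : nat, (t0 <= t)%N ->
     (\sum_(k < c * t) (occurs k x : nat) < t)%N].
Proof.
have pL0 : 0 < p ^+ L by rewrite exprn_gt0.
have pL1 : p ^+ L <= 1 by rewrite exprn_ile1// ltW.
move=> cy; pose y := 1 - p ^+ L / 2.
have y0 : 0 <= y by rewrite /y; lra.
set E := [set x | _].
have EE : E = \bigcap_(t in [set t | (t0 <= t)%N]) few (c * t) t by apply/seteqP; split.
have mE : measurable E by rewrite EE; apply: bigcap_measurableType => t _.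
have bound t : (t0 <= t)%N -> fine (rho E) <= 2^-1 ^+ t.
  move=> tt; apply: (@le_trans _ _ (fine (rho (few (c * t) t)))).
    by rewrite fine_le ?fin_num_measure// le_measure ?inE// EE => x; apply.
  apply: (le_trans (few_le _ _)); rewrite -/y exprM -exprMn.
  by apply: lerXn2r; rewrite ?nnegrE ?mulr_ge0 ?exprn_ge0//; lra.
exists E; split=> //; transitivity (fine (rho E))%:E; first by rewrite fineK// fin_num_measure.
congr EFin; apply/eqP.
rewrite eq_le fine_ge0// andbT.
have : `|2^-1 : R| < 1 by rewrite ger0_norm ?invf_lt1 ?ltr1n.
move=> /cvg_expr/cvgrPdist_lt h; apply/ler_addgt0Pr => e e0; rewrite add0r.
have [n _ hn] := h e e0.
have := hn (maxn n t0) (leq_maxl _ _); rewrite sub0r normrN ger0_norm ?exprn_ge0// => le.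
by apply: ltW; apply: le_lt_trans le; apply: bound; exact: leq_maxr.
Qed.

End RareWords.

(** * Marks almost surely outnumber four times the requests *)

Section Supply.
Context {d : measure_display} {S : measurableType d} {R : realType}.
Variables (a b : S) (rho_ : int -> probability S R) (rho : probability (seqZ S) R) (p : R).
Hypotheses (ab : a != b) (mS : forall B : set S, measurable B)
  (rhoE : is_product_measure rho_ rho) (p0 : 0 < p) (p1 : p < 1)
  (pa : forall i, p <= fine (rho_ i [set a])) (pb : forall i, p <= fine (rho_ i [set b])).

(* Four fair bits per request exceed the mean consumption of [sampler_exists]. *)
Definition supplied N (x : seqZ S) := forall (l : int) (A : nat), exists n : nat,
  (A + 4 * \sum_(k < n) (request a b N x (l + k%:Z) : nat) <=
   \sum_(k < n) (mark a b x (l + k%:Z) : nat))%N.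

Let word (j : nat) : S :=
  if (j < 6)%N then b else nth b [:: a; a; b; a; b; b] ((j - 6) %% 6).

Let word_ge i j : p <= fine (rho_ i [set word j]).
Proof.
rewrite /word; case: ifP => _ //; have : ((j - 6) %% 6 < 6)%N by exact: ltn_pmod.
by case: (_ %% _)%N => [|[|[|[|[|[]]]]]].
Qed.

Let occurs_anchor l k x : occurs 54 word l k x -> anchor a b x (l + (54 * k)%N%:Z + 6).
Proof.
move=> /forallP h; apply: anchor_word ab => j j54.
rewrite -[RHS]/(word j); have /eqP <- := h (Ordinal j54).
by congr (x _) => /=; lia.
Qed.

Let count_anchors l x m : (\sum_(k < m) (occurs 54 word l k x : nat) <=
  \sum_(k < 54 * m) (anchor a b x (l + k%:Z) : nat))%N.
Proof.
elim: m => [|m IH]; first by rewrite big_ord0.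
rewrite big_ord_recr /= -!(big_mkord xpredT (fun k => anchor a b x (l + k%:Z) : nat)) in IH *.
rewrite (@big_cat_nat _ _ _ (54 * m)%N)//=; last by lia.
apply: leq_add => //; case: (boolP (occurs 54 word l m x)) => // /occurs_anchor h.
rewrite (bigD1_seq (54 * m + 6)%N) ?iota_uniq ?mem_index_iota//=; last by lia.
by rewrite PoszD addrA h.
Qed.

Lemma supplied_ae : exists e : nat, rho.-negligible [set x | ~ supplied (2 ^ e) x].
Proof.
have [c c0 cy] : exists2 c : nat, (0 < c)%N & (1 - p ^+ 54 / 2) ^+ c <= 4^-1.
  have pL0 : 0 < p ^+ 54 by rewrite exprn_gt0.
  have pL1 : p ^+ 54 <= 1 by rewrite exprn_ile1// ltW.
  have : `|1 - p ^+ 54 / 2| < 1 by rewrite ger0_norm; lra.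
  move=> /cvg_expr/cvgrPdist_lt/(_ 4^-1); rewrite invr_gt0 ltr0n => /(_ isT)[n _ hn].
  exists n.+1 => //; have := hn n.+1 (leqnSn n); rewrite sub0r normrN ger0_norm ?exprn_ge0//.
    exact: ltW.
  by lra.
(* [N >= 108 * c = 2 * (54 * c)]: among [54 * c * t] sites, which contain at least [t] anchors for
   suitable [t], there are only about [t / 2] requests other than anchors. *)
pose e := (108 * c)%N; exists e; set N := (2 ^ e)%N.
have Nc : (108 * c <= N)%N by rewrite ltnW// ltn_expl.
have N0 : (0 < N)%N by rewrite expn_gt0.
pose ev (l : int) (t0 : nat) := [set x | forall t : nat, (t0 <= t)%N ->
     (\sum_(k < c * t) (occurs 54 word l k x : nat) < t)%N].
pose F (k : nat) := if @choice.unpickle int k is Some l then \bigcup_t0 ev l t0 else set0.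
have negF k : rho.-negligible (F k).
  rewrite /F; case: choice.unpickle => [l|]; last exact: negligible_set0.
  by apply: negligible_bigcup => t0; exact: (few_null mS rhoE l p0 p1 word_ge t0 cy).
apply: negligibleS (negligible_bigcup negF) => x nsx.
apply: contrapT => nF; apply: nsx.
have often l t0 : exists2 t : nat, (t0 <= t)%N &
    (t <= \sum_(k < c * t) (occurs 54 word l k x : nat))%N.
  apply: contrapT => h; apply: nF; exists (choice.pickle l) => //.
  rewrite /F choice.pickleK; exists t0 => // t tt; rewrite ltnNge; apply/negP => h'.
  by apply: h; exists t.
move=> l A.
have [g al] : exists g : nat, anchor a b x (l + g%:Z).
  have [t t1 tl] := often l 1%N.
  have [k /occurs_anchor h] : exists k, occurs 54 word l k x.
    apply: contrapT => /forallNP h; move: tl; rewrite big1 ?leqn0; first by lia.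
    by move=> k _; apply/eqP; rewrite eqb0; apply/negP; exact: h.
  by exists (54 * k + 6)%N; rewrite PoszD addrA.
(* The surplus [A], four coins for each of the [g] sites before the first anchor found, and
   [170 = 4 * 42 + 2] for the overhang of the window and the rounding. *)
have [t tT tl] := often (l + g%:Z) (A + 4 * g + 170)%N.
have := leq_trans tl (count_anchors _ _ _); rewrite mulnA.
set n := (54 * c * t)%N => tR.
exists (g + (n + 42))%N; rewrite !(@big_split_ord _ _ _ g) /=.
have gE (P : int -> bool) : (\sum_(k < n + 42) (P (l + (g + k)%N%:Z)%R : nat) =
    \sum_(k < n + 42) (P (l + g%:Z + k%:Z)%R : nat))%N.
  by apply: eq_bigr => k _; rewrite PoszD addrA.
rewrite (gE (request a b N x)) (gE (mark a b x)).
have hS := count_marks a b x (l + g%:Z) n.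
have hX := count_extra N0 (n + 42) al.
have hQg : (\sum_(k < g) (request a b N x (l + k%:Z) : nat) <= g)%N.
  rewrite -[leqRHS]muln1 -[X in (_ <= X * _)%N](card_ord g) -sum_nat_const.
  by apply: leq_sum => k _; exact: leq_b1.
have hQ : (\sum_(k < n + 42) (request a b N x (l + g%:Z + k%:Z) : nat) <=
   \sum_(k < n) (anchor a b x (l + g%:Z + k%:Z) : nat) + 42 +
   \sum_(k < n + 42) (request a b N x (l + g%:Z + k%:Z) && ~~ anchor a b x (l + g%:Z + k%:Z) : nat))%N.
  have h : (\sum_(k < n + 42) (anchor a b x (l + g%:Z + k%:Z) : nat) <=
     \sum_(k < n) (anchor a b x (l + g%:Z + k%:Z) : nat) + 42)%N.
    rewrite big_split_ord /= leq_add2l -[leqRHS]muln1 -[X in (_ <= X * _)%N](card_ord 42) -sum_nat_const.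
    by apply: leq_sum => k _; exact: leq_b1.
  apply: leq_trans (leq_add h (leqnn _)); rewrite -big_split /=; apply: leq_sum => k _.
  by case: request; case: anchor.
move: hS hX hQg hQ tR tT.
set sS := (\sum_(k < n + 42) (mark _ _ _ _ : nat))%N.
set sQ := (\sum_(k < n + 42) (request _ _ _ _ _ : nat))%N.
set sX := (\sum_(k < n + 42) (_ && _ : nat))%N.
set sR := (\sum_(k < n) _)%N; set sg := (\sum_(k < g) (request _ _ _ _ _ : nat))%N.
set sg' := (\sum_(k < g) _)%N.
move=> hS hX hQg hQ tR tT.
have X2 : (2 * sX <= t + 1)%N.
  have : (108 * c * sX <= 54 * c * t + 42)%N.
    by apply: leq_trans hX; rewrite leq_mul2r Nc orbT.
  rewrite leqNgt => h; apply/negP => h'; move: h => /negP; apply.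
  nia.
lia.
Qed.

End Supply.

Lemma measurable_bits d (T : measurableType d) (W : T -> nat -> bool) n
    (P : (nat -> bool) -> bool) : finite_dep n P ->
  (forall k, measurable [set t | W t k]) -> measurable [set t | P (W t)].
Proof.
move=> Pn mW; elim: n W P Pn mW => [|n IH] W P Pn mW.
  have -> : [set t | P (W t)] = [set t | P (fun=> false)].
    by apply/seteqP; split => t /=; rewrite (Pn _ (fun=> false)).
  case: (P _).
    rewrite (_ : [set _ : T | _] = setT); first exact: measurableT.
    by apply/seteqP; split.
  rewrite (_ : [set _ : T | _] = set0); first exact: measurable0.
  by apply/seteqP; split.
have mW' k : measurable [set t | sshift 1 (W t) k] by exact: mW.
have IHc c := IH (fun t => sshift 1 (W t)) (fun w => P (scons c w))
  (@finite_dep_scons _ _ _ c Pn) mW'.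
have -> : [set t | P (W t)] =
    ([set t | W t 0%N] `&` [set t | P (scons true (sshift 1 (W t)))]) `|`
    (~` [set t | W t 0%N] `&` [set t | P (scons false (sshift 1 (W t)))]).
  have E t : P (W t) = P (scons (W t 0%N) (sshift 1 (W t))) by rewrite scons_sshift.
  apply/seteqP; split => t /=; rewrite E.
    by case: (W t 0%N) => h; [left|right].
  by case: (W t 0%N) => -[[]|[]].
apply: measurableU; apply: measurableI.
- exact: mW.
- exact: (IHc true).
- by apply: measurableC; exact: mW.
- exact: (IHc false).
Qed.

(** The three streams are interleaved into one by residues modulo 3. *)
Lemma measurable_bits3 d (T : measurableType d) (W1 W2 W3 : T -> nat -> bool) n
    (P : (nat -> bool) -> (nat -> bool) -> (nat -> bool) -> bool) :
  (forall w1 w2 w3 w1' w2' w3',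
     (forall k, (k < n)%N -> [/\ w1 k = w1' k, w2 k = w2' k & w3 k = w3' k]) ->
     P w1 w2 w3 = P w1' w2' w3') ->
  (forall k, measurable [set t | W1 t k]) -> (forall k, measurable [set t | W2 t k]) ->
  (forall k, measurable [set t | W3 t k]) ->
  measurable [set t | P (W1 t) (W2 t) (W3 t)].
Proof.
move=> Pn m1 m2 m3.
pose W t k := if (k %% 3 == 0)%N then W1 t (k %/ 3)%N
              else if (k %% 3 == 1)%N then W2 t (k %/ 3)%N else W3 t (k %/ 3)%N.
pose Q w := P (fun k => w (3 * k)%N) (fun k => w (3 * k + 1)%N) (fun k => w (3 * k + 2)%N).
have QE z : P (W1 z) (W2 z) (W3 z) = Q (W z).
  apply: Pn => k _; rewrite /W; split.
  - by rewrite mulnC modnMl eqxx mulnK.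
  - by rewrite mulnC modnMDl divnMDl//= addn0.
  - by rewrite mulnC modnMDl divnMDl//= addn0.
have -> : [set z | P (W1 z) (W2 z) (W3 z)] = [set z | Q (W z)].
  by apply/seteqP; split => z /=; rewrite QE.
apply: (@measurable_bits _ _ _ (3 * n)%N).
  move=> w w' ww'; apply: Pn => k kn; split; apply: ww'; lia.
by move=> k; rewrite /W; case: (_ == 0)%N => //; case: (_ == 1)%N.
Qed.

(** * The factor map *)

Section FactorMap.
Context {d : measure_display} {S : measurableType d}.
Variables (a b : S) (t : tree (seq bool)) (N : nat).
Hypothesis mS : forall B : set S, measurable B.
Implicit Types (x : seqZ S) (u : seqZ bool).

Let sources x (i : int) : nat -> bool := fun k => mark a b x (i + k%:Z).
Let requests x (i : int) : nat -> bool := fun k => request a b N x (i + k%:Z).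

(* Sample delivered at the request site [i], if the stack is empty [n] sites to its right. *)
Definition sample x u (i : int) n : seq bool :=
  tree_val t (stack t (sources x (i + 1)) (requests x (i + 1)) (window id (i + 1) u) n
    (fun=> false)).

(* [false] if the samples have no limit at [j]. *)
Definition output x u (i : int) (j : nat) : bool :=
  `[< exists n0, forall n, (n0 <= n)%N -> nth false (sample x u i n) j >].

Definition output_bits x u : seqZ bool :=
  fun i => output x u (i - (offset a b N x i)%:Z) (offset a b N x i).

(** The coin of [i] if [i] is a mark; its value elsewhere is never pushed. *)
Definition mark_bits x : seqZ bool := fun i => x (i + 3) == a.

Definition letters_of (w : seqZ bool) : seqZ S := fun i => if w i then a else b.

Definition factor_map x : seqZ S := letters_of (output_bits x (mark_bits x)).

Lemma anchor_shift x i : anchor a b (left_shift x) i = anchor a b x (i + 1).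
Proof.
rewrite /anchor; congr (~~ _ && _).
  by rewrite (mark_shift a b x (i - 6) 1); congr mark; lia.
by apply: eq_forallb => k; rewrite (mark_shift a b x _ 1); congr mark; lia.
Qed.

Lemma offset_shift x i : offset a b N (left_shift x) i = offset a b N x (i + 1).
Proof.
have E k : anchor a b (left_shift x) (i - k%:Z) = anchor a b x (i + 1 - k%:Z).
  by rewrite anchor_shift; congr anchor; lia.
have [h|[k [ak kmin]]] := last_anchor a b x (i + 1).
  by rewrite !offset_noanchor// => k; rewrite E.
have ak' : anchor a b (left_shift x) (i - k%:Z) by rewrite E.
rewrite (offset_last N ak kmin) (offset_last N ak')// => j jk.
by rewrite E; exact: kmin.
Qed.

Lemma sample_shift x u i n :
  sample (left_shift x) (left_shift u) i n = sample x u (i + 1) n.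
Proof.
rewrite /sample; congr (tree_val t (stack t _ _ _ n _)); apply/funext => k.
- by rewrite /sources (mark_shift a b x _ 1); congr mark; lia.
- by rewrite /requests /request offset_shift; congr (offset _ _ _ _ _ == _); lia.
- by rewrite /window /left_shift; congr (id (u _)); lia.
Qed.

Lemma factor_map_shift : factor_map \o left_shift = left_shift \o factor_map.
Proof.
apply/funext => x; apply/funext => i; rewrite /= /factor_map /letters_of /left_shift.
rewrite -/(left_shift x) /output_bits offset_shift.
have -> : mark_bits (left_shift x) = left_shift (mark_bits x).
  by apply/funext => k; rewrite /mark_bits /left_shift; congr (x _ == a); lia.
rewrite /output; congr (if asbool _ then a else b); apply/propext.
by split=> -[n0 h]; exists n0 => n nn; have := h n nn; rewrite sample_shift;
  congr (nth _ (sample _ _ _ _) _); lia.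
Qed.

Section Measurability.
Context {d' : measure_display} {T : measurableType d'}.
Variables (X : T -> seqZ S) (U : T -> seqZ bool).
Hypotheses (mX : measurable_fun setT X) (mU : measurable_fun setT U).

Let measurable_true (f : T -> bool) : measurable_fun setT f -> measurable [set z | f z].
Proof. by move=> mf; have := mf measurableT [set true] I; rewrite setTI. Qed.

Lemma measurable_anchor i : measurable [set z | anchor a b (X z) i].
Proof.
pose W z (k : nat) := mark a b (X z) (i - 6 + k%:Z).
pose P (w : nat -> bool) := ~~ w 0%N && [forall k : 'I_8, w (6 + 6 * k)%N].
have -> : [set z | anchor a b (X z) i] = [set z | P (W z)].
  have E z : anchor a b (X z) i = P (W z).
    rewrite /anchor /P /W addr0; congr (_ && _); apply: eq_forallb => k; congr mark; lia.
  by apply/seteqP; split => z /=; rewrite E.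
apply: (@measurable_bits _ _ _ 49).
  move=> w w' ww'; rewrite /P ww'//; congr (_ && _); apply: eq_forallb => k.
  by rewrite ww'//; have := ltn_ord k; lia.
by move=> k; apply: measurable_true; exact: measurable_mark.
Qed.

Lemma measurable_offset i m : measurable [set z | offset a b N (X z) i = m].
Proof.
pose L k := [set z | anchor a b (X z) (i - k%:Z)] `&`
  \bigcap_(j in `I_k) ~` [set z | anchor a b (X z) (i - j%:Z)].
have mL k : measurable (L k).
  apply: measurableI; first exact: measurable_anchor.
  apply: fin_bigcap_measurable => // j _; apply: measurableC; exact: measurable_anchor.
pose L0 := \bigcap_k ~` [set z | anchor a b (X z) (i - k%:Z)].
have mL0 : measurable L0.
  by apply: bigcapT_measurable => k; apply: measurableC; exact: measurable_anchor.
have -> : [set z | offset a b N (X z) i = m] =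
    (\bigcup_(k in [set k | (k %% N)%N = m]) L k) `|` (if m == 0%N then L0 else set0).
  apply/seteqP; split => z /=.
    have [h|[k [ak kmin]]] := last_anchor a b (X z) i.
      rewrite offset_noanchor// => <-; right => /= k _; exact/negP.
    rewrite (offset_last N ak kmin) => km; left; exists k => //; split=> // j /= jk.
    exact/negP/kmin.
  case=> [[k /= km [ak kmin]]|].
    by rewrite (offset_last N ak)// => j jk; apply/negP; exact: kmin.
  by case: eqP => // -> h; rewrite offset_noanchor// => k; apply/negP; exact: h.
apply: measurableU; last by case: ifP.
by apply: bigcup_measurable => k _.
Qed.

Lemma measurable_output i j : measurable [set z | output (X z) (U z) i j].
Proof.
have mn n : measurable [set z | nth false (sample (X z) (U z) i n) j].
  pose P (w1 w2 w3 : nat -> bool) := nth false (tree_val t (stack t w1 w2 w3 n (fun=> false))) j.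
  apply: (@measurable_bits3 _ _ (fun z => sources (X z) (i + 1))
    (fun z => requests (X z) (i + 1)) (fun z => window id (i + 1) (U z)) n P).
  - by move=> *; rewrite /P; congr (nth _ (tree_val _ _) _); exact: stack_eq_below.
  - by move=> k; apply: measurable_true; exact: measurable_mark.
  - move=> k; rewrite /requests /request.
    rewrite (_ : [set _ | _] = [set z | offset a b N (X z) (i + 1 + k%:Z) = 0%N]).
      exact: measurable_offset.
    by apply/seteqP; split => z /= /eqP.
  - move=> k; apply: measurable_true.
    exact: (measurableT_comp (measurable_coord _) mU).
have -> : [set z | output (X z) (U z) i j] =
    \bigcup_n0 \bigcap_(n in [set n | (n0 <= n)%N])
      [set z | nth false (sample (X z) (U z) i n) j].
  apply/seteqP; split => z /=.
    by move=> /asboolP [n0 h]; exists n0 => // n /= nn; exact: h.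
  by move=> [n0 _ h]; apply/asboolP; exists n0 => n nn; exact: h.
by apply: bigcupT_measurable => n0; apply: bigcap_measurableType => n _.
Qed.

Lemma measurable_output_bits :
  measurable_fun setT (fun z => output_bits (X z) (U z)).
Proof.
apply: measurable_seqZ => i; apply: (@measurable_fun_bool _ _ _ _ true).
rewrite setTI.
have -> : (fun z => output_bits (X z) (U z) i) @^-1` [set true] =
    \bigcup_m ([set z | offset a b N (X z) i = m] `&`
               [set z | output (X z) (U z) (i - m%:Z) m]).
  apply/seteqP; split => z /=; rewrite /output_bits.
    by move=> h; exists (offset a b N (X z) i) => //; split.
  by move=> [m _ [/= <-]].
apply: bigcupT_measurable => m; apply: measurableI; first exact: measurable_offset.
exact: measurable_output.
Qed.

End Measurability.

Lemma measurable_letters_of : measurable_fun setT letters_of.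
Proof.
apply: measurable_seqZ => i; rewrite /letters_of; apply: measurable_fun_ifT => //.
exact: measurable_coord.
Qed.

Lemma measurable_factor_map : measurable_fun setT factor_map.
Proof.
apply: (measurableT_comp measurable_letters_of).
apply: measurable_output_bits; first exact: measurable_id.
apply: measurable_seqZ => i.
exact: (measurable_coord_eq mS (i + 3) a (@measurable_id _ _ setT)).
Qed.

End FactorMap.

Lemma tree_val_dep (T : Type) (t : tree T) : finite_dep (tree_height t) (tree_val t).
Proof.
by move=> w w' ww'; have [-> _ _] := tree_agree (tree_depth_le t w) ww'.
Qed.

Lemma tree_depth_dep (T : Type) (t : tree T) : finite_dep (tree_height t) (tree_depth t).
Proof.
by move=> w w' ww'; have [_ -> _] := tree_agree (tree_depth_le t w) ww'.
Qed.

Lemma stack_acc_dep (T : Type) (t : tree T) s q n :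
  finite_dep (n + (tree_height t + n * tree_height t))
    (fun u => stack_acc t s q u n (sshift n u)).
Proof.
move=> u u' uu'; rewrite !stack_accE; congr (_ - _%:Z).
apply: eq_bigr => k _; case: (q k) => //.
exact: (@state_dep _ t nat s q n k.+1 _ _ (@tree_depth_dep _ t)).
Qed.

Lemma natr_forall (R : realFieldType) m (P : 'I_m -> bool) :
  ([forall i, P i])%:R = \prod_(i < m) (P i)%:R :> R.
Proof.
have -> : [forall i, P i] = \big[andb/true]_(i < m) P i by rewrite big_andE.
by apply: (big_ind2 (fun (e : bool) (y : R) => e%:R = y)) => // -[] y [] z <- <-;
  rewrite ?mulr1 ?mulr0.
Qed.

Lemma prod_nat_addl (R : realFieldType) N m (F : nat -> R) :
  \prod_(N <= i < N + m) F i = \prod_(i < m) F (N + i)%N.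
Proof.
rewrite -[LHS]/(\prod_(0 + N <= i < N + m) F i) big_addn addKn big_mkord.
by apply: eq_bigr => i _; rewrite addnC.
Qed.

(** Turns errors of order [theta ^- A], available for every surplus [A], into an exact equality of
    laws. *)
Lemma exp_bounded_eq0 (R : archiRealFieldType) (theta y K : R) : 1 < theta -> 0 <= y ->
  (forall A : nat, y * theta ^+ A <= K) -> y = 0.
Proof.
move=> th1 y0 h; apply/eqP; rewrite eq_le y0 andbT leNgt; apply/negP => yp.
have bern (A : nat) : 1 + A%:R * (theta - 1) <= theta ^+ A.
  elim: A => [|A IH]; first by rewrite mul0r addr0 expr0.
  have : 0 <= A%:R * (theta - 1) ^+ 2 by rewrite mulr_ge0 ?sqr_ge0.
  have := ler_wpM2l (ltW (lt_trans ltr01 th1)) IH.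
  by rewrite [theta ^+ A.+1]exprS -natr1; nra.
have K0 : 0 <= K by apply: le_trans (h 0%N); rewrite expr0 mulr1.
have d0 : 0 < y * (theta - 1) by rewrite mulr_gt0// subr_gt0.
have := archi_boundP (divr_ge0 K0 (ltW d0)).
set A := Num.bound _; rewrite ltr_pdivrMr// => lt.
have := ler_wpM2l y0 (bern A); have := h A; nra.
Qed.

(** * With fair coins the output on a supplied sequence is exactly i.i.d *)

Section OutputLaw.
Context {d : measure_display} {S : measurableType d} {R : realType}.
Variables (a b : S) (t : tree (seq bool)) (N : nat) (theta c : R).
Hypotheses (mS : forall B : set S, measurable B) (N0 : (0 < N)%N)
  (theta1 : 1 < theta) (c01 : 0 <= c <= 1)
  (t_law : forall g : nat -> bool -> R,
     treeE t (fun v _ => \prod_(j < N) g j (nth false v j)) =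
     \prod_(j < N) (c * g j true + (1 - c) * g j false))
  (t_depth : treeE t (fun _ d => theta ^+ d) <= theta ^+ 4).
Variables (beta beta_c : probability (seqZ bool) R).
Hypotheses (betaE : is_product_measure (fun=> bernoulli_prob 2^-1) beta)
  (beta_cE : is_product_measure (fun=> bernoulli_prob c) beta_c).
Variable x : seqZ S.
Hypothesis sx : supplied a b N x.

Section Window.
Variables (l : int) (m : nat) (J : {fset int}) (B : int -> set bool).
Hypothesis Jlm : forall j, j \in J -> l <= j < l + m%:Z.

(** Offsets are below [N], so starting [N] sites to the left of [l] brings in every request that
    serves a site of the window. *)
Let L0 : int := l - N%:Z.
Let s : nat -> bool := fun k => mark a b x (L0 + k%:Z).
Let q : nat -> bool := fun k => request a b N x (L0 + k%:Z).
Let o (k : nat) : nat := offset a b N x (L0 + k%:Z).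
Let M := (N + m)%N.
Let fb (i : nat) (e : bool) : bool := (L0 + i%:Z \in J) ==> (e \in B (L0 + i%:Z)).
(** The output computed on a finite window, the stack at site [n] being the sequence of all later
    bits. Its law is exact for every [n], and it equals the true output except on [Bad n], where
    some sample may depend on that initial stack. *)
Let ref n w i := nth false (tree_val t (state t s q w n (i - o i).+1)) (o i).
Let Fn n (w : nat -> bool) : bool := [forall i : 'I_m, fb (N + i) (ref n w (N + i))].
Let bad n (w : nat -> bool) (k : nat) : bool :=
  (stack_acc t (sshift k s) (sshift k q) (sshift k w) (n - k)
     (sshift (n - k) (sshift k w)) <= 0)%R.
Let Bad n (w : nat -> bool) : bool := [exists k : 'I_M, bad n w k].
Let H := tree_height t.
Let prodc : R := \prod_(N <= i < N + m) (c * (fb i true)%:R + (1 - c) * (fb i false)%:R).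

Let oP i : (N <= i < N + m)%N -> [&& (o i < N)%N, (o i <= i)%N & q (i - o i)%N].
Proof.
move=> /andP[Ni _]; have oN := offset_lt a b N0 x (L0 + i%:Z).
apply/and3P; split; [exact: oN|by apply: leq_trans Ni; exact: ltnW|].
have := request_offset a b N0 x (L0 + i%:Z); rewrite /q.
by have -> : L0 + i%:Z - (offset a b N x (L0 + i%:Z))%:Z = L0 + (i - o i)%N%:Z
  by rewrite /o; lia.
Qed.

Let FnE n w : (Fn n w)%:R = \prod_(N <= i < N + m) (fb i (ref n w i))%:R :> R.
Proof.
by rewrite natr_forall prod_nat_addl.
Qed.

Let Fn_dep n : finite_dep (n + (H + n * H)) (Fn n).
Proof.
move=> w w' ww'; rewrite /Fn; apply: eq_forallb => i; congr fb; rewrite /ref.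
by rewrite (@state_dep _ t _ s q n _ _ _ (@tree_val_dep _ t) _ _ ww').
Qed.

Let Bad_dep n : exists D, finite_dep D (Bad n).
Proof.
exists (M + (n + (H + n * H)))%N => w w' ww'; apply: eq_existsb => k; rewrite /bad.
have dep := finite_dep_sshift (l := k) (@stack_acc_dep _ t (sshift k s) (sshift k q) (n - k)).
rewrite (dep w w')// => j jd; apply: ww'; apply: leq_trans jd _.
have := ltn_ord k; rewrite -/H => kM; apply: leq_add; first exact: ltnW.
by apply: leq_add; rewrite ?leq_subr// leq_add2l leq_mul2r leq_subr orbT.
Qed.

Let window_law n (P : (nat -> bool) -> bool) : finite_dep n P ->
  beta [set u | P (window id L0 u)] = (bitsE (fun=> 2^-1) n (fun w => (P w)%:R))%:E.
Proof.
move=> Pn; rewrite (product_windowT betaE (f := id) _ _ Pn)//.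
have -> : (fun k : nat => fine (bernoulli_prob 2^-1 [set e | id e])) = (fun=> 2^-1 : R).
  by apply/funext => k; rewrite (@bernoulli_prob1 R 2^-1 true)//; lra.
by [].
Qed.

Let Fn_law n : (M <= n)%N -> beta [set u | Fn n (window id L0 u)] = prodc%:E.
Proof.
move=> Mn; rewrite (window_law (@Fn_dep n)); congr EFin.
have [B0 hB0] := stack_outputs_law s (fun i e => (fb i e)%:R) t_law oP Mn.
rewrite -(bitsE_dep _ _ (leq_maxl _ B0)); last first.
  exact: (finite_dep_comp (fun e : bool => e%:R : R) (@Fn_dep n)).
rewrite -[RHS](hB0 _ (leq_maxr (n + (H + n * H)) _)).
by congr bitsE; apply/funext => w; rewrite FnE.
Qed.

(** Union bound over the [M] possible sites of the tail estimate [stack_acc_tail]. *)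
Let Bad_law n (A : nat) : (M <= n)%N ->
  (A + 4 * \sum_(k < n) (q k : nat) <= \sum_(k < n) (s k : nat))%N ->
  fine (beta [set u | Bad n (window id L0 u)]) * theta ^+ A <= M%:R * theta ^+ M.
Proof.
move=> Mn supply; have [D Bdep] := Bad_dep n; rewrite (window_law Bdep) /=.
have th0 : 0 < theta by apply: lt_trans theta1.
have /choice[B0 hB0] : forall k : nat, exists B0, forall D', (B0 <= D')%N ->
    bitsE (fun=> 2^-1) D' (fun w => ((stack_acc t (sshift k s) (sshift k q) w (n - k)
     (sshift (n - k) w) <= 0)%R : nat)%:R) * theta ^+ (\sum_(j < n - k) (sshift k s j : nat)) <=
    theta ^+ (4 * \sum_(j < n - k) (sshift k q j : nat)).
  by move=> k; apply: stack_acc_tail.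
have bad_le (k : 'I_M) : exists D0, forall D', (D0 <= D')%N ->
    bitsE (fun=> 2^-1) D' (fun w => (bad n w k)%:R) * theta ^+ A <= theta ^+ M.
  exists (k + B0 k)%N => D' kD'; have kn : (k <= n)%N by apply: leq_trans Mn; exact: ltnW.
  have -> : D' = (k + (D' - k))%N by rewrite subnKC//; lia.
  rewrite (bitsE_sshift _ _ _ (fun w => ((stack_acc t (sshift k s) (sshift k q) w (n - k)
     (sshift (n - k) w) <= 0)%R : nat)%:R)).
  have := hB0 k (D' - k)%N; rewrite leq_subRL; last by lia.
  move=> /(_ kD'); set e := bitsE _ _ _.
  set Sk := (\sum_(j < n - k) (sshift k s j : nat))%N.
  set Qk := (\sum_(j < n - k) (sshift k q j : nat))%N => eS.
  have split_sum (z : nat -> bool) n' r : n' = (k + r)%N -> (\sum_(j < n') (z j : nat) =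
      \sum_(j < k) (z j : nat) + \sum_(j < r) (sshift k z j : nat))%N.
    by move=> ->; exact: big_split_ord.
  have split z := split_sum z n _ (esym (subnKC kn)).
  have sk : (\sum_(j < k) (s j : nat) <= k)%N.
    rewrite -[leqRHS]muln1 -[X in (_ <= X * _)%N](card_ord k) -sum_nat_const.
    by apply: leq_sum => j _; exact: leq_b1.
  (* Leaving out the first [k] sites loses at most [k < M] sources, hence the factor [theta ^+ M] in
     the bound. *)
  have AQ : (A + 4 * Qk <= M + Sk)%N.
    move: supply; rewrite !split -/Sk -/Qk; have := ltn_ord k; lia.
  have thS : 0 < theta ^+ Sk by exact: exprn_gt0.
  rewrite -(ler_pM2r thS) -exprD -mulrA [theta ^+ A * _]mulrC mulrA.
  apply: le_trans (ler_wpM2r (exprn_ge0 A (ltW th0)) eS) _.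
  by rewrite -exprD ler_eXn2l// addnC.
have /choice[D0 hD0] : forall k : 'I_M, exists D0, forall D', (D0 <= D')%N ->
    bitsE (fun=> 2^-1) D' (fun w => (bad n w k)%:R) * theta ^+ A <= theta ^+ M by [].
pose D' := maxn D (\max_(k < M) D0 k).
have half (k : nat) : 0 <= (2^-1 : R) <= 1 by lra.
rewrite -(bitsE_dep _ (finite_dep_comp (fun e : bool => e%:R : R) Bdep) (leq_maxl D (\max_(k < M) D0 k))).
have thA : 0 <= theta ^+ A by rewrite exprn_ge0// ltW.
apply: (@le_trans _ _ ((\sum_(k < M) bitsE (fun=> 2^-1) D' (fun w => (bad n w k)%:R)) * theta ^+ A)).
  rewrite ler_wpM2r// -bitsE_sum; apply: ler_bitsE => [|w]; first exact: half.
  rewrite /Bad; case: (boolP [exists k : 'I_M, bad n w k]) => [/existsP[k bk]|_];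
    last by apply: sumr_ge0 => k _; rewrite ler0n.
  by rewrite (bigD1 k)//= bk lerDl; apply: sumr_ge0 => i _; rewrite ler0n.
rewrite mulr_suml.
have -> : M%:R * theta ^+ M = \sum_(k < M) theta ^+ M by rewrite sumr_const card_ord mulr_natl.
apply: ler_sum => k _; apply: hD0; apply: leq_trans (leq_maxr _ _).
exact: (leq_bigmax (F := D0)).
Qed.

(** Emptying the stack further to the right only changes the initial stack at site [n], which a good
    request ignores; the samples are thus eventually constant and [output] is their common value. *)
Let outputs_ref n u (k : nat) j : (k < n)%N -> q k -> ~~ bad n (window id L0 u) k ->
  output a b t N x u (L0 + k%:Z) j =
  nth false (tree_val t (state t s q (window id L0 u) n k.+1)) j.
Proof.
move=> kn qk; rewrite /bad -ltNge => good.
have [n' nE] : exists n', (n - k)%N = n'.+1 by exists (n - k).-1; rewrite prednK// subn_gt0.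
have sE (k' : nat) : sshift k.+1 s k' = mark a b x (L0 + k%:Z + 1 + k'%:Z).
  by rewrite /sshift /s; congr mark; lia.
have qE (k' : nat) : sshift k.+1 q k' = request a b N x (L0 + k%:Z + 1 + k'%:Z).
  by rewrite /sshift /q; congr request; lia.
have uE : window id (L0 + k%:Z + 1) u = sshift k.+1 (window id L0 u).
  by apply/funext => k'; rewrite /window /sshift; congr (u _); lia.
have val_eq z' : tree_val t (stack t (sshift k.+1 s) (sshift k.+1 q)
      (sshift k.+1 (window id L0 u)) n' z') =
    tree_val t (state t s q (window id L0 u) n k.+1).
  have qk0 : sshift k q 0%N by rewrite /sshift addn0.
  rewrite nE in good.
  have := @coalesce_val _ t (sshift k s) (sshift k q) (sshift k (window id L0 u)) n'
    (sshift n'.+1 (sshift k (window id L0 u))) z' qk0 good.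
  rewrite !sshift_sshift !addn1 => ->; rewrite /state; congr tree_val.
  by rewrite -nE subnKC 1?ltnW// subnS nE.
have stable n1 : (n' <= n1)%N -> sample a b t N x u (L0 + k%:Z) n1 =
    tree_val t (state t s q (window id L0 u) n k.+1).
  move=> n'n1; rewrite /sample -(subnKC n'n1).
  have -> : (fun k0 : nat => mark a b x (L0 + k%:Z + 1 + k0%:Z)) = sshift k.+1 s.
    by apply/funext => k'; rewrite sE.
  have -> : (fun k0 : nat => request a b N x (L0 + k%:Z + 1 + k0%:Z)) = sshift k.+1 q.
    by apply/funext => k'; rewrite qE.
  by rewrite uE stack_cat val_eq.
rewrite /output; apply/asboolP/idP => [[n0 h]|h].
  by have := h (maxn n0 n') (leq_maxl _ _); rewrite stable// leq_maxr.
by exists n' => n1 n'n1; rewrite stable.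
Qed.

Let rect_ref n u : (M <= n)%N -> ~~ Bad n (window id L0 u) ->
  rect J B (output_bits a b t N x u) <-> Fn n (window id L0 u).
Proof.
move=> Mn /existsPn good.
have outE (i : 'I_m) : output_bits a b t N x u (L0 + (N + i)%N%:Z) =
    ref n (window id L0 u) (N + i)%N.
  have iM : (N <= N + i < N + m)%N by rewrite leq_addr ltn_add2l ltn_ord.
  have /and3P[oN oi qi] := oP iM.
  have kM : (N + i - o (N + i) < M)%N by apply: leq_ltn_trans (leq_subr _ _) _; case/andP: iM.
  rewrite /output_bits -/(o (N + i)).
  have -> : L0 + (N + i)%N%:Z - (o (N + i))%:Z = L0 + (N + i - o (N + i))%N%:Z by lia.
  rewrite (outputs_ref _ (n := n))//; first exact: leq_trans kM Mn.
  exact: (good (Ordinal kM)).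
split=> [h|/forallP h].
  apply/forallP => i; apply/implyP => iJ; rewrite -outE in_setE; exact: h.
move=> j jJ; have /andP[lj jlm] := Jlm jJ.
have im : (absz (j - l)%R < m)%N by lia.
have := h (Ordinal im); rewrite -outE /fb /=.
have -> : L0 + (N + absz (j - l)%R)%N%:Z = j by rewrite /L0; lia.
by rewrite jJ /= in_setE.
Qed.

Let rectE : rect J B = [set u | (fun v => [forall i : 'I_m, fb (N + i) (v i)]) (window id l u)].
Proof.
apply/seteqP; split => u /= h.
  apply/forallP => i; apply/implyP => iJ; rewrite in_setE /window.
  have E : L0 + (N + i)%N%:Z = l + (i : nat)%:Z by rewrite /L0; lia.
  by move: iJ; rewrite E; exact: h.
move=> j jJ; have /andP[lj jlm] := Jlm jJ.
have im : (absz (j - l)%R < m)%N by lia.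
have := forallP h (Ordinal im); rewrite /fb /window /=.
have -> : L0 + (N + absz (j - l)%R)%N%:Z = j by rewrite /L0; lia.
have -> : l + (absz (j - l)%R)%:Z = j by lia.
by rewrite jJ /= in_setE.
Qed.

Let beta_c_rect : beta_c (rect J B) = prodc%:E.
Proof.
have dep : finite_dep m (fun v : nat -> bool => [forall i : 'I_m, fb (N + i) (v i)]).
  by move=> w w' ww'; apply: eq_forallb => i; rewrite ww'.
rewrite rectE (product_windowT beta_cE (f := id) _ _ dep)//; congr EFin.
have -> : (fun k : nat => fine (bernoulli_prob c [set e | id e])) = (fun=> c).
  by apply/funext => k; rewrite (@bernoulli_prob1 R c true).
rewrite /prodc prod_nat_addl -(bitsE_prod (fun=> c) m (fun i e => (fb (N + i) e)%:R)).
by congr bitsE; apply/funext => w; rewrite natr_forall.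
Qed.

(** True and reference outputs differ only on [Bad n], whose probability decreases geometrically in
    the surplus [A] while the target value does not depend on [n]. *)
Lemma output_rect : beta [set u | rect J B (output_bits a b t N x u)] = beta_c (rect J B).
Proof.
rewrite beta_c_rect.
set E := [set u | _].
have mE : measurable E.
  have := measurable_output_bits a b t N mS (X := fun=> x) (U := id) (@measurable_cst _ _ _ _ setT x)
    (@measurable_id _ _ setT) measurableT (measurable_rect J (fun i => _ : measurable (B i))).
  by rewrite setTI; apply.
have key (A : nat) : `|fine (beta E) - prodc| * theta ^+ A <= M%:R * theta ^+ M.
  (* The extra [M] forces [n >= M], since at most [n] marks lie in the window. *)
  have [n supply] := sx L0 (M + A).
  have supply' : (A + 4 * \sum_(k < n) (q k : nat) <= \sum_(k < n) (s k : nat))%N.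
    by apply: leq_trans supply; rewrite -addnA leq_addl.
  have Mn : (M <= n)%N.
    have : (\sum_(k < n) (s k : nat) <= n)%N.
      rewrite -[leqRHS]muln1 -[X in (_ <= X * _)%N](card_ord n) -sum_nat_const.
      by apply: leq_sum => j _; exact: leq_b1.
    by apply: leq_trans; apply: leq_trans supply; rewrite -addnA leq_addr.
  have th0 : 0 <= theta by apply: ltW; apply: lt_trans theta1.
  apply: le_trans (Bad_law Mn supply'); rewrite ler_wpM2r ?exprn_ge0//.
  set F := [set u | Fn n (window id L0 u)].
  set G := [set u | Bad n (window id L0 u)].
  have mid e : measurable [set e' : bool | id e' = e] by [].
  have mF : measurable F by exact: (measurable_window mid L0 (@Fn_dep n)).
  have mG : measurable G by have [D /(measurable_window mid L0)] := Bad_dep n.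
  have FE : fine (beta F) = prodc by rewrite /F Fn_law.
  have EFG : E `<=` F `|` G.
    move=> u Eu; case: (boolP (Bad n (window id L0 u))) => h; first by right.
    by left; exact: (proj1 (rect_ref Mn h) Eu).
  have FEG : F `<=` E `|` G.
    move=> u Fu; case: (boolP (Bad n (window id L0 u))) => h; first by right.
    by left; exact: (proj2 (rect_ref Mn h) Fu).
  have le1 (A1 A2 : set (seqZ bool)) : measurable A1 -> measurable A2 -> A1 `<=` A2 `|` G ->
      fine (beta A1) <= fine (beta A2) + fine (beta G).
    move=> m1 m2 sub; rewrite -lee_fin EFinD !fineK ?fin_num_measure//.
    apply: (@le_trans _ _ (beta (A2 `|` G))); last exact: measureU2.
    by apply: le_measure; rewrite ?inE//; exact: measurableU.
  rewrite -FE ler_norml; have := le1 _ _ mE mF EFG; have := le1 _ _ mF mE FEG; lra.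
rewrite -[LHS]fineK ?fin_num_measure//; congr EFin; apply/eqP; rewrite -subr_eq0 -normr_eq0.
by apply/eqP; exact: exp_bounded_eq0 theta1 (normr_ge0 _) key.
Qed.

End Window.
End OutputLaw.

Section ProductDomination.
Context {d1 d2 : measure_display} {T1 : measurableType d1} {T2 : measurableType d2}
  {R : realType}.

(** Almost every section of a null set is [mu2]-null, hence [mu1]-null. *)
Lemma product_dominates (P : probability T1 R) (mu1 mu2 : probability T2 R)
    (E : set (T1 * T2)) :
  mu1 `<< mu2 -> measurable E -> (P \x mu2)%E E = 0%E -> (P \x mu1)%E E = 0%E.
Proof.
move=> /null_content_dominatesP mu12 mE.
have m1 := measurable_fun_xsection mu1 mE.
have m2 := measurable_fun_xsection mu2 mE.
rewrite /product_measure1 => int0.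
have : (\int[P]_x `|mu2 (xsection E x)| = 0)%E.
  by rewrite -[RHS]int0; apply: eq_integral => x _; rewrite gee0_abs.
move=> /(ae_eq_integral_abs P measurableT m2) ae0.
have : ae_eq P setT (mu1 \o xsection E) (cst 0%E).
  apply: filterS ae0 => x h _; apply: mu12; first exact: measurable_xsection.
  exact: h.
move=> /(ae_eq_integral_abs P measurableT m1) <-.
by apply: eq_integral => x _; rewrite gee0_abs.
Qed.

Lemma product_measure_ae_cst (P : probability T1 R) (mu : probability T2 R)
    (E : set (T1 * T2)) (r : \bar R) :
  measurable E -> (0 <= r)%E -> P.-negligible [set x | mu (xsection E x) <> r] ->
  (P \x mu)%E E = r.
Proof.
move=> mE r0 neg; rewrite /product_measure1.
rewrite (ge0_ae_eq_integral (g := cst r))//.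
- by rewrite integral_cst//= probability_setT mule1.
- exact: measurable_fun_xsection.
- apply: (negligibleS _ neg) => x /= h; apply: contra_not h => hx _; exact: hx.
Qed.

End ProductDomination.

(** * The image measure of the factor map *)

Section IidFactor.
Context {d : measure_display} {S : measurableType d} {R : realType}.
Variables (a b : S) (rho_ : int -> probability S R) (rho : probability (seqZ S) R) (p : R).
Hypotheses (ab : a != b) (mS : forall B : set S, measurable B)
  (rhoE : is_product_measure rho_ rho) (p0 : 0 < p) (p1 : p < 1)
  (pa : forall i, p <= fine (rho_ i [set a])) (pb : forall i, p <= fine (rho_ i [set b])).

(** Marks, anchors and requests do not see the content of the pairs, and the coin read at a mark of
    the resampled sequence is the bit of [u] written there. *)
Lemma output_bits_resample t N x u :
  output_bits a b t N (resample a b predT u x) (mark_bits a (resample a b predT u x)) =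
  output_bits a b t N x u.
Proof.
have anchorE i : anchor a b (resample a b predT u x) i = anchor a b x i.
  rewrite /anchor mark_resample//; congr andb.
  by apply: eq_forallb => k; rewrite mark_resample.
have offsetE i : offset a b N (resample a b predT u x) i = offset a b N x i.
  have [h|[k [ak kmin]]] := last_anchor a b x i.
    by rewrite !offset_noanchor// => k; rewrite anchorE.
  rewrite (offset_last N ak kmin) (@offset_last _ _ _ _ N _ _ k) ?anchorE// => j jk.
  by rewrite anchorE; exact: kmin.
apply/funext => i; rewrite /output_bits offsetE /output; congr asbool; apply/propext.
have E n : sample a b t N (resample a b predT u x) (mark_bits a (resample a b predT u x))
    (i - (offset a b N x i)%:Z) n = sample a b t N x u (i - (offset a b N x i)%:Z) n.
  rewrite /sample; congr tree_val.
  have -> : (fun k : nat => mark a b (resample a b predT u x) (i - (offset a b N x i)%:Z + 1 + k%:Z))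
    = (fun k : nat => mark a b x (i - (offset a b N x i)%:Z + 1 + k%:Z)).
    by apply/funext => k; rewrite mark_resample.
  have -> : (fun k : nat => request a b N (resample a b predT u x) (i - (offset a b N x i)%:Z + 1 + k%:Z))
    = (fun k : nat => request a b N x (i - (offset a b N x i)%:Z + 1 + k%:Z)).
    by apply/funext => k; rewrite /request offsetE.
  apply: eq_stack => k mk; rewrite /window /mark_bits /= resample_3//=.
  by case: (u _); rewrite ?eqxx// eq_sym (negPf ab).
by split=> -[n0 h]; exists n0 => n nn; have := h n nn; rewrite E.
Qed.

Let w i c : R := fine (rho_ i [set c]).

Let w01 i c : 0 <= w i c <= 1.
Proof. by rewrite /w fine_ge0//= -lee_fin fineK ?probability_le1// fin_num_measure. Qed.

(** The shifted measure is the product of the [rho_ (i + 1)], so [dominates_sum_sqr] compares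
    neighbouring marginals. *)
Let sum_diff c : pushforward rho left_shift `<< rho ->
  exists C : R, forall (l : int) n,
    \sum_(k < n) (w (l + k%:Z) c - w (l + k%:Z + 1) c) ^+ 2 <= C.
Proof.
move=> ns.
have mshift : measurable_fun setT (@left_shift _ S).
  by apply: measurable_seqZ => i; exact: measurable_coord.
have [Q QE] := pushforward_probability rho mshift.
have Qpush : pushforward rho left_shift = Q by apply/funext => E; rewrite QE.
rewrite Qpush in ns.
have Qprod : is_product_measure (fun i => rho_ (i + 1)) Q.
  move=> I B mB; rewrite QE.
  pose I' := [fset (i + 1)%R | i in I]%fset.
  have -> : left_shift @^-1` [set x | forall i, i \in I -> B i (x i)] =
      rect I' (fun i => B (i - 1)).
    apply/seteqP; split => x /= h i.
      move=> /imfsetP[j /= jI ->]; rewrite addrK; exact: h.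
    move=> iI; have := h (i + 1); rewrite addrK; apply.
    by apply/imfsetP; exists i.
  rewrite rhoE// big_imfset /=; last by move=> i j _ _ /addIr.
  by apply: eq_bigr => i _; rewrite addrK.
have [C hC] := dominates_sum_sqr (f := fun s => s == c) rhoE Qprod (fun=> mS _) ns.
exists C => l n; apply: le_trans (hC l n).
rewrite le_eqVlt; apply/orP; left; apply/eqP; apply: eq_bigr => k _.
have -> : [set s | s == c] = [set c] by apply/seteqP; split => s /= /eqP.
by rewrite /w.
Qed.

(** Exchanging adjacent letters makes the bias exactly one half when the two marginals coincide:
    [t - 1/2] has numerator [b0 (a0 - a1) - a0 (b0 - b1)] and denominator [2 D], with [D >= 2 p^2],
    whence the constant [8 p^4]. *)
Lemma mark_bias_sum : pushforward rho left_shift `<< rho ->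
  exists C : R, forall (l : int) n,
    \sum_(k < n) (mark_bias a b rho_ (l + k%:Z) - 2^-1) ^+ 2 <= C.
Proof.
move=> ns; have [Ca hCa] := sum_diff a ns; have [Cb hCb] := sum_diff b ns.
exists ((Ca + Cb) / (8 * p ^+ 4)) => l n.
have := hCa (l + 3) n; have := hCb (l + 3) n.
have pp : 0 < 8 * p ^+ 4 by rewrite mulr_gt0// exprn_gt0.
rewrite ler_pdivlMr// => hb ha; apply: le_trans (lerD ha hb).
rewrite mulr_suml -big_split /=; apply: ler_sum => k _.
rewrite /mark_bias -!/(w _ _).
have e3 : l + k%:Z + 3 = l + 3 + k%:Z by lia.
have e4 : l + k%:Z + 4 = l + 3 + k%:Z + 1 by lia.
rewrite e3 e4; set i := l + 3 + k%:Z.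
have := pa i; have := pa (i + 1); have := pb i; have := pb (i + 1).
have := w01 i a; have := w01 (i + 1) a; have := w01 i b; have := w01 (i + 1) b.
rewrite -!/(w _ _).
move: (w i a) (w (i + 1) a) (w i b) (w (i + 1) b) => a0 a1 b0 b1 b101 b001 a101 a001 pb1 pb0 pa1 pa0.
set D := a0 * b1 + b0 * a1.
have D2 : 2 * p ^+ 2 <= D.
  have := ler_pM (ltW p0) (ltW p0) pa0 pb1; have := ler_pM (ltW p0) (ltW p0) pb0 pa1.
  by rewrite /D expr2; lra.
have D0 : 0 < D by apply: lt_le_trans D2; rewrite mulr_gt0// exprn_gt0.
have -> : a0 * b1 / D - 2^-1 = (a0 * b1 - b0 * a1) / (2 * D) by rewrite /D; field; rewrite gt_eqF.
have num : (a0 * b1 - b0 * a1) ^+ 2 <= 2 * ((a0 - a1) ^+ 2 + (b0 - b1) ^+ 2).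
  have -> : a0 * b1 - b0 * a1 = b0 * (a0 - a1) - a0 * (b0 - b1) by ring.
  have := sqr_ge0 (b0 * (a0 - a1) + a0 * (b0 - b1)).
  have h1 : (b0 * (a0 - a1)) ^+ 2 <= (a0 - a1) ^+ 2.
    by rewrite exprMn ler_piMl ?sqr_ge0// exprn_ile1//; lra.
  have h2 : (a0 * (b0 - b1)) ^+ 2 <= (b0 - b1) ^+ 2.
    by rewrite exprMn ler_piMl ?sqr_ge0// exprn_ile1//; lra.
  move: (b0 * (a0 - a1)) (a0 * (b0 - b1)) h1 h2 => y z h1 h2; nra.
rewrite expr_div_n mulrAC ler_pdivrMr; last by rewrite exprn_gt0// mulr_gt0.
have p2 : 0 <= p ^+ 2 by rewrite exprn_ge0// ltW.
have D4 : 16 * p ^+ 4 <= (2 * D) ^+ 2.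
  have -> : 16 * p ^+ 4 = (4 * p ^+ 2) ^+ 2 by ring.
  by apply: lerXn2r; rewrite ?nnegrE; lra.
have X0 : 0 <= (a0 - a1) ^+ 2 + (b0 - b1) ^+ 2 by rewrite addr_ge0 ?sqr_ge0.
apply: le_trans (ler_wpM2r (ltW pp) num) _.
have -> : 2 * ((a0 - a1) ^+ 2 + (b0 - b1) ^+ 2) * (8 * p ^+ 4) =
  ((a0 - a1) ^+ 2 + (b0 - b1) ^+ 2) * (16 * p ^+ 4) by ring.
exact: ler_wpM2l.
Qed.

Lemma iid_factor_exists : pushforward rho left_shift `<< rho ->
  exists (c : R) (nu0 : probability S R) (nu : probability (seqZ S) R)
         (phi : seqZ S -> seqZ S),
    [/\ 0 < c < 1, nu0 [set a] = c%:E, nu0 [set b] = (1 - c)%:E,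
        is_product_measure (fun=> nu0) nu & is_factor rho nu phi].
Proof.
move=> ns; have [C hC] := mark_bias_sum ns.
have [e neg] := supplied_ae ab mS rhoE p0 p1 pa pb.
have [t [theta [c [th1 c01 t_law t_depth]]]] := @sampler_exists R e.
set N := (2 ^ e)%N in neg t_law.
have N0 : (0 < N)%N by rewrite expn_gt0.
have c01' : 0 <= c <= 1 by lra.
have pos_a i : 0 < fine (rho_ i [set a]) by apply: lt_le_trans (pa i).
have pos_b i : 0 < fine (rho_ i [set b]) by apply: lt_le_trans (pb i).
have bias01 i := mark_bias01 pos_a pos_b i.
have [beta betaE] : exists mu : probability (seqZ bool) R,
    is_product_measure (fun=> bernoulli_prob 2^-1) mu.
  by apply: (@bernoulli_sequence_exists R (fun=> 2^-1)) => i; lra.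
have [betac betacE] : exists mu : probability (seqZ bool) R,
    is_product_measure (fun=> bernoulli_prob c) mu.
  by apply: (@bernoulli_sequence_exists R (fun=> c)).
have [gam gamE] : exists mu : probability (seqZ bool) R,
    is_product_measure (fun i => bernoulli_prob (mark_bias a b rho_ i)) mu.
  by apply: bernoulli_sequence_exists => i; have := bias01 i; lra.
(* Each of the two products in [mark_bias] lies between [p ^+ 2] and 1, which keeps the bias at
   distance [p ^+ 2 / 2] from 0 and 1. *)
have p2 : 0 < p ^+ 2 / 2 by rewrite divr_gt0// exprn_gt0.
have biasE i : p ^+ 2 / 2 <= mark_bias a b rho_ i <= 1 - p ^+ 2 / 2.
  rewrite /mark_bias -!/(w _ _).
  have := pa (i + 3); have := pa (i + 4); have := pb (i + 3); have := pb (i + 4).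
  have := w01 (i + 3) a; have := w01 (i + 4) a; have := w01 (i + 3) b; have := w01 (i + 4) b.
  rewrite -!/(w _ _).
  move: (w (i + 3) a) (w (i + 4) a) (w (i + 3) b) (w (i + 4) b).
  move=> x0 x1 y0 y1 y101 y001 x101 x001 py1 py0 px1 px0.
  have h1 : p ^+ 2 <= x0 * y1 := ler_pM (ltW p0) (ltW p0) px0 py1.
  have h2 : p ^+ 2 <= y0 * x1 := ler_pM (ltW p0) (ltW p0) py0 px1.
  have g1 : x0 * y1 <= 1 by apply: mulr_ile1; lra.
  have g2 : y0 * x1 <= 1 by apply: mulr_ile1; lra.
  have q0 : 0 < p ^+ 2 by rewrite exprn_gt0.
  move: (x0 * y1) (y0 * x1) (p ^+ 2) h1 h2 g1 g2 q0 => X Y q h1 h2 g1 g2 q0.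
  have D0 : 0 < X + Y by lra.
  by apply/andP; split; [rewrite ler_pdivlMr//|rewrite ler_pdivrMr//]; nra.
have gam_beta : gam `<< beta.
  apply: (kakutani_dominates (eta := 2^-1) (C := C) betaE gamE) => //.
  - by move=> i; lra.
  - by move=> i; have := bias01 i; lra.
have beta_gam : beta `<< gam.
  apply: (kakutani_dominates (C := C) gamE betaE p2 biasE).
  - by move=> i; lra.
  - by move=> l n; under eq_bigr do rewrite -sqrrN opprB; exact: hC.
pose f (v : bool) : S := if v then a else b.
have mf : measurable_fun setT f by [].
have [nu0 nu0E] := pushforward_probability (bernoulli_prob c) mf.
have [nu nuE] := pushforward_probability betac (measurable_letters_of a b).
pose Psi (z : seqZ S * seqZ bool) := output_bits a b t N z.1 z.2.
have mPsi : measurable_fun setT Psi.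
  exact: measurable_output_bits.
have [Q QE] := pushforward_probability (rho \x beta)%E mPsi.
(* For almost every [x] the section over [x] already has the right measure, by [output_rect] on a
   window that contains [J]. *)
have Qc E : measurable E -> Q E = betac E.
  apply: eq_seqZ_measure => J B mB; rewrite QE.
  have mE : measurable (Psi @^-1` rect J B).
    by have := mPsi measurableT _ (measurable_rect J mB); rewrite setTI.
  apply: (product_measure_ae_cst mE (measure_ge0 _ _)).
  apply: (negligibleS _ neg) => x /=; apply: contra_not => sx.
  pose K := (\max_(j <- J) `|j|%N)%N.
  have JK j : j \in J -> - K%:Z <= j < - K%:Z + (K.*2.+1)%:Z.
    move=> jJ; have : (`|j| <= K)%N by apply: leq_bigmax_seq.
    by rewrite -addnn; lia.
  rewrite -(output_rect mS N0 th1 c01' t_law t_depth betaE betacE sx B JK).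
  by congr (beta _); apply/seteqP; split => u /=; rewrite /xsection /= in_setE.
have phiE z : factor_map a b t N (resample a b predT z.2 z.1) = letters_of a b (Psi z).
  by rewrite /factor_map output_bits_resample.
have mphi := measurable_factor_map a b t N mS.
have ba : (b == a) = false by rewrite eq_sym; exact: negbTE.
exists c, nu0, nu, (factor_map a b t N); split=> //.
- rewrite nu0E (_ : f @^-1` _ = [set true]); first exact: bernoulli_prob1 c01'.
  by apply/seteqP; split => -[] //= /eqP; rewrite /f ba.
- rewrite nu0E (_ : f @^-1` _ = [set false]); first exact: bernoulli_prob1 c01'.
  by apply/seteqP; split => -[] //= /eqP; rewrite /f (negbTE ab).
- move=> I B mB; rewrite nuE.
  have -> : letters_of a b @^-1` [set x | forall i, i \in I -> B i (x i)] =
      rect I (fun i => f @^-1` B i) by [].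
  by rewrite betacE//; apply: eq_bigr => i _; rewrite nu0E.
split=> //; first exact: factor_map_shift.
have [Q' Q'E] := pushforward_probability rho mphi.
have -> : pushforward rho (factor_map a b t N) = Q' by apply/funext => E; rewrite Q'E.
pose G E := Psi @^-1` (letters_of a b @^-1` E).
have mG E : measurable E -> measurable (G E).
  move=> mE; rewrite /G -[X in measurable X]setTI; apply: mPsi => //.
  rewrite -[X in measurable X]setTI; exact: measurable_letters_of.
(* [rho] is the law of the resampled sequence under [rho \x gam], so both [Q'] and [nu] are images
   under one map, of measures that differ only by [gam] and [beta]. *)
have Q'G E : measurable E -> Q' E = (rho \x gam)%E (G E).
  move=> mE; rewrite Q'E -(resample_law ab mS rhoE pos_a pos_b gamE); last first.
    by rewrite -[X in measurable X]setTI; exact: mphi.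
  by congr ((_ \x _)%E _); apply/seteqP; split => z /=; rewrite phiE.
have nuG E : measurable E -> nu E = (rho \x beta)%E (G E).
  move=> mE; rewrite nuE -Qc ?QE//.
  rewrite -[X in measurable X]setTI; exact: measurable_letters_of.
split; apply/null_content_dominatesP => E mE.
  move=> nuE0; apply: (etrans (Q'G E mE)).
  exact: product_dominates gam_beta (mG _ mE) (etrans (esym (nuG E mE)) nuE0).
move=> QE0; apply: (etrans (nuG E mE)).
exact: product_dominates beta_gam (mG _ mE) (etrans (esym (Q'G E mE)) QE0).
Qed.

End IidFactor.

(** * Conclusion for a finite alphabet of reals *)

Lemma measurable_alphabet (R : realType) (A : {fset R}) (a0 : A)
    (B : set (alphabet a0)) : measurable B.
Proof.
pose V (s : alphabet a0) : R := \val (s : A).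
exists (V @` B).
  have finVB : finite_set (V @` B).
    by apply: (sub_finite_set _ (finite_fset A)) => _ [s _ <-]; exact: (fsvalP (s : A)).
  rewrite -(image_id (V @` B)) -bigcup_imset1.
  by apply: fin_bigcup_measurable => // r _; exact: measurable_set1.
rewrite setTI; apply/seteqP; split => s /=; last by move=> Bs; exists s.
by move=> [s' Bs' /val_inj <-].
Qed.

Theorem theorem1 (R : realType) (A : {fset R}) (a0 : A)
    (rho_ : int -> probability (alphabet a0) R)
    (rho : probability (seqZ (alphabet a0)) R) :
  is_product_measure rho_ rho ->
  nonsingular rho ->
  doeblin rho_ ->
  exists (nu0 : probability (alphabet a0) R)
         (nu : probability (seqZ (alphabet a0)) R)
         (phi : seqZ (alphabet a0) -> seqZ (alphabet a0)),
    [/\ is_product_measure (fun=> nu0) nu,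
        is_factor rho nu phi &
        (1 < #|` A|)%N -> non_dirac nu0].
Proof.
move=> rhoE [ns _] [delta delta0 hdelta].
have mS := @measurable_alphabet R A a0.
(* Marks need two letters. Over a single letter all marginals coincide, and the identity is a factor
   onto [rho] itself. *)
have [[b ba]|all_a0] := pselect (exists b : alphabet a0, (a0 : alphabet a0) != b).
  (* The minimum with one half provides the strict bound [p < 1]. *)
  pose p := Num.min delta 2^-1.
  have p0 : 0 < p by rewrite /p lt_min delta0 invr_gt0 ltr0n.
  have p1 : p < 1 by rewrite /p gt_min; apply/orP; right; lra.
  have pS c i : p <= fine (rho_ i [set c]).
    rewrite /p ge_min; apply/orP; left; rewrite -lee_fin fineK ?fin_num_measure//.
    exact: ltW.
  have [c [nu0 [nu [phi [c01 nu0a nu0b nuE phi_factor]]]]] :=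
    iid_factor_exists ba mS rhoE p0 p1 (pS _) (pS _) ns.
  exists nu0, nu, phi; split=> // _ s; apply/eqP => s1.
  have not_other s' e : s != s' -> nu0 [set s'] = e%:E -> 0 < e -> False.
    move=> ss' s'e e0.
    have : (nu0 ([set s] `|` [set s']) <= 1)%E by exact: probability_le1.
    rewrite measureU//; last by apply/seteqP; split => x //= [-> ss]; rewrite ss eqxx in ss'.
    rewrite [X in (X + _)%E]s1 [X in (_ + X)%E]s'e -EFinD lee_fin; lra.
  have [sa|sa] := eqVneq s (a0 : alphabet a0).
    by apply: (not_other b _ _ nu0b); [rewrite sa|lra].
  by apply: (not_other (a0 : alphabet a0) _ sa nu0a); lra.
have a0E (s : alphabet a0) : s = a0.
  by apply: contrapT => sa; apply: all_a0; exists s; apply/eqP => sa'; exact: sa.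
have constE i : rho_ i = rho_ 0 :> (set _ -> _).
  apply/funext => B; have [Ba|Ba] := pselect (B a0).
    by rewrite (_ : B = setT) ?probability_setT//; apply/seteqP; split => s // _; rewrite (a0E s).
  by rewrite (_ : B = set0) ?measure0//; apply/seteqP; split => s //; rewrite (a0E s).
exists (rho_ 0), rho, id; split.
- by move=> I B mB; rewrite rhoE//; apply: eq_bigr => i _; rewrite constE.
- by split=> //; split.
- suff : (#|` A| <= 1)%N by case: leqP.
  have <- : #|` [fset \val a0]%fset| = 1%N by exact: cardfs1.
  apply: fsubset_leq_card; apply/fsubsetP => r rA; rewrite in_fset1; apply/eqP.
  by have := a0E [` rA]%fset => /(congr1 (fun s : alphabet a0 => \val (s : A))).
Qed.
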